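(* Let $\mathcal{HG}$ be the space of oriented (not necessarily connected) graphs over a field of characteristic $0$, $\mathcal G\subset\mathcal{HG}$ the span of connected graphs, and $\mathcal C\subset \mathcal G$ the span of connected graphs with at least one cut vertex. The Lie bracket and cobracket on $\mathcal{HG}$ induce a compatible graded Lie bialgebra structure on $\mathcal G/\mathcal C$.
   Context: Let $k$ be a field of characteristic $0$. A graph is a finite 1-dimensional CW complex (multiple edges and loops allowed) in which every vertex has valence at least $3$. Each edge consists of two half-edges; $\bar x$ denotes the other half of the edge containing the half-edge $x$. Each half-edge terminates at one vertex. An orientation of a graph is an ordering of its vertices together with a direction on each edge, where an odd permutation of the vertices or the reversal of one edge changes the orientation to the opposite one, so that every nonempty graph has exactly two orientations. $\mathcal{HG}$ is the $k$-vector space spanned by isomorphism classes of oriented graphs modulo the relation that $G$ with the opposite orientation equals $-G$ (so a graph with an orientation-reversing automorphism, e.g. one with a loop, is $0$). It is graded by the number of vertices. The product $G\cdot H$ is the disjoint union, with the vertices of $G$ ordered before those of $H$. $\mathcal G$ is the span of connected nonempty graphs. A cut vertex is a vertex whose deletion (as a point of the topological space) increases the number of connected components. $\mathcal{HC}\subset\mathcal{HG}$ is the span of all graphs with at least one cut vertex, and $\mathcal C=\mathcal G\cap\mathcal{HC}$ is the span of connected such graphs. There is a natural isomorphism $(\mathcal G+\mathcal{HC})/\mathcal{HC}\cong\mathcal G/\mathcal C$, and $\mathcal G/\mathcal C$ is spanned by cosets of connected graphs without cut vertices. Contraction of half-edges: let $x\ne y$ be half-edges of $G$ terminating at vertices $v\neq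 w$. Cut the edges containing $x$ and $y$ in half, glue $x$ to $y$ to form an edge $xy$ from $v$ to $w$, and, if $y\ne\bar x$, glue $\bar x$ to $\bar y$ to form an edge $\bar x\bar y$; finally collapse $xy$ to a point. The result is $G_{xy}$. Orientation: represent the orientation of $G$ so that $v$ is the first vertex, $w$ the second, $x$ is the initial half of its edge and $y$ the terminal half of its edge; in $G_{xy}$ the merged vertex is first, the other vertices follow in order, the edge $\bar x\bar y$ is directed from the vertex of $\bar y$ to the vertex of $\bar x$, and all other edges keep their directions. If $v=w$, set $G_{xy}=0$. Bracket: $[G,H]=\sum_{x\in G,\,y\in H}(G\cdot H)_{xy}$, summed over half-edges $x$ of $G$ and $y$ of $H$. Cobracket: a pair $\{x,y\}$ of half-edges (at distinct vertices) of $G$ is separating if $G_{xy}$ has more components than $G$. For $G$ connected, $\theta(G)=\sum_{\{x,y\}\ \text{separating}} \big(A\otimes B+(-1)^{ab}B\otimes A\big)$, where $G_{xy}=A\cdot B$ with $A,B$ connected having $a$ and $b$ vertices. The induced operations on $\mathcal G/\mathcal C$ are given, for connected graphs $G,H$ without cut vertices, by $[G+\mathcal C,H+\mathcal C]=[G,H]+\mathcal C$ and $\theta(G+\mathcal C)=\sum_{\{x,y\}\ \text{separating}} (A+\mathcal C)\otimes(B+\mathcal C)+(-1)^{ab}(B+\mathcal C)\otimes(A+\mathcal C)$. Conventions for ''compatible graded Lie bialgebra'': bracket and cobracket both have degree $-1$ with respect to the number of vertices. For homogeneous elements of degrees $a,b,c$ (denoted by the same letters), the bracket satisfies $[a,b]=(-1)^{ab}[b,a]$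 and the Jacobi identity $[[a,b],c]+(-1)^{a(b+c)}[[b,c],a]+(-1)^{c(a+b)}[[c,a],b]=0$. The cobracket satisfies $\tau\theta=\theta$, where $\tau(A\otimes B)=(-1)^{ab}B\otimes A$, and the co-Jacobi identity $(1+\sigma+\sigma^2)(\theta\otimes \mathrm{id})\theta=0$, where $\sigma$ is the cyclic permutation of the three tensor factors with the Koszul sign. Compatibility means $\theta[G,H]+[\theta(G),H]+(-1)^g[G,\theta(H)]=0$ for $G$ of degree $g$, where $[A\otimes B,H]=(-1)^aA\otimes[B,H]+(-1)^{bh}[A,H]\otimes B$ and $[G,A\otimes B]=[G,A]\otimes B+(-1)^{ga+a}A\otimes[G,B]$ ($a,b,g,h$ being the degrees of $A,B,G,H$). *)

(* Defs.v *)
From HB Require Import structures.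
From mathcomp Require Import all_boot all_order all_algebra.
From mathcomp Require Import boolp classical_sets.
From mathcomp Require Import monalg.

Set Implicit Arguments.
Unset Strict Implicit.
Unset Printing Implicit Defensive.

Import GRing.Theory.
Local Open Scope quotient_scope.
Local Open Scope ring_scope.

Section Span.
Variables (k : fieldType) (V : lmodType k) (X : set V).

Definition span : {pred V} := fun v => `[< exists s : seq (k * V),
  (forall p, p \in s -> X p.2) /\ v = \sum_(p <- s) p.1 *: p.2 >].

Lemma span_submod_closed : submod_closed span.
Proof.
split=> [|a u v /asboolP[s [sX ->]] /asboolP[t [tX ->]]]; apply/asboolP.
  by exists [::]; rewrite big_nil.
exists ([seq (a * p.1, p.2) | p <- s] ++ t); split=> [p|].
  by rewrite mem_cat => /orP[/mapP[q /sX qX ->]|/tX].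
rewrite big_cat big_map scaler_sumr /=; congr (_ + _).
by apply: eq_bigr => p _; rewrite scalerA.
Qed.

HB.instance Definition _ := GRing.isSubmodClosed.Build k V span
  (GRing.submod_closed_semi span_submod_closed).

Lemma mem_span v : X v -> v \in span.
Proof.
move=> Xv; apply/asboolP; exists [:: (1, v)]; split=> [p|].
  by rewrite inE => /eqP->.
by rewrite big_seq1 scale1r.
Qed.

Record subspace := Subspace { subspace_val : V; _ : subspace_val \in span }.

HB.instance Definition _ := [isSub for subspace_val].
HB.instance Definition _ := [Choice of subspace by <:].
HB.instance Definition _ := [SubChoice_isSubLmodule of subspace by <:].

(* {ideal_quot I} is the quotient of an additive group by any subgroup I. *)
Definition quotient := {ideal_quot span}.

HB.instance Definition _ := GRing.Zmodule.on quotient.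

Definition coset (v : V) : quotient := \pi_{ideal_quot span} v.

Lemma coset_eq u v : (coset u == coset v) = (u - v \in span).
Proof. by rewrite /coset piE Quotient.equivE. Qed.

Lemma cosetD u v : coset (u + v) = coset u + coset v.
Proof. by rewrite /coset !piE. Qed.

Definition quotient_scale (a : k) (q : quotient) : quotient :=
  coset (a *: repr q).

Lemma cosetZ a v : quotient_scale a (coset v) = coset (a *: v).
Proof.
apply/eqP; rewrite coset_eq -scalerBr rpredZ // -coset_eq.
by rewrite /coset reprK.
Qed.

Lemma coset_repr (q : quotient) : coset (repr q) = q.
Proof. exact: reprK. Qed.

Lemma quotient_scaleA a b q :
  quotient_scale a (quotient_scale b q) = quotient_scale (a * b) q.
Proof. by rewrite -[q]coset_repr !cosetZ scalerA. Qed.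

Lemma quotient_scale1 : left_id 1 quotient_scale.
Proof. by move=> q; rewrite -[q]coset_repr cosetZ scale1r. Qed.

Lemma quotient_scaleDr : right_distributive quotient_scale +%R.
Proof.
move=> a p q; rewrite -[p]coset_repr -[q]coset_repr.
by rewrite -cosetD !cosetZ scalerDr cosetD.
Qed.

Lemma quotient_scaleDl q : {morph quotient_scale^~ q : a b / a + b}.
Proof. by move=> a b; rewrite -[q]coset_repr !cosetZ scalerDl cosetD. Qed.

HB.instance Definition _ := GRing.Zmodule_isLmodule.Build k quotient
  quotient_scaleA quotient_scale1 quotient_scaleDr quotient_scaleDl.

Lemma coset_is_linear : linear coset.
Proof. by move=> a u v; rewrite cosetD -cosetZ. Qed.

HB.instance Definition _ :=
  GRing.isLinear.Build k V quotient *:%R coset coset_is_linear.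

End Span.

Section Tensor.
Variables (k : fieldType) (V W : lmodType k).

Let F := {malg k[(V * W)%type]}.

Definition tensor_relation : set F := [set r | exists a : k,
  (exists v v' w,
     r = << (a *: v + v', w) >> - (a *: << (v, w) >> + << (v', w) >>)) \/
  (exists v w w',
     r = << (v, a *: w + w') >> - (a *: << (v, w) >> + << (v, w') >>))].

Definition tensor := quotient tensor_relation.

HB.instance Definition _ := GRing.Lmodule.on tensor.

Definition tpure (v : V) (w : W) : tensor :=
  coset tensor_relation << (v, w) >>.

End Tensor.

Notation "v '\ox' w" := (tpure v w) (at level 40, left associativity).

Section LieBialgebra.
Variables (k : fieldType) (V : lmodType k) (hom : nat -> {pred V}).

Record homog := Homog {
  deg : nat;
  homog_val :> V;
  homogP : homog_val \in hom deg }.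

Record grading : Prop := Grading {
  grading_submod : forall n, submod_closed (hom n);
  grading_generates : forall v : V,
    exists s : seq homog, v = \sum_(a <- s) (a : V);
  grading_direct : forall (N : nat) (u : nat -> V),
    (forall n, u n \in hom n) -> \sum_(n < N) u n = 0 ->
    forall n, (n < N)%N -> u n = 0 }.

Definition tsum (s : seq (homog * homog)) : tensor V V :=
  \sum_(p <- s) (p.1 : V) \ox (p.2 : V).

Variables (br : V -> V -> V) (th : V -> tensor V V).

Definition sg (n : nat) : k := (-1) ^+ n.

(* In the clauses about the cobracket, t chooses for every homogeneous a an
   expression of th a as a sum of homogeneous pure tensors (one exists by
   lie_cobracket_degree); Koszul-signed operations on V \ox V and
   V \ox V \ox V are written out on these pure tensors. *)
Definition cobracket_expansion (t : homog -> seq (homog * homog)) :=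
  forall a : homog, th a = tsum (t a).

(* (1 + sigma + sigma^2) (u \ox v \ox w), where
   sigma (u \ox v \ox w) = (-1)^(w(u + v)) w \ox u \ox v. *)
Definition cyclic_sum (u v w : homog) : tensor (tensor V V) V :=
  (u : V) \ox (v : V) \ox (w : V)
  + sg (deg w * (deg u + deg v)) *: ((w : V) \ox (u : V) \ox (v : V))
  + sg (deg u * (deg v + deg w)) *: ((v : V) \ox (w : V) \ox (u : V)).

Record graded_lie_bialgebra : Prop := GradedLieBialgebra {
  lie_grading : grading;
  lie_bracket_linearl : forall v, linear (br^~ v);
  lie_bracket_linearr : forall u, linear (br u);
  lie_cobracket_linear : linear th;
  lie_bracket_degree : forall a b : homog,
    if (deg a + deg b)%N is n.+1 then br a b \in hom n else br a b = 0;
  lie_cobracket_degree : forall a : homog, exists2 s : seq (homog * homog),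
    th a = tsum s & all (fun p => (deg p.1 + deg p.2).+1 == deg a) s;
  lie_bracket_sym : forall a b : homog,
    br a b = sg (deg a * deg b) *: br b a;
  lie_jacobi : forall a b c : homog,
    br (br a b) c
    + sg (deg a * (deg b + deg c)) *: br (br b c) a
    + sg (deg c * (deg a + deg b)) *: br (br c a) b = 0;
  lie_cobracket_sym : forall t, cobracket_expansion t -> forall a : homog,
    \sum_(p <- t a) sg (deg p.1 * deg p.2) *: ((p.2 : V) \ox (p.1 : V)) = th a;
  lie_cojacobi : forall t, cobracket_expansion t -> forall a : homog,
    \sum_(p <- t a) \sum_(q <- t p.1) cyclic_sum q.1 q.2 p.2 = 0;
  lie_compatible : forall t, cobracket_expansion t -> forall g h : homog,
    th (br g h)
    + \sum_(p <- t g)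
        (sg (deg p.1) *: ((p.1 : V) \ox br p.2 h)
         + sg (deg p.2 * deg h) *: (br p.1 h \ox (p.2 : V)))
    + sg (deg g) *: \sum_(p <- t h)
        (br g p.1 \ox (p.2 : V)
         + sg (deg g * deg p.1 + deg p.1) *: ((p.1 : V) \ox br g p.2))
    = 0 }.

End LieBialgebra.

(* The vertices and half-edges of a graph are labelled by natural numbers, so
   that graphs form a small type; bar, term and init are meaningful on the
   labels in hs only.  The orientation is the order of the list vs together
   with the direction of each edge from its half in init to the other half. *)
Record graph_data := GraphData {
  vs : seq nat;
  hs : seq nat;
  bar : nat -> nat;
  term : nat -> nat;
  init : pred nat }.

Definition graph_wf (P : graph_data) : bool :=
  [&& uniq (vs P), uniq (hs P),
    all (fun h => [&& bar P h \in hs P, bar P (bar P h) == h, bar P h != h,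
                      term P h \in vs P & init P (bar P h) == ~~ init P h])
        (hs P)
    & all (fun v => 3 <= count (fun h => term P h == v) (hs P))%N (vs P)].

Record ograph := OGraph { ograph_data :> graph_data; _ : graph_wf ograph_data }.

HB.instance Definition _ := [isSub for ograph_data].
HB.instance Definition _ := gen_eqMixin ograph.
HB.instance Definition _ := gen_choiceMixin ograph.

Definition graph_iso (f g : nat -> nat) (P Q : graph_data) : Prop :=
  [/\ perm_eq [seq f v | v <- vs P] (vs Q),
      perm_eq [seq g h | h <- hs P] (hs Q),
      {in hs P, forall h, bar Q (g h) = g (bar P h)}
    & {in hs P, forall h, term Q (g h) = f (term P h)}].

Definition inversions (s t : seq nat) : nat :=
  \sum_(u <- s) count (fun v => (index u s < index v s)%N
                                && (index v t < index u t)%N) s.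

(* false if the isomorphism (f, g) carries the orientation of P to that of Q,
   true if it carries it to the opposite one: the parity of the permutation
   of the vertices plus the number of edges whose direction changes. *)
Definition iso_parity (f g : nat -> nat) (P Q : graph_data) : bool :=
  odd (inversions [seq f v | v <- vs P] (vs Q)
       + count (fun h => init P h && ~~ init Q (g h)) (hs P)).

(* The topological space of P, with the vertices outside K deleted, is cut
   into its vertices (inl) and open half-edges (inr).  Every edge survives the
   deletion of its endpoints, as an open interval. *)
Definition cells (P : graph_data) (K : pred nat) : seq (nat + nat) :=
  [seq inl v | v <- vs P & K v] ++ [seq inr h | h <- hs P].

Definition incident (P : graph_data) (c d : nat + nat) : bool :=
  match c, d with
  | inl v, inr h | inr h, inl v => term P h == v
  | inr h, inr h' => bar P h == h'
  | inl _, inl _ => false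
  end.

Definition ncomp (P : graph_data) (K : pred nat) : nat :=
  n_comp (fun c d : seq_sub (cells P K) => incident P (val c) (val d)) predT.

Definition connected (P : graph_data) : bool := ncomp P predT == 1%N.

Definition cut_vertex (P : graph_data) (v : nat) : bool :=
  (v \in vs P) && (ncomp P predT < ncomp P (predC1 v))%N.

Definition has_cut_vertex (P : graph_data) : bool :=
  has (cut_vertex P) (vs P).

(* The disjoint union makes the labels of the first graph even and those of the
   second one odd. *)
Definition inG (n : nat) : nat := n.*2.
Definition inH (n : nat) : nat := n.*2.+1.
Arguments inG : simpl never.
Arguments inH : simpl never.

Definition union_data (P Q : graph_data) : graph_data := {|
  vs := [seq inG v | v <- vs P] ++ [seq inH v | v <- vs Q];
  hs := [seq inG h | h <- hs P] ++ [seq inH h | h <- hs Q];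
  bar := fun n => if odd n then inH (bar Q n./2) else inG (bar P n./2);
  term := fun n => if odd n then inH (term Q n./2) else inG (term P n./2);
  init := fun n => if odd n then init Q n./2 else init P n./2 |}.

Lemma inG_inj : injective inG. Proof. exact: double_inj. Qed.
Lemma inH_inj : injective inH. Proof. by move=> m n [] /double_inj. Qed.
Lemma odd_inG n : odd (inG n) = false. Proof. exact: odd_double. Qed.
Lemma odd_inH n : odd (inH n) = true.
Proof. by rewrite /inH /= odd_double. Qed.
Lemma half_inG n : (inG n)./2 = n. Proof. exact: doubleK. Qed.
Lemma half_inH n : (inH n)./2 = n.
Proof. by rewrite /inH /= uphalf_double. Qed.
Lemma inG_inH m n : (inG m == inH n) = false.
Proof. by apply/eqP => /(congr1 odd); rewrite odd_inG odd_inH. Qed.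
Lemma inH_inG m n : (inH m == inG n) = false.
Proof. by rewrite eq_sym inG_inH. Qed.

Lemma graph_wfP (P : graph_data) : graph_wf P ->
  [/\ uniq (vs P), uniq (hs P),
      {in hs P, forall h, [/\ bar P h \in hs P, bar P (bar P h) = h,
         bar P h != h, term P h \in vs P & init P (bar P h) = ~~ init P h]}
    & {in vs P, forall v, 3 <= count (fun h => term P h == v) (hs P)}%N].
Proof.
case/and4P => uv uh /allP Ph /allP Pv; split=> // h /Ph.
by case/and5P=> ? /eqP ? ? ? /eqP ?.
Qed.

Lemma union_wf (G H : ograph) : graph_wf (union_data G H).
Proof.
case: G H => [P /graph_wfP[uvP uhP hP vP]] [Q /graph_wfP[uvQ uhQ hQ vQ]] /=.
have uni (s t : seq nat) : uniq s -> uniq t ->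
    uniq ([seq inG v | v <- s] ++ [seq inH v | v <- t]).
  move=> us ut; rewrite cat_uniq (map_inj_uniq inG_inj) (map_inj_uniq inH_inj).
  rewrite us ut andbT /=; apply/hasPn => n /mapP[m _ ->].
  by apply/mapP => -[j _ /eqP]; rewrite inH_inG.
have memG (s t : seq nat) v : v \in s ->
    inG v \in [seq inG v | v <- s] ++ [seq inH v | v <- t].
  by move=> vs; rewrite mem_cat map_f.
have memH (s t : seq nat) v : v \in t ->
    inH v \in [seq inG v | v <- s] ++ [seq inH v | v <- t].
  by move=> vt; rewrite mem_cat map_f ?orbT.
apply/and4P; split; rewrite /= ?uni //.
- apply/allP=> n; rewrite mem_cat => /orP[] /mapP[h hin ->].
  + rewrite !(odd_inG, half_inG) /=; have [a b c d e] := hP h hin.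
    by rewrite b e !eqxx (inj_eq inG_inj) c !memG.
  + rewrite !(odd_inH, half_inH) /=; have [a b c d e] := hQ h hin.
    by rewrite b e !eqxx (inj_eq inH_inj) c !memH.
- apply/allP=> n; rewrite mem_cat => /orP[] /mapP[v vin ->].
  + apply: leq_trans (vP v vin) _; rewrite count_cat !count_map.
    apply: leq_trans (leq_addr _ _); rewrite leq_eqVlt; apply/orP; left.
    by apply/eqP/eq_count => h /=; rewrite odd_inG half_inG (inj_eq inG_inj).
  + apply: leq_trans (vQ v vin) _; rewrite count_cat !count_map.
    apply: leq_trans (leq_addl _ _); rewrite leq_eqVlt; apply/orP; left.
    by apply/eqP/eq_count => h /=; rewrite odd_double uphalf_double (inj_eq inH_inj).
Qed.

Definition union (G H : ograph) : ograph := OGraph (union_wf G H).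

(* The same graph, reoriented so that the vertices of x and y are the first
   and the second one, x is initial and y is terminal. *)
Definition front_data (P : graph_data) (x y : nat) : graph_data := {|
  vs := [:: term P x, term P y
         & [seq u <- vs P | (u != term P x) && (u != term P y)]];
  hs := hs P;
  bar := bar P;
  term := term P;
  init := fun h => if h \in [:: x; bar P y] then true
                   else if h \in [:: y; bar P x] then false else init P h |}.

(* The merged vertex keeps the label of the vertex of x.  If y = bar x the
   two tests in bar are never met on the remaining half-edges. *)
Definition contract_data (P : graph_data) (x y : nat) : graph_data := {|
  vs := rem (term P y) (vs P);
  hs := [seq h <- hs P | (h != x) && (h != y)];
  bar := fun h => if bar P h == x then bar P y
                  else if bar P h == y then bar P x else bar P h;
  term := fun h => if term P h == term P y then term P x else term P h;
  init := init P |}.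

Lemma contract_wf (G : ograph) (x y : nat) :
  x \in hs G -> y \in hs G -> term G x != term G y ->
  graph_wf (contract_data (front_data G x y) x y).
Proof.
case: G => [P /graph_wfP[uv uh hP vP]] /= xP yP vw.
have xy : x != y by apply: contraNneq vw => ->.
have [bx bbx nx tx ix] := hP x xP; have [by_ bby ny ty iy] := hP y yP.
have vsE : vs (contract_data (front_data P x y) x y)
    = term P x :: [seq u <- vs P | (u != term P x) && (u != term P y)].
  by rewrite /= (negPf vw) eqxx.
have yx : y != x by rewrite eq_sym.
have bxy : bar P x != bar P y by apply: contraNneq xy => E; rewrite -bbx E bby.
have tin h : h \in hs P ->
    (if term P h == term P y then term P x else term P h)
      \in term P x :: [seq u <- vs P | (u != term P x) && (u != term P y)].
  move=> /hP[_ _ _ th _]; rewrite inE; case: ifPn => [_|hw]; first by rewrite eqxx.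
  by rewrite mem_filter hw th; case: (term P h == term P x).
rewrite /graph_wf vsE; apply/and4P; split.
- by rewrite /= mem_filter eqxx filter_uniq.
- exact: filter_uniq.
- rewrite [hs _]/= [term _]/= [bar _]/= [init _]/=.
  apply/allP => h; rewrite mem_filter => /andP[/andP[hx hy] hh].
  have [bh bbh nh _ ih] := hP h hh.
  have {}tin := tin h hh.
  rewrite tin !mem_filter !inE.
  case: (eqVneq (bar P h) x) => [hbx|hbx].
    have hE : h = bar P x by rewrite -hbx bbh.
    rewrite hE in hx hy *.
    have byx : bar P y != x by apply: contraNneq hy => <-; rewrite bby.
    have F := (bby, by_, eqxx, negPf ny, negPf nx, negPf byx, negPf bxy,
      negPf yx, orbT, andbT).
    by do 4 rewrite ?F /=; rewrite eq_sym (negPf bxy).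
  case: (eqVneq (bar P h) y) => [hby|hby].
    have hE : h = bar P y by rewrite -hby bbh.
    rewrite hE in hx hy *.
    have bxy' : bar P x != y by apply: contraNneq hx => <-; rewrite bbx.
    have F := (bbx, bx, eqxx, negPf nx, negPf bxy', negPf bxy, orbT, andbT).
    by do 4 rewrite ?F /=.
  have hbx' : h != bar P x by apply: contraNneq hbx => ->; rewrite bbx.
  have hby' : h != bar P y by apply: contraNneq hby => ->; rewrite bby.
  have bhbx : bar P h != bar P x.
    by apply: contraNneq hx => E; rewrite -bbh E bbx.
  have bhby : bar P h != bar P y.
    by apply: contraNneq hy => E; rewrite -bbh E bby.
  have F := (bbh, bh, hbx, hby, nh, negPf hx, negPf hy, ih, eqxx, negPf hbx',
    negPf hby', negPf bhbx, negPf bhby, negPf hbx, negPf hby).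
  by do 4 rewrite ?F /=.
- rewrite [hs _]/= [term _]/=; apply/allP => u uin; rewrite count_filter.
  set hs' := fun h => (h != x) && (h != y).
  have cle (a : pred nat) : (count a (hs P) <= count (predI a hs') (hs P)
      + count (fun h => a h && ((h == x) || (h == y))) (hs P))%N.
    rewrite -count_predUI; apply: leq_trans (leq_addr _ _).
    by apply: sub_count => h /= ->; rewrite /hs' -negb_or orNb.
  have c1 z : z \in hs P -> count (pred1 z) (hs P) = 1%N.
    by move=> zin; rewrite count_uniq_mem // zin.
  have cxy : (count (fun h => (h == x) || (h == y)) (hs P) <= 2)%N.
    by rewrite -[2%N]/(1 + 1)%N -{1}(c1 x xP) -(c1 y yP) -count_predUI leq_addr.
  move: uin; rewrite inE => /predU1P[-> | ].
  + set a := fun h => (term P h == term P x) || (term P h == term P y).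
    have aE : (6 <= count a (hs P))%N.
      have -> : count a (hs P) = (count (fun h => term P h == term P x) (hs P)
          + count (fun h => term P h == term P y) (hs P))%N.
        rewrite -count_predUI (@eq_count _ (predI _ _) pred0) ?count_pred0 ?addn0 //.
        by move=> h /=; apply/negP => /andP[/eqP-> E]; rewrite E in vw.
      exact: (leq_add (vP _ tx) (vP _ ty)).
    have c2 : (count (fun h => a h && ((h == x) || (h == y))) (hs P) <= 2)%N.
      by apply: leq_trans cxy; apply: sub_count => h /andP[].
    have := leq_trans aE (leq_trans (cle a) (leq_add (leqnn _) c2)).
    rewrite addn2 !ltnS => le4; apply: leq_trans (ltnW le4) _.
    apply: sub_count => h /= /andP[ah ->]; rewrite andbT.
    by case: ifP ah => // hw; rewrite /a hw orbF.
  rewrite mem_filter => /andP[/andP[uv' uw] uin].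
  apply: leq_trans (vP _ uin) _; apply: leq_trans (cle _) _.
  rewrite [X in (_ + X)%N](@eq_count _ _ pred0) ?count_pred0 ?addn0; last first.
    move=> h /=; apply/negP => /andP[/eqP E /orP[]/eqP hE];
      by rewrite -E hE eqxx in uv' uw.
  apply: sub_count => h /= /andP[/eqP E ->].
  by rewrite E (negPf uw) eqxx.
Qed.

(* By contract_wf, the default value G of insubd is only reached when x or y is
   not a half-edge of G or when both have the same vertex. *)
Definition gcontract (G : ograph) (x y : nat) : ograph :=
  insubd G (contract_data (front_data G x y) x y).

Definition contract_parity (G : ograph) (x y : nat) : bool :=
  iso_parity id id G (front_data G x y).

Definition separating (G : ograph) (x y : nat) : bool :=
  (term G x != term G y) && (ncomp G predT < ncomp (gcontract G x y) predT)%N.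

Record cgraph := CGraph { cgraph_graph :> ograph; _ : connected cgraph_graph }.

Section GraphSpaces.
Variable k : fieldType.

Definition orientation_relation : set {malg k[ograph]} :=
  [set r | exists G H : ograph, exists2 fg : (nat -> nat) * (nat -> nat),
    graph_iso fg.1 fg.2 G H
    & r = << H >> - (-1) ^+ iso_parity fg.1 fg.2 G H *: << G >>].

Definition HG := quotient orientation_relation.
HB.instance Definition _ := GRing.Lmodule.on HG.

Definition hg (G : ograph) : HG := coset orientation_relation << G >>.

(* G_xy: the parity is that of the passage from the orientation of G to the one
   with respect to which gcontract is oriented. *)
Definition contraction (G : ograph) (x y : nat) : HG :=
  if term G x == term G y then 0
  else (-1) ^+ contract_parity G x y *: hg (gcontract G x y).

Definition graph_bracket (G H : ograph) : HG :=
  \sum_(x <- hs G) \sum_(y <- hs H) contraction (union G H) (inG x) (inH y).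

Definition HC : {pred HG} :=
  span [set u | exists2 G : ograph, has_cut_vertex G & u = hg G].

Definition GG := subspace [set u | exists G : cgraph, u = hg G].
HB.instance Definition _ := GRing.Lmodule.on GG.

Definition cg (G : cgraph) : GG :=
  Subspace (mem_span (ex_intro (fun H : cgraph => hg G = hg H) G erefl)).

Definition cut_graphs : set GG :=
  [set u | exists2 G : cgraph, has_cut_vertex G & u = cg G].

Definition GC := quotient cut_graphs.
HB.instance Definition _ := GRing.Lmodule.on GC.

Definition gc (G : cgraph) : GC := coset cut_graphs (cg G).

Definition GC_hom (n : nat) : {pred GC} :=
  span [set u | exists2 G : cgraph, size (vs G) = n & u = gc G].

(* [G + C, H + C] is the coset corresponding to [G, H] in
   (GG + HC) / HC = GG / C. *)
Definition induced_bracket (br : GC -> GC -> GC) : Prop :=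
  forall G H : cgraph, exists2 u : GG,
    val u - graph_bracket G H \in HC & br (gc G) (gc H) = coset cut_graphs u.

(* G_xy = A . B as oriented graphs *)
Definition contraction_splits (G : ograph) (x y : nat) (A B : ograph) : Prop :=
  exists2 fg : (nat -> nat) * (nat -> nat),
    graph_iso fg.1 fg.2 (gcontract G x y) (union A B)
    & iso_parity fg.1 fg.2 (gcontract G x y) (union A B)
      = contract_parity G x y.

(* As half-edges are numbers, the unordered pairs {x, y} are enumerated by
   x < y. *)
Definition induced_cobracket (th : GC -> tensor GC GC) : Prop :=
  forall G : cgraph, exists A B : nat -> nat -> cgraph,
    (forall x y, x \in hs G -> y \in hs G -> separating G x y ->
       contraction_splits G x y (A x y) (B x y)) /\
    th (gc G) =
      \sum_(x <- hs G) \sum_(y <- hs G | (x < y)%N && separating G x y)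
        (gc (A x y) \ox gc (B x y)
         + (-1) ^+ (size (vs (A x y)) * size (vs (B x y)))
             *: (gc (B x y) \ox gc (A x y))).

End GraphSpaces.

(* Main.v *)
Require Import Defs.
From HB Require Import structures.
From mathcomp Require Import all_boot all_order all_algebra.
From mathcomp Require Import boolp classical_sets.
From mathcomp Require Import finmap monalg.

Set Implicit Arguments.
Unset Strict Implicit.
Unset Printing Implicit Defensive.

Import Defs GRing.Theory.
Local Open Scope quotient_scope.
Local Open Scope ring_scope.

(** Contracting two disjoint pairs of half-edges {x, y} and {z, t} in the two
    possible orders gives opposite elements of HG (ctr2_anti), so that the terms
    of the Jacobi, co-Jacobi and compatibility identities cancel in pairs.  To
    bring the cobracket into this form, let Phi2 : HG -> GC \ox GC send a product
    A . B of two connected graphs to A \ox B + (-1)^(ab) B \ox A and all connected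
    graphs to 0, and let Phi3 do the same for three components; then theta is
    half of Phi2 applied to the sum of all contractions of ordered pairs, and the
    co-Jacobi and compatibility identities become the images under Phi3 and Phi2
    of sums of iterated contractions that vanish in HG.
    Cut vertices enter twice.  A contraction between G and H keeps the cut
    vertices of G, and a disconnected contraction of a connected graph with a cut
    vertex has one too, so that the operations descend to GC.  If H has no cut
    vertex, then contracting a half-edge of a connected graph with one of H leaves
    the result connected, so that the unwanted terms of [G, H] do not occur. *)

(** * Linear maps on free modules, quotients and tensor products *)

(** Elements of [HG] and [GC] show neither the components of a graph nor its degree, yet the
    identities need both. A function of graphs that changes by the sign of every isomorphism extends
    to [HG]. An ordered choice of components is not of this kind, so a component is split off at
    every vertex and weighted by the inverse of its number of vertices; this is where characteristic
    0 enters, beside the division by 2. Koszul signs are handled by linear extensions of families of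
    maps indexed by the degree. The disjoint union is commutative and associative only up to
    relabelling, hence the sums of iterated contractions are transported to one fixed union before
    they are compared. The anticommutation of contractions is reduced to positions in which both
    orders give the same labelled graph, so that the sign is that of deleting two entries of a list
    in two orders. *)

Section Linear.
Variables (k : fieldType).
Implicit Types (U V W : lmodType k).

Lemma lin0 U V (f : U -> V) : linear f -> f 0 = 0.
Proof.
by move=> lf; have := lf (-1) 0 0; rewrite scaler0 add0r scaleN1r addNr.
Qed.

Lemma linD U V (f : U -> V) : linear f -> {morph f : u v / u + v}.
Proof. by move=> lf u v; have := lf 1 u v; rewrite !scale1r. Qed.

Lemma linZ U V (f : U -> V) a : linear f -> {morph f : u / a *: u}.
Proof. by move=> lf u; have := lf a u 0; rewrite !addr0 (lin0 lf) addr0. Qed.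

Lemma linN U V (f : U -> V) : linear f -> {morph f : u / - u}.
Proof. by move=> lf u; rewrite -scaleN1r linZ // scaleN1r. Qed.

Lemma linB U V (f : U -> V) : linear f -> {morph f : u v / u - v}.
Proof. by move=> lf u v; rewrite linD // linN. Qed.

Lemma lin_sum U V (f : U -> V) (I : Type) (r : seq I) (P : pred I) F :
  linear f -> f (\sum_(i <- r | P i) F i) = \sum_(i <- r | P i) f (F i).
Proof. by move=> lf; apply: (big_morph f (linD lf) (lin0 lf)). Qed.

Lemma lin_comp U V W (g : V -> W) (f : U -> V) :
  linear g -> linear f -> linear (fun u => g (f u)).
Proof. by move=> lg lf a u v; rewrite lf lg. Qed.

Lemma lin_add U V (f g : U -> V) :
  linear f -> linear g -> linear (fun u => f u + g u).
Proof. by move=> lf lg a u v; rewrite lf lg scalerDr addrACA. Qed.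

Lemma lin_scale U V a (f : U -> V) : linear f -> linear (fun u => a *: f u).
Proof. by move=> lf b u v; rewrite lf scalerDr !scalerA mulrC. Qed.

(** The linear extension of [f] from the basis [K] to the free module. *)
Definition mlift (K : choiceType) V (f : K -> V) (u : {malg k[K]}) : V :=
  \sum_(x <- msupp u) u@_x *: f x.

Lemma mliftEw (K : choiceType) V (f : K -> V) (u : {malg k[K]}) (d : {fset K}) :
  (msupp u `<=` d)%fset -> mlift f u = \sum_(x <- d) u@_x *: f x.
Proof.
move=> sud; rewrite /mlift; apply/esym.
rewrite (bigID (fun x => x \in msupp u)) /= [X in _ + X]big1 ?addr0; last first.
  by move=> x /mcoeff_outdom->; rewrite scale0r.
rewrite -big_filter; apply: perm_big.
apply: uniq_perm; rewrite ?filter_uniq ?fset_uniq // => x.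
by rewrite mem_filter andb_idr // => /(fsubsetP sud).
Qed.

Lemma mlift_linear (K : choiceType) V (f : K -> V) : linear (mlift f).
Proof.
move=> a u v; pose d := (msupp u `|` msupp v)%fset.
rewrite (@mliftEw _ _ _ _ d) ?(@mliftEw _ _ _ u d) ?(@mliftEw _ _ _ v d)
  ?fsubsetUl ?fsubsetUr //; last first.
  apply: fsubset_trans (msuppD_le _ _) _.
  by apply: fsetSU; apply: msuppZ_le.
rewrite scaler_sumr -big_split; apply: eq_bigr => x _ /=.
by rewrite mcoeffD mcoeffZ scalerDl scalerA.
Qed.

Lemma mliftU (K : choiceType) V (f : K -> V) x : mlift f << x >> = f x.
Proof.
by rewrite /mlift msuppU oner_eq0 big_seq_fset1 mcoeffUU scale1r.
Qed.

Lemma malg_ind_lin (K : choiceType) V (f g : {malg k[K]} -> V) :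
  linear f -> linear g -> (forall x, f << x >> = g << x >>) -> f =1 g.
Proof.
move=> lf lg fg u; rewrite [u]monalgE !lin_sum //; apply: eq_bigr => x _.
have -> : << u@_x *g x >> = u@_x *: << x >> :> {malg k[K]}.
  by apply/malgP => y; rewrite mcoeffZ !mcoeffU mulr_natr.
by rewrite !linZ // fg.
Qed.

Lemma mliftD (K : choiceType) V (f g : K -> V) u :
  mlift (fun x => f x + g x) u = mlift f u + mlift g u.
Proof. by rewrite -big_split; apply: eq_bigr => x _; rewrite scalerDr. Qed.

Lemma mliftZ (K : choiceType) V a (f : K -> V) u :
  mlift (fun x => a *: f x) u = a *: mlift f u.
Proof.
by rewrite scaler_sumr; apply: eq_bigr => x _; rewrite !scalerA mulrC.
Qed.

Lemma lin_span0 V W (X : set V) (f : V -> W) : linear f ->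
  (forall v, X v -> f v = 0) -> forall v, v \in span X -> f v = 0.
Proof.
move=> lf fX v /asboolP[s [sX ->]]; rewrite lin_sum // big_seq big1 // => p ps.
by rewrite linZ // fX ?scaler0 //; apply: sX.
Qed.

Lemma lin_span V W (X : set V) (f g : V -> W) : linear f -> linear g ->
  (forall v, X v -> f v = g v) -> forall v, v \in span X -> f v = g v.
Proof.
move=> lf lg fg v vX; apply/eqP; rewrite -subr_eq0; apply/eqP.
apply: (@lin_span0 _ _ X (fun v => f v - g v)) v vX => [|v /fg->]; last exact: subrr.
by move=> a u v /=; rewrite lf lg scalerBr opprD addrACA.
Qed.

Lemma coset_linear V (X : set V) : linear (coset X : V -> quotient X).
Proof. exact: coset_is_linear. Qed.

Lemma coset0P V (X : set V) v : coset X v = 0 <-> v \in span X.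
Proof.
rewrite -(lin0 (@coset_linear V X)).
by split=> [/eqP|h]; [|apply/eqP]; rewrite coset_eq subr0.
Qed.

Lemma repr_coset V (X : set V) v : repr (coset X v) - v \in span X.
Proof. by rewrite -coset_eq coset_repr. Qed.

(** Evaluated on a chosen representative, so that it can be formed without a proof; linearity of [f]
    and its vanishing on [X] are hypotheses of the lemmas. *)
Definition qlift V W (X : set V) (f : V -> W) (q : quotient X) : W := f (repr q).

Lemma qliftE V W (X : set V) (f : V -> W) v : linear f ->
  (forall v, X v -> f v = 0) -> qlift f (coset X v) = f v.
Proof.
move=> lf fX; apply/eqP; rewrite -subr_eq0 /qlift -(linB lf); apply/eqP.
exact: lin_span0 (repr_coset _ _).
Qed.

Lemma qlift_linear V W (X : set V) (f : V -> W) : linear f ->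
  (forall v, X v -> f v = 0) -> linear (qlift f : quotient X -> W).
Proof.
move=> lf fX a p q; rewrite -[p]coset_repr -[q]coset_repr.
by rewrite -(coset_is_linear X) !qliftE // lf.
Qed.

Lemma quotient_ind_lin V W (X : set V) (f g : quotient X -> W) :
  linear f -> linear g -> (forall v, f (coset X v) = g (coset X v)) -> f =1 g.
Proof. by move=> lf lg fg q; rewrite -[q]coset_repr. Qed.

Section Tensor.
Variables (V W : lmodType k).

Lemma tpure_linl (w : W) : linear (fun v : V => v \ox w).
Proof.
move=> a v v'; apply: etrans (coset_is_linear (@tensor_relation k V W) _ _ _); apply/eqP.
by rewrite coset_eq; apply: mem_span; exists a; left; exists v, v', w.
Qed.

Lemma tpure_linr (v : V) : linear (fun w : W => v \ox w).
Proof.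
move=> a w w'; apply: etrans (coset_is_linear (@tensor_relation k V W) _ _ _); apply/eqP.
by rewrite coset_eq; apply: mem_span; exists a; right; exists v, w, w'.
Qed.

Definition tlift (U : lmodType k) (f : V -> W -> U) : tensor V W -> U :=
  qlift (mlift (fun p : V * W => f p.1 p.2)).

Variables (U : lmodType k) (f : V -> W -> U).
Hypotheses (fl : forall w, linear (f^~ w)) (fr : forall v, linear (f v)).

Lemma tlift_rel (r : {malg k[(V * W)%type]}) : tensor_relation r ->
  mlift (fun p : V * W => f p.1 p.2) r = 0.
Proof.
have lm := mlift_linear (fun p : V * W => f p.1 p.2).
case=> a [] [v [w [w' ->]]]; rewrite (linB lm) (linD lm) (linZ _ lm) !mliftU /=.
  by rewrite fl subrr.
by rewrite fr subrr.
Qed.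

Lemma tlift_linear : linear (tlift f).
Proof. exact: qlift_linear (mlift_linear _) tlift_rel. Qed.

Lemma tliftE v w : tlift f (v \ox w) = f v w.
Proof. by rewrite /tlift qliftE ?mliftU //; [apply: mlift_linear|apply: tlift_rel]. Qed.

End Tensor.

Lemma tensor_ind_lin V W U (f g : tensor V W -> U) : linear f -> linear g ->
  (forall v w, f (v \ox w) = g (v \ox w)) -> f =1 g.
Proof.
move=> lf lg fg; apply: quotient_ind_lin => // v.
apply: (@malg_ind_lin _ _ (fun v => f (coset _ v)) (fun v => g (coset _ v))).
- exact: lin_comp lf (coset_linear _).
- exact: lin_comp lg (coset_linear _).
- by case=> a b; apply: fg.
Qed.

End Linear.

(** * Parity of a reordering *)

Definition parity (s t : seq nat) : bool := odd (inversions s t).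

(** The inversions of [s] against the natural order of its labels. This common reference makes
    [parity] additive along chains of reorderings. *)
Fixpoint label_parity (s : seq nat) : bool :=
  if s is a :: s' then odd (count (fun b => (b < a)%N) s') (+) label_parity s'
  else false.

(** What the pairs with one entry in each list contribute to [label_parity (s ++ t)]. It depends on
    the lists only up to permutation, whence [parity_cat]. *)
Definition cross_parity (s t : seq nat) : bool :=
  \big[addb/false]_(u <- s) odd (count (fun v => (v < u)%N) t).

Ltac parity_cases := repeat match goal with
  | |- context [parity ?s ?t] => case: (parity s t)
  | |- context [odd ?n] => case: (odd n)
  | |- context [label_parity ?s] => case: (label_parity s)
  | |- context [cross_parity ?s ?t] => case: (cross_parity s t)
  end; done.

Lemma odd_count (T : Type) (p : pred T) s :
  odd (count p s) = \big[addb/false]_(v <- s) p v.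
Proof.
by elim: s => [|x s IHs]; rewrite ?big_nil ?big_cons //= oddD IHs oddb.
Qed.

Lemma label_parity_big s : uniq s -> label_parity s =
  \big[addb/false]_(u <- s) \big[addb/false]_(v <- s)
    ((u < v) && (index v s < index u s))%N.
Proof.
elim: s => [|x s IHs] /=; first by rewrite big_nil.
case/andP=> xs us; rewrite big_cons big_cons eqxx andbF addFb big1_seq ?addFb; last first.
  by move=> v _; rewrite ltn0 andbF.
rewrite IHs // odd_count -big_split; apply: eq_big_seq => u us'.
have ux : (x == u) = false by apply: contraNF xs => /eqP->.
rewrite [RHS]big_cons eqxx ux ltn0Sn andbT; congr (_ (+) _).
apply: eq_big_seq => v vs'.
have vx : (x == v) = false by apply: contraNF xs => /eqP->.
by rewrite vx ltnS.
Qed.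

Lemma index_ltn_neq (s : seq nat) u v : u \in s -> v \in s -> u != v ->
  (index u s < index v s)%N = ~~ (index v s < index u s)%N.
Proof.
move=> us vs uv; rewrite -leqNgt ltn_neqAle andb_idl // => _.
by apply: contraNneq uv => E; rewrite (@index_inj _ 0%N s u v us vs E).
Qed.

(** Two labels are inverted between [s] and [t] exactly when they are in decreasing order in just
    one of the two lists. *)
Lemma parity_label s t : uniq s -> perm_eq s t ->
  parity s t = label_parity s (+) label_parity t.
Proof.
move=> us st; have ut : uniq t by rewrite -(perm_uniq st).
rewrite /parity /inversions.
rewrite (big_morph odd oddD (erefl : odd 0 = false)).
under eq_bigr do rewrite odd_count.
rewrite !label_parity_big //.
rewrite -(perm_big t st) /=.
under [X in _ = _ (+) X]eq_bigr do rewrite -(perm_big t st) /=.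
rewrite -big_split /=.
under [RHS]eq_bigr do rewrite -big_split /=.
pose F u v := ((index u s < index v s) && (index v t < index u t))%N.
(* The inverted pairs are sorted by the order of their labels; the part with [v < u] is transposed
   below, so that every pair is met with [u < v]. *)
transitivity (\big[addb/false]_(u <- s) \big[addb/false]_(v <- s) ((u < v)%N && F u v)
  (+) \big[addb/false]_(u <- s) \big[addb/false]_(v <- s) ((v < u)%N && F u v)).
  rewrite -big_split /=; apply: eq_bigr => u _.
  rewrite -big_split /=; apply: eq_bigr => v _.
  rewrite /F; case: (ltngtP u v) => [_|_|->]; rewrite ?addbF //=.
  by rewrite ltnn.
rewrite [X in _ (+) X]exchange_big -big_split; apply: eq_big_seq => u us' /=.
rewrite -big_split; apply: eq_big_seq => v vs' /=.
rewrite /F; case: (ltnP u v) => //= uv.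
have nuv : u != v by rewrite neq_ltn uv.
rewrite (index_ltn_neq us' vs' nuv) (@index_ltn_neq t u v) -?(perm_mem st) //.
by case: (_ < _)%N; case: (_ < _)%N.
Qed.

Lemma cross_parity_perml s s' t : perm_eq s s' -> cross_parity s t = cross_parity s' t.
Proof. exact: perm_big. Qed.

Lemma cross_parity_permr s t t' : perm_eq t t' -> cross_parity s t = cross_parity s t'.
Proof. by move/permP=> tt'; apply: eq_bigr => u _; rewrite tt'. Qed.

(** Two distinct labels, one from each list, are counted in exactly one of the two terms. This is
    the source of the Koszul sign in [parity_catC]. *)
Lemma cross_parityC s t : uniq (s ++ t) ->
  cross_parity s t (+) cross_parity t s = odd (size s * size t).
Proof.
move=> ust; rewrite /cross_parity.
under eq_bigr do rewrite odd_count.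
under [X in _ (+) X]eq_bigr do rewrite odd_count.
rewrite [X in _ (+) X]exchange_big -big_split /=.
transitivity (\big[addb/false]_(u <- s) odd (size t)).
  apply: eq_big_seq => u us; rewrite -big_split /=.
  transitivity (\big[addb/false]_(v <- t) true).
    apply: eq_big_seq => v vt.
    move: ust; rewrite cat_uniq => /and3P[_ /hasPn/(_ v vt) /= vs _].
    case: ltngtP => // uv; by rewrite uv us in vs.
  by rewrite -(odd_count xpredT) count_predT.
elim: s {ust} => [|x s IHs]; first by rewrite big_nil.
by rewrite big_cons IHs /= mulSn oddD.
Qed.

Lemma label_parity_cat s t :
  label_parity (s ++ t) = label_parity s (+) label_parity t (+) cross_parity s t.
Proof.
elim: s => [|x s IHs] /=; first by rewrite /cross_parity big_nil addbF.
rewrite IHs count_cat oddD /cross_parity big_cons.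
rewrite -[\big[_/_]_(_ <- _) _]/(cross_parity s t).
parity_cases.
Qed.

Lemma parity_refl s : uniq s -> parity s s = false.
Proof. by move=> us; rewrite parity_label // addbb. Qed.

Lemma parity_sym s t : uniq s -> perm_eq s t -> parity s t = parity t s.
Proof.
move=> us st; rewrite !parity_label // 1?addbC // ?(perm_uniq (s2 := s)) //.
- by rewrite perm_sym.
- by rewrite perm_sym.
Qed.

Lemma parity_trans t s r : uniq s -> perm_eq s t -> perm_eq t r ->
  parity s r = parity s t (+) parity t r.
Proof.
move=> us st tr; have ut : uniq t by rewrite -(perm_uniq st).
by rewrite !parity_label ?(perm_trans st tr) //; parity_cases.
Qed.

Lemma parity_cat s s' t t' : uniq (s ++ t) -> perm_eq s s' -> perm_eq t t' ->
  parity (s ++ t) (s' ++ t') = parity s s' (+) parity t t'.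
Proof.
move=> ust ss' tt'; move: (ust); rewrite cat_uniq => /and3P[us _ ut].
rewrite !parity_label // ?perm_cat // !label_parity_cat.
rewrite (cross_parity_perml _ ss') (cross_parity_permr _ tt').
parity_cases.
Qed.

Lemma parity_catC s t : uniq (s ++ t) ->
  parity (s ++ t) (t ++ s) = odd (size s * size t).
Proof.
move=> ust; rewrite parity_label //; last by rewrite perm_catC.
rewrite !label_parity_cat -cross_parityC //.
parity_cases.
Qed.

Lemma parity_cons a s t : uniq (a :: s) -> perm_eq s t ->
  parity (a :: s) (a :: t) = parity s t.
Proof.
move=> us st; rewrite -[a :: s]/([:: a] ++ s) -[a :: t]/([:: a] ++ t) parity_cat //.
by rewrite parity_refl.
Qed.

Lemma index_map_in (f : nat -> nat) (s t : seq nat) x : {in s &, injective f} ->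
  {subset t <= s} -> x \in s -> index (f x) (map f t) = index x t.
Proof.
move=> fi ts xs; elim: t ts => //= y t IHt ts.
have ys : y \in s by apply: ts; rewrite mem_head.
rewrite IHt => [|z zt]; last by apply: ts; rewrite inE zt orbT.
case: eqVneq => [/fi->|fxy]; rewrite ?eqxx //.
by case: eqVneq => // xy; rewrite xy eqxx in fxy.
Qed.

Lemma parity_map (f : nat -> nat) s t : {in s &, injective f} -> perm_eq s t ->
  parity (map f s) (map f t) = parity s t.
Proof.
move=> fi st; congr odd; rewrite /inversions big_map; apply: eq_big_seq => u us.
rewrite count_map; apply: eq_in_count => v vs /=.
have ts : {subset t <= s} by move=> x; rewrite (perm_mem st).
by rewrite !(index_map_in fi).
Qed.

(** [a] jumps over the [index a s] entries that precede it. *)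
Lemma parity_rem_front a s : uniq s -> a \in s ->
  parity s (a :: rem a s) = odd (index a s).
Proof.
move=> us a_s; case/splitPr: a_s us => s1 s2 us.
have as1 : a \notin s1.
  by move: us; rewrite cat_uniq => /and3P[_ /=]; rewrite negb_or => /andP[].
have -> : rem a (s1 ++ a :: s2) = s1 ++ s2.
  by elim: s1 as1 {us} => [|b s1 IHs] /=; rewrite ?eqxx // inE negb_or eq_sym
    => /andP[/negPf-> /IHs->].
rewrite index_cat (negPf as1) /= eqxx addn0.
have -> : a :: s1 ++ s2 = ([:: a] ++ s1) ++ s2 by [].
rewrite -(cat1s a s2) catA in us *.
have us1 : uniq (s1 ++ [:: a]) by move: us; rewrite cat_uniq => /and3P[].
have us2 : uniq s2 by move: us; rewrite cat_uniq => /and3P[].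
rewrite parity_cat //; last by rewrite perm_catC.
by rewrite (parity_refl us2) addbF parity_catC // muln1.
Qed.

Lemma perm_rem a (s t : seq nat) : a \in s -> perm_eq s t ->
  perm_eq (rem a s) (rem a t).
Proof.
move=> a_s st; rewrite -(perm_cons a) -(permPl (perm_to_rem a_s)) (permPl st).
by apply: perm_to_rem; rewrite -(perm_mem st).
Qed.

Lemma parity_rem a s t : uniq s -> perm_eq s t -> a \in s ->
  parity (rem a s) (rem a t) = parity s t (+) odd (index a s) (+) odd (index a t).
Proof.
move=> us st a_s; have a_t : a \in t by rewrite -(perm_mem st).
have ut : uniq t by rewrite -(perm_uniq st).
have prst := perm_rem a_s st.
have ps := perm_to_rem a_s; have pt := perm_to_rem a_t.
rewrite -(parity_cons (a := a)) ?(perm_uniq (s2 := s)) //; last by rewrite perm_sym.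
rewrite (@parity_trans s) //; [|by rewrite -(perm_uniq ps)|by rewrite perm_sym|].
  rewrite (@parity_trans t s) // parity_rem_front //.
  rewrite parity_sym ?parity_rem_front //; first by parity_cases.
    by rewrite -(perm_uniq ps).
  by rewrite perm_sym.
by rewrite (perm_trans st).
Qed.

Lemma parity_swap a b s : uniq [:: a, b & s] ->
  parity [:: a, b & s] [:: b, a & s] = true.
Proof.
move=> us; rewrite -[_ :: _]/([:: a; b] ++ s) -[X in parity _ X]/([:: b; a] ++ s).
rewrite parity_cat //; last by rewrite (perm_catC [:: a] [:: b]).
have /= /and3P[abs bs us'] := us.
rewrite (@parity_refl s) // addbF (@parity_catC [:: a] [:: b]) //=.
by move: abs; rewrite inE negb_or => /andP[ab _]; rewrite inE ab.
Qed.

Lemma remC (s : seq nat) a b : uniq s -> rem a (rem b s) = rem b (rem a s).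
Proof.
move=> us; rewrite (rem_filter b us) (rem_filter a us).
by rewrite !rem_filter ?filter_uniq // -!filter_predI; apply: eq_filter => x /=; rewrite andbC.
Qed.

Lemma parity_rem2_front a b s : uniq s -> a \in s -> b \in s -> a != b ->
  parity s [:: a, b & rem b (rem a s)]
  = odd (index a s) (+) odd (index b (rem a s)).
Proof.
move=> us a_s b_s ab.
have b_s' : b \in rem a s by rewrite rem_mem // eq_sym.
have ura := rem_uniq a us.
rewrite (@parity_trans (a :: rem a s)) ?perm_to_rem ?perm_cons ?perm_to_rem //.
rewrite parity_rem_front // parity_cons ?parity_rem_front ?perm_to_rem //.
by rewrite /= ura mem_rem_uniqF.
Qed.

(** Moving [a] and [b] to the front in the two possible orders gives lists that differ by one
    transposition. This sign makes contractions anticommute. *)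
Lemma index_rem2 (a b : nat) (s : seq nat) : uniq s -> a \in s -> b \in s -> a != b ->
  odd (index a s) (+) odd (index b (rem a s))
  = ~~ (odd (index b s) (+) odd (index a (rem b s))).
Proof.
move=> us a_s b_s ab; have ba : b != a by rewrite eq_sym.
have b_s' : b \in rem a s by rewrite rem_mem.
have a_s' : a \in rem b s by rewrite rem_mem.
rewrite -!parity_rem2_front // -[rem a (rem b s)](@remC s b a us).
have pba : perm_eq s [:: b, a & rem b (rem a s)].
  rewrite (@remC s b a us); apply: perm_trans (perm_to_rem b_s) _.
  by rewrite perm_cons perm_to_rem.
have pab : perm_eq [:: b, a & rem b (rem a s)] [:: a, b & rem b (rem a s)].
  by rewrite (perm_catCA [:: b] [:: a]).
by rewrite (parity_trans us pba pab) parity_swap -?(perm_uniq pba) // addbT.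
Qed.

(** * Contractions *)

Lemma uniq_map_inj (T T' : eqType) (f : T -> T') (s : seq T) :
  uniq (map f s) -> {in s &, injective f}.
Proof.
elim: s => //= x s IHs /andP[fxs ufs] u v; rewrite !inE.
move=> /predU1P[->|us] /predU1P[->|vs'] // fuv; last exact: IHs.
  by rewrite fuv map_f in fxs.
by rewrite -fuv map_f in fxs.
Qed.

Lemma map_rem_in (f : nat -> nat) (s : seq nat) a : {in s &, injective f} ->
  a \in s -> map f (rem a s) = rem (f a) (map f s).
Proof.
move=> fi a_s; have : {subset s <= s} by [].
elim: {-2}s => //= x t IHt ts; have x_s : x \in s by apply: ts; rewrite mem_head.
rewrite (inj_in_eq fi) //; case: eqVneq => // _ /=.
by rewrite IHt // => y yt; apply: ts; rewrite inE yt orbT.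
Qed.

Lemma odd_count_rem (p : pred nat) s x : uniq s -> x \in s ->
  odd (count p s) = p x (+) odd (count p [seq h <- s | h != x]).
Proof.
move=> us xs; rewrite (permP (perm_to_rem xs)) /= oddD oddb.
by rewrite rem_filter.
Qed.

Lemma odd_count_rem2 (p : pred nat) s x y : uniq s -> x \in s -> y \in s -> x != y ->
  odd (count p s) =
    p x (+) p y (+) odd (count p [seq h <- s | (h != x) && (h != y)]).
Proof.
move=> us xs ys xy; rewrite (odd_count_rem _ us xs).
rewrite (odd_count_rem _ (filter_uniq _ us) (x := y)) ?mem_filter 1?eq_sym ?xy //.
rewrite -filter_predI addbA; congr (_ (+) odd (count p _)).
by apply: eq_filter => h /=; rewrite andbC.
Qed.

(** Each edge is tested once, at its half that is initial in [P]. *)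
Definition flips (g : nat -> nat) (P Q : graph_data) : bool :=
  odd (count (fun h => init P h && ~~ init Q (g h)) (hs P)).

Lemma iso_parityE f g P Q :
  iso_parity f g P Q = parity (map f (vs P)) (vs Q) (+) flips g P Q.
Proof. by rewrite /iso_parity oddD. Qed.

Section IsoFacts.
Variables (f g : nat -> nat) (P Q : graph_data).
Hypotheses (wP : graph_wf P) (wQ : graph_wf Q) (iso : graph_iso f g P Q).

Lemma iso_vs_inj : {in vs P &, injective f}.
Proof.
case: iso => pv _ _ _; apply: uniq_map_inj; rewrite (perm_uniq pv).
by case/graph_wfP: wQ.
Qed.

Lemma iso_hs_inj : {in hs P &, injective g}.
Proof.
case: iso => _ ph _ _; apply: uniq_map_inj; rewrite (perm_uniq ph).
by case/graph_wfP: wQ.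
Qed.

Lemma iso_vs v : v \in vs P -> f v \in vs Q.
Proof. by case: iso => pv _ _ _ vP; rewrite -(perm_mem pv) map_f. Qed.

Lemma iso_hs h : h \in hs P -> g h \in hs Q.
Proof. by case: iso => _ ph _ _ hP; rewrite -(perm_mem ph) map_f. Qed.

Lemma iso_bar h : h \in hs P -> bar Q (g h) = g (bar P h).
Proof. by case: iso => _ _ eb _; apply: eb. Qed.

Lemma iso_term h : h \in hs P -> term Q (g h) = f (term P h).
Proof. by case: iso => _ _ _; apply. Qed.

Lemma iso_size : size (vs P) = size (vs Q).
Proof. by case: iso => pv _ _ _; rewrite -(perm_size pv) size_map. Qed.

End IsoFacts.

(** Keeps the orientation of [P] as far as possible, so that contractions can be iterated without
    reordering: only the vertex of [y] leaves the list, and [bar y] takes the place of [x] in the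
    edge of [x], with its direction. The sign is kept apart in [contract_sign]. *)
Definition contract (P : graph_data) (x y : nat) : graph_data := {|
  vs := rem (term P y) (vs P);
  hs := [seq h <- hs P | (h != x) && (h != y)];
  bar := fun h => if bar P h == x then bar P y
                  else if bar P h == y then bar P x else bar P h;
  term := fun h => if term P h == term P y then term P x else term P h;
  init := fun h => if h == bar P y then init P x else init P h |}.

(** To reach the convention for [G_xy], the vertex of [y] moves to the front, which costs its index,
    and changes places with that of [x], which costs the negation; the edge of [y] is reversed if
    [y] is initial. The position of the vertex of [x] and a reversal of the edge of [x], if it is
    another edge, enter both before and after the contraction and cancel. *)
Definition contract_sign (P : graph_data) (x y : nat) : bool :=
  ~~ (odd (index (term P y) (vs P)) (+) init P y).

Section ContractFacts.
Variable P : graph_data.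
Hypothesis wP : graph_wf P.

Lemma bar_hs h : h \in hs P -> bar P h \in hs P.
Proof. by case/graph_wfP: wP => _ _ hP _ /hP[]. Qed.
Lemma barK h : h \in hs P -> bar P (bar P h) = h.
Proof. by case/graph_wfP: wP => _ _ hP _ /hP[]. Qed.
Lemma bar_neq h : h \in hs P -> bar P h != h.
Proof. by case/graph_wfP: wP => _ _ hP _ /hP[]. Qed.
Lemma term_vs h : h \in hs P -> term P h \in vs P.
Proof. by case/graph_wfP: wP => _ _ hP _ /hP[]. Qed.
Lemma init_bar h : h \in hs P -> init P (bar P h) = ~~ init P h.
Proof. by case/graph_wfP: wP => _ _ hP _ /hP[]. Qed.
Lemma uniq_vs : uniq (vs P). Proof. by case/graph_wfP: wP. Qed.
Lemma uniq_hs : uniq (hs P). Proof. by case/graph_wfP: wP. Qed.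
Lemma bar_inj x y : x \in hs P -> y \in hs P -> bar P x = bar P y -> x = y.
Proof. by move=> xP yP E; rewrite -(barK xP) E barK. Qed.
Lemma bar_eq x y : x \in hs P -> y \in hs P -> (bar P x == y) = (x == bar P y).
Proof. by move=> xP yP; apply/eqP/eqP => [<-|->]; rewrite barK. Qed.

Variables x y : nat.
Hypotheses (xP : x \in hs P) (yP : y \in hs P) (vw : term P x != term P y).

Lemma contract_data_wf : graph_wf (contract_data (front_data P x y) x y).
Proof. exact: (@contract_wf (OGraph wP) x y xP yP vw). Qed.

Lemma perm_contract_vs :
  perm_eq (vs (contract_data (front_data P x y) x y)) (vs (contract P x y)).
Proof.
rewrite /= (negPf vw) eqxx (perm_trans (perm_refl _)) //.
apply: uniq_perm; rewrite /= ?mem_filter ?eqxx ?filter_uniq ?rem_uniq ?uniq_vs //.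
move=> u; rewrite inE mem_filter (mem_rem_uniq _ uniq_vs) !inE.
case: (eqVneq u (term P x)) => [->|] /=; first by rewrite vw term_vs.
by [].
Qed.

Lemma init_contract h : h \in hs (contract P x y) ->
  init (contract P x y) (bar (contract P x y) h) = ~~ init (contract P x y) h.
Proof.
rewrite mem_filter /= => /andP[/andP[hx hy] hP].
have xy : x != y by apply: contraNneq vw => ->.
have bxy : (bar P x == bar P y) = false.
  by apply: contraNF xy => /eqP/(bar_inj xP yP)/eqP.
rewrite !bar_eq //; case: (eqVneq h (bar P x)) => [->|hbx].
  by rewrite eqxx bxy init_bar // negbK.
case: (eqVneq h (bar P y)) => [_|hby]; first by rewrite bxy init_bar.
case: eqP => [/(bar_inj hP yP) E|_]; first by rewrite E eqxx in hy.
exact: init_bar.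
Qed.

Lemma wf_contract : graph_wf (contract P x y).
Proof.
have /and4P[uv uh hP vP] := contract_data_wf.
have pv := perm_contract_vs.
apply/and4P; split.
- by rewrite -(perm_uniq pv).
- exact: uh.
- apply/allP => h hin; have := allP hP h hin.
  case/and5P => a b c d _; rewrite init_contract // eqxx andbT.
  by apply/and4P; split; rewrite // -(perm_mem pv).
- by rewrite -(perm_all _ pv).
Qed.

Lemma size_contract : (size (vs (contract P x y))).+1 = size (vs P).
Proof.
rewrite size_rem ?term_vs // prednK //.
by rewrite -has_predT; apply/hasP; exists (term P y); rewrite ?term_vs.
Qed.

End ContractFacts.

Lemma iso_id P Q : perm_eq (vs P) (vs Q) -> perm_eq (hs P) (hs Q) ->
  {in hs P, bar Q =1 bar P} -> {in hs P, term Q =1 term P} -> graph_iso id id P Q.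
Proof. by move=> pv ph eb et; split; rewrite ?map_id. Qed.

Fact class_key : unit. Proof. exact: tt. Qed.

Section Classes.
Variable k : fieldType.

(* Locked, since attempts to unify different classes unfold graph_wf. *)
Definition hgd : graph_data -> HG k :=
  locked_with class_key (fun P => if insub P is Some G then hg k G else 0).

Lemma hgd_hg (G : ograph) : hgd G = hg k G.
Proof. by rewrite /hgd unlock valK. Qed.

Lemma hg_iso (G H : ograph) f g : graph_iso f g G H ->
  hg k H = (-1) ^+ iso_parity f g G H *: hg k G.
Proof.
move=> iso; rewrite /hg; apply/eqP.
rewrite -(linZ _ (coset_is_linear (@orientation_relation k))) coset_eq.
by apply: mem_span; exists G, H; exists (f, g).
Qed.

Lemma hgd_iso P Q f g : graph_wf P -> graph_wf Q -> graph_iso f g P Q ->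
  hgd Q = (-1) ^+ (parity (map f (vs P)) (vs Q) (+) flips g P Q) *: hgd P.
Proof.
move=> wP wQ iso; rewrite -iso_parityE.
by rewrite -[P]/(ograph_data (OGraph wP)) -[Q]/(ograph_data (OGraph wQ)) !hgd_hg (@hg_iso (OGraph wP) (OGraph wQ) f g).
Qed.

Definition ctr : graph_data -> nat -> nat -> HG k :=
  locked_with class_key (fun P x y => if term P x == term P y then 0
  else (-1) ^+ contract_sign P x y *: hgd (contract P x y)).

Lemma ctrE P x y : ctr P x y = if term P x == term P y then 0
  else (-1) ^+ contract_sign P x y *: hgd (contract P x y).
Proof. by rewrite /ctr unlock. Qed.

Lemma contractionE (G : ograph) x y : x \in hs G -> y \in hs G ->
  contraction k G x y = ctr G x y.
Proof.
case: G => P wP xP yP; rewrite /contraction ctrE /=.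
case: (boolP (_ == _)) => // vw.
have xy : x != y by apply: contraNneq vw => ->.
have wD := contract_data_wf wP xP yP vw.
rewrite -hgd_hg /gcontract insubdK //.
have wC := wf_contract wP xP yP vw.
have iso : graph_iso id id (contract_data (front_data P x y) x y) (contract P x y).
  by apply: iso_id => //; apply: perm_contract_vs.
rewrite (hgd_iso wD wC iso) scalerA -signr_addb; congr ((-1) ^+ nat_of_bool _ *: _).
have vP := term_vs wP xP; have wP' := term_vs wP yP.
have uv := uniq_vs wP; have uh := uniq_hs wP.
have fE : [seq u <- vs P | (u != term P x) && (u != term P y)] =
    rem (term P x) (rem (term P y) (vs P)).
  by rewrite (rem_filter _ (rem_uniq _ uv)) (rem_filter _ uv) -filter_predI.
have wv : term P y != term P x by rewrite eq_sym.
have iE := parity_rem2_front uv wP' vP wv.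
rewrite /contract_parity iso_parityE map_id map_id /= fE.
rewrite (negPf vw) eqxx.
have pyx : perm_eq (vs P) [:: term P y, term P x & rem (term P x) (rem (term P y) (vs P))].
  by apply: perm_trans (perm_to_rem wP') _; rewrite perm_cons perm_to_rem // rem_mem.
have pxy : perm_eq [:: term P y, term P x & rem (term P x) (rem (term P y) (vs P))]
   [:: term P x, term P y & rem (term P x) (rem (term P y) (vs P))].
  by rewrite (perm_catCA [:: _] [:: _]).
rewrite (parity_trans uv pyx pxy) iE.
rewrite parity_swap -?(perm_uniq pyx) //.
have vwP : term P x \in rem (term P y) (vs P) by rewrite rem_mem.
rewrite (parity_sym (t := rem (term P y) (vs P))); last 2 first.
- by rewrite -(perm_uniq (perm_to_rem vwP)) rem_uniq.
- by rewrite perm_sym perm_to_rem.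
rewrite parity_rem_front ?rem_uniq //.
have bxy : (bar P x == bar P y) = false.
  by apply: contraNF xy => /eqP/(bar_inj wP xP yP)/eqP.
have byP := bar_hs wP yP; have bxP := bar_hs wP xP.
(* The new edge takes over the direction of the edge of [x], so that a reversal of the latter is
   counted twice and only the edge of [y] is left. If [y] is [bar x], there is one edge and no new
   one. *)
have F1 : flips id P (front_data P x y) (+)
   flips id (contract_data (front_data P x y) x y) (contract P x y) = init P y.
  rewrite /flips /=; have [Eyx|Nyx] := eqVneq (bar P x) y.
    have Exy : bar P y = x by rewrite -Eyx barK.
    rewrite (odd_count_rem2 _ uh xP yP xy) !(eqxx, inE, Eyx, Exy).
    rewrite [y == x]eq_sym (negPf xy) /= andbF andbT addFb.
    rewrite -addbA [X in _ (+) X](_ : _ = false) ?addbF //.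
    set s := [seq h <- hs P | _].
    rewrite !(@eq_in_count _ _ pred0 s) ?count_pred0 // => h;
      rewrite mem_filter !inE => /andP[/andP[/negPf hx /negPf hy] _];
      by rewrite !(hx, hy, Eyx, Exy) /= andbN.
  have Nxy : bar P y != x by rewrite (bar_eq wP) // eq_sym.
  have uhf : uniq [seq h <- hs P | (h != x) && (h != y)] by rewrite filter_uniq.
  rewrite (odd_count_rem2 _ uh xP yP xy).
  have bxf : bar P x \in [seq h <- hs P | (h != x) && (h != y)].
    by rewrite mem_filter (bar_neq wP) // Nyx.
  have byf : bar P y \in [seq h <- hs P | (h != x) && (h != y)].
    by rewrite mem_filter (bar_neq wP) // Nxy.
  rewrite !(odd_count_rem2 _ uhf bxf byf) ?bxy //.
  have S (u v : nat) : u != v -> ((u == v) = false) * ((v == u) = false).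
    by move=> ne; rewrite [v == u]eq_sym (negPf ne).
  have F := (S _ _ (negbT bxy), S _ _ xy, S _ _ Nyx, S _ _ Nxy,
    S _ _ (bar_neq wP xP), S _ _ (bar_neq wP yP), eqxx, init_bar wP xP, init_bar wP yP).
  rewrite !inE !F /=.
  set s := [seq h <- [seq h <- hs P | _] | _].
  rewrite !(@eq_in_count _ _ pred0 s) ?count_pred0; last 2 first.
  - move=> h; rewrite !mem_filter !inE => /andP[/andP[/negPf h1 /negPf h2] /andP[/andP[/negPf h3 /negPf h4] _]].
    by rewrite h1 h2 h3 h4 /= andbN.
  - move=> h; rewrite !mem_filter !inE => /andP[/andP[/negPf h1 /negPf h2] /andP[/andP[/negPf h3 /negPf h4] _]].
    by rewrite h1 h2 h3 h4 /= andbN.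
  by case: (init P x); case: (init P y).
rewrite /contract_sign -F1.
by repeat match goal with |- context [odd ?n] => case: (odd n)
  | |- context [flips ?g ?A ?B] => case: (flips g A B) end.
Qed.

End Classes.

(** * Iterated contractions *)

Lemma neq_sym2 (u v : nat) : u != v -> ((u == v) = false) * ((v == u) = false).
Proof. by move=> ne; rewrite [v == u]eq_sym (negPf ne). Qed.

(** [b] stands for the directions pulled back from a second graph. The comparison at the edge of [x]
    is inherited by the new edge; that at the edge of [y] is lost, and it is [init P y (+) b y]. *)
Lemma flips_contract P (b : pred nat) x y : graph_wf P ->
  {in hs P, forall h, b (bar P h) = ~~ b h} ->
  x \in hs P -> y \in hs P -> x != y ->
  odd (count (fun h => init (contract P x y) h
       && ~~ (if h == bar P y then b x else b h)) (hs (contract P x y)))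
  = odd (count (fun h => init P h && ~~ b h) (hs P)) (+) init P y (+) b y.
Proof.
move=> wP bP xP yP xy; have uh := uniq_hs wP.
have bxy : bar P x != bar P y by apply: contraNneq xy => /(bar_inj wP xP yP)->.
have byP := bar_hs wP yP; have bxP := bar_hs wP xP.
have bX := bP _ xP; have bY := bP _ yP.
have iX := init_bar wP xP; have iY := init_bar wP yP.
rewrite (odd_count_rem2 _ uh xP yP xy) /=.
have [Eyx|Nyx] := eqVneq (bar P x) y.
  have Exy : bar P y = x by rewrite -Eyx barK.
  rewrite -Eyx bX iX Eyx Exy.
  rewrite (@eq_in_count _ _ (fun h => init P h && ~~ b h)); last first.
    by move=> h; rewrite mem_filter => /andP[/andP[/negPf-> _] _].
  by case: (init P x); case: (b x); case: (odd _).
have Nxy : bar P y != x by rewrite (bar_eq wP) // eq_sym.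
have uhf : uniq [seq h <- hs P | (h != x) && (h != y)] by rewrite filter_uniq.
have bxf : bar P x \in [seq h <- hs P | (h != x) && (h != y)].
  by rewrite mem_filter (bar_neq wP) // Nyx.
have byf : bar P y \in [seq h <- hs P | (h != x) && (h != y)].
  by rewrite mem_filter (bar_neq wP) // Nxy.
rewrite !(odd_count_rem2 _ uhf bxf byf) //.
rewrite !(eqxx, neq_sym2 bxy, bX, bY, iX, iY) /=.
set s := [seq h <- [seq h <- hs P | _] | _].
rewrite (@eq_in_count _ _ (fun h => init P h && ~~ b h) s); last first.
  by move=> h; rewrite !mem_filter => /andP[/andP[_ /negPf->] _].
by case: (init P x); case: (b x); case: (init P y); case: (b y); case: (odd _).
Qed.

Section ContractIso.
Variables (f g : nat -> nat) (P Q : graph_data).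
Hypotheses (wP : graph_wf P) (wQ : graph_wf Q) (iso : graph_iso f g P Q).
Variables x y : nat.
Hypotheses (xP : x \in hs P) (yP : y \in hs P) (vw : term P x != term P y).

Let fi := iso_vs_inj wQ iso.
Let gi := iso_hs_inj wQ iso.

Lemma iso_term_eq h h' : h \in hs P -> h' \in hs P ->
  (term Q (g h) == term Q (g h')) = (term P h == term P h').
Proof.
by move=> hP h'P; rewrite !(iso_term iso) // (inj_in_eq fi) ?term_vs.
Qed.

Lemma contract_graph_iso : graph_iso f g (contract P x y) (contract Q (g x) (g y)).
Proof.
have [pv ph eb et] := iso.
split=> /=.
- rewrite (map_rem_in fi) ?term_vs // et //.
  by apply: perm_rem; rewrite ?map_f ?term_vs.
- rewrite (eq_in_filter (a2 := preim g (fun h => (h != g x) && (h != g y)))).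
    by rewrite -filter_map perm_filter.
  by move=> h hP /=; rewrite !(inj_in_eq gi).
- move=> h; rewrite mem_filter => /andP[_ hP].
  rewrite !eb // !(inj_in_eq gi) ?bar_hs //.
  by case: ifP => // _; case: ifP.
- move=> h; rewrite mem_filter => /andP[_ hP].
  by rewrite !et // (inj_in_eq fi) ?term_vs //; case: ifP.
Qed.

(** Deleting the vertex of [y] changes the vertex parity by its indices in both lists, and losing
    the edge of [y] changes [flips] by its directions in both graphs; these are the terms of the two
    values of [contract_sign]. *)
Lemma contract_iso_parity :
  parity (map f (vs (contract P x y))) (vs (contract Q (g x) (g y)))
   (+) flips g (contract P x y) (contract Q (g x) (g y))
   (+) contract_sign P x y (+) contract_sign Q (g x) (g y)
  = parity (map f (vs P)) (vs Q) (+) flips g P Q.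
Proof.
have [pv ph eb et] := iso.
have xy : x != y by apply: contraNneq vw => ->.
have uf : uniq (map f (vs P)) by rewrite (map_inj_in_uniq fi) uniq_vs.
have tP := term_vs wP yP.
have -> : flips g (contract P x y) (contract Q (g x) (g y)) =
    flips g P Q (+) init P y (+) init Q (g y).
  have ib : {in hs P, forall h, (init Q \o g) (bar P h) = ~~ (init Q \o g) h}.
    by move=> h hP /=; rewrite -eb // init_bar // (iso_hs iso).
  apply: etrans (flips_contract wP ib xP yP xy).
  congr odd; apply: eq_in_count => h; rewrite mem_filter => /andP[_ hP] /=.
  by rewrite eb // (inj_in_eq gi) ?bar_hs.
rewrite /= (map_rem_in fi) // et // parity_rem ?map_f //.
rewrite /contract_sign et // (index_map_in fi) //.
by repeat match goal with
 | |- context [parity ?s ?t] => case: (parity s t)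
 | |- context [odd ?n] => case: (odd n)
 | |- context [flips ?h ?A ?B] => case: (flips h A B)
 | |- context [init ?A ?h] => case: (init A h) end.
Qed.

End ContractIso.

Lemma flips_id P : graph_wf P -> flips id P P = false.
Proof.
by move=> wP; rewrite /flips (@eq_count _ _ pred0) ?count_pred0 // => h /=; rewrite andbN.
Qed.

Section SwapContract.
Variables (P : graph_data) (x y : nat).
Hypotheses (wP : graph_wf P) (xP : x \in hs P) (yP : y \in hs P)
  (vw : term P x != term P y).

(** The merged vertex keeps the label of the first argument, so it is renamed when the arguments are
    exchanged. *)
Let f u := if u == term P x then term P y else u.

Lemma contract_swap_iso : graph_iso f id (contract P x y) (contract P y x).
Proof.
have uv := uniq_vs wP; have tx := term_vs wP xP; have ty := term_vs wP yP.
have fi : {in rem (term P y) (vs P) &, injective f}.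
  move=> u1 u2; rewrite !(mem_rem_uniq _ uv) !inE /f => /andP[/negPf n1 _] /andP[/negPf n2 _].
  case: eqVneq => [->|_]; case: eqVneq => [->|_] //.
    by move/eqP; rewrite eq_sym n2.
  by move/eqP; rewrite n1.
split=> /=.
- apply: uniq_perm; rewrite ?(map_inj_in_uniq fi) ?rem_uniq // => u.
  rewrite (mem_rem_uniq _ uv) inE /=; apply/mapP/andP.
    case=> u1; rewrite (mem_rem_uniq _ uv) inE /f => /andP[nu uP] ->.
    have wv : term P y != term P x by rewrite eq_sym.
    by case: (eqVneq u1 (term P x)) => [_|ux1]; split.
  case=> ux uP; case: (eqVneq u (term P y)) => uy.
    exists (term P x); rewrite ?(mem_rem_uniq _ uv) ?inE ?vw ?tx //.
    by rewrite /f eqxx.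
  by exists u; rewrite ?(mem_rem_uniq _ uv) ?inE ?uy ?uP // /f (negPf ux).
- rewrite map_id; under eq_filter do rewrite andbC; exact: perm_refl.
- move=> h; rewrite mem_filter => /andP[_ hP].
  case: (eqVneq (bar P h) x) => [->|_]; last by [].
  have xy : x != y by apply: contraNneq vw => ->.
  by rewrite (neq_sym2 xy).
- move=> h; rewrite mem_filter => /andP[_ hP]; rewrite /f.
  case: (eqVneq (term P h) (term P y)) => [->|_]; last by [].
  by rewrite eqxx eq_sym (negPf vw).
Qed.

(** By [index_rem2] the vertex lists differ by the two indices and one more sign. The new edge has
    its direction from the edge of [x] in one graph and from that of [y] in the other, which
    accounts for the two values of [init] and for a second sign that compensates the first. *)
Lemma contract_swap_parity :
  parity (map f (vs (contract P x y))) (vs (contract P y x))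
   (+) flips id (contract P x y) (contract P y x)
  = contract_sign P x y (+) contract_sign P y x.
Proof.
have uv := uniq_vs wP; have tx := term_vs wP xP; have ty := term_vs wP yP.
have wv : term P y != term P x by rewrite eq_sym.
have xy : x != y by apply: contraNneq vw => ->.
have bxy : bar P x != bar P y by apply: contraNneq xy => /(bar_inj wP xP yP)->.
have [pv _ _ _] := contract_swap_iso.
have wyx : graph_wf (contract P y x) by apply: wf_contract.
have fi := iso_vs_inj wyx contract_swap_iso.
have tx' : term P x \in rem (term P y) (vs P) by rewrite rem_mem.
have ty' : term P y \in rem (term P x) (vs P) by rewrite rem_mem.
have flE : flips id (contract P x y) (contract P y x) = ~~ (init P x (+) init P y).
  have iX := init_bar wP xP; have iY := init_bar wP yP.
  rewrite /flips /=; have [Eyx|Nyx] := eqVneq (bar P x) y.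
    have Exy : bar P y = x by rewrite -Eyx barK.
    rewrite -Eyx iX; rewrite (@eq_in_count _ _ pred0) ?count_pred0 ?addbN ?addbb // => h.
    rewrite mem_filter Eyx Exy => /andP[/andP[/negPf-> /negPf->] _].
    by rewrite /= andbN.
  have Nxy : bar P y != x by rewrite (bar_eq wP) // eq_sym.
  have uhf : uniq [seq h <- hs P | (h != x) && (h != y)] by rewrite filter_uniq ?uniq_hs.
  have bxf : bar P x \in [seq h <- hs P | (h != x) && (h != y)].
    by rewrite mem_filter (bar_neq wP) // Nyx bar_hs.
  have byf : bar P y \in [seq h <- hs P | (h != x) && (h != y)].
    by rewrite mem_filter (bar_neq wP) // Nxy bar_hs.
  rewrite (odd_count_rem2 _ uhf bxf byf bxy).
  rewrite !(eqxx, neq_sym2 bxy, iX, iY) /=.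
  set s := [seq h <- [seq h <- hs P | _] | _].
  rewrite (@eq_in_count _ _ pred0 s) ?count_pred0; last first.
    by move=> h; rewrite !mem_filter => /andP[/andP[/negPf-> /negPf->] _]; rewrite andbN.
  by case: (init P x); case: (init P y).
rewrite flE.
set r := rem (term P x) (rem (term P y) (vs P)).
have p1 := perm_to_rem tx'; rewrite -/r in p1.
have p2 := perm_to_rem ty'; rewrite -(remC _ _ uv) -/r in p2.
have fr : map f (term P x :: r) = term P y :: r.
  rewrite /= /f eqxx; congr (_ :: _); rewrite -[RHS]map_id; apply/eq_in_map => u.
  by rewrite (mem_rem_uniq _ (rem_uniq _ uv)) inE => /andP[/negPf->].
have u1 : uniq (map f (rem (term P y) (vs P))).
  by rewrite (map_inj_in_uniq fi) rem_uniq.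
have p1' : perm_eq (map f (rem (term P y) (vs P))) (term P y :: r).
  by rewrite -fr perm_map.
rewrite /= (parity_trans u1 p1'); last by rewrite perm_sym.
rewrite -{1}fr parity_map // parity_rem_front ?rem_uniq //.
rewrite parity_sym -?(perm_uniq p2) ?rem_uniq //; last by rewrite perm_sym.
rewrite /r (remC _ _ uv) parity_rem_front ?rem_uniq //.
have := index_rem2 uv tx ty vw.
rewrite /contract_sign.
by repeat match goal with
 | |- context [odd ?n] => case: (odd n)
 | |- context [init ?A ?h] => case: (init A h) end.
Qed.

End SwapContract.

(** Tests without inner conditionals are decided first, so that the nested conditionals of an
    iterated contraction are resolved from the inside. *)
Ltac eq_cases := repeat match goal with
  | |- context [?a == ?b] => lazymatch a with
      | context [if _ then _ else _] => fail
      | _ => lazymatch b with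
             | context [if _ then _ else _] => fail
             | _ => case: (@eqP _ a b) => ? end
      end
  end.

Section Contraction.
Variable k : fieldType.
Implicit Types P Q : graph_data.

Definition iso_sign f g P Q : bool := parity (map f (vs P)) (vs Q) (+) flips g P Q.

Lemma ctr_iso f g P Q x y : graph_wf P -> graph_wf Q -> graph_iso f g P Q ->
  x \in hs P -> y \in hs P ->
  ctr k Q (g x) (g y) = (-1) ^+ iso_sign f g P Q *: ctr k P x y.
Proof.
move=> wP wQ iso xP yP; rewrite !ctrE (iso_term_eq wP wQ iso) //.
case: (boolP (_ == _)) => [_|vw]; first by rewrite scaler0.
have iso' := contract_graph_iso wP wQ iso xP yP.
have wP' := wf_contract wP xP yP vw.
have wQ' : graph_wf (contract Q (g x) (g y)).
  by apply: wf_contract; rewrite ?(iso_hs iso) // (iso_term_eq wP wQ iso).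
rewrite (hgd_iso k wP' wQ' iso') !scalerA -!signr_addb; congr ((-1) ^+ nat_of_bool _ *: _).
rewrite /iso_sign -(contract_iso_parity wP wQ iso xP yP vw).
by case: (parity _ _); case: (flips _ _ _); case: (contract_sign _ _ _); case: (contract_sign _ _ _).
Qed.

Lemma ctr_swap P x y : graph_wf P -> x \in hs P -> y \in hs P ->
  ctr k P y x = ctr k P x y.
Proof.
move=> wP xP yP; rewrite !ctrE eq_sym; case: (boolP (_ == _)) => // vw.
have wv : term P y != term P x by rewrite eq_sym.
have iso := contract_swap_iso wP xP yP vw.
rewrite (hgd_iso k (wf_contract wP xP yP vw) (wf_contract wP yP xP wv) iso).
rewrite contract_swap_parity // scalerA -signr_addb.
by rewrite [contract_sign P x y (+) _]addbC addbA addbb addFb.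
Qed.

(** Zero for overlapping pairs, so that a sum over the half-edges of the contracted graph becomes a
    sum over all those of [P]. *)
Definition ctr2 : graph_data -> nat -> nat -> nat -> nat -> HG k :=
  locked_with class_key (fun P x y z t =>
  if [|| z \in [:: x; y], t \in [:: x; y] | term P x == term P y] then 0
  else (-1) ^+ contract_sign P x y *: ctr k (contract P x y) z t).

Lemma ctr2E P x y z t : ctr2 P x y z t =
  if [|| z \in [:: x; y], t \in [:: x; y] | term P x == term P y] then 0
  else (-1) ^+ contract_sign P x y *: ctr k (contract P x y) z t.
Proof. by rewrite /ctr2 unlock. Qed.

Lemma mem_contract_hs P x y z : z \in hs P -> z \notin [:: x; y] ->
  z \in hs (contract P x y).
Proof. by rewrite mem_filter !inE negb_or => -> ->. Qed.

Lemma ctr2_iso f g P Q x y z t : graph_wf P -> graph_wf Q -> graph_iso f g P Q ->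
  x \in hs P -> y \in hs P -> z \in hs P -> t \in hs P ->
  ctr2 Q (g x) (g y) (g z) (g t) = (-1) ^+ iso_sign f g P Q *: ctr2 P x y z t.
Proof.
move=> wP wQ iso xP yP zP tP; rewrite !ctr2E (iso_term_eq wP wQ iso) //.
have gi := iso_hs_inj wQ iso.
have E u : u \in hs P -> (g u \in [:: g x; g y]) = (u \in [:: x; y]).
  by move=> uP; rewrite !inE !(inj_in_eq gi).
rewrite !E //; case: ifPn => [_|]; first by rewrite scaler0.
case/norP=> nz /norP[nt vw].
have iso' := contract_graph_iso wP wQ iso xP yP.
have wP' := wf_contract wP xP yP vw.
have wQ' : graph_wf (contract Q (g x) (g y)).
  by apply: wf_contract; rewrite ?(iso_hs iso) // (iso_term_eq wP wQ iso).
have zP' := mem_contract_hs zP nz; have tP' := mem_contract_hs tP nt.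
rewrite (ctr_iso wP' wQ' iso' zP' tP') !scalerA -!signr_addb; congr ((-1) ^+ nat_of_bool _ *: _).
rewrite /iso_sign -(contract_iso_parity wP wQ iso xP yP vw).
by case: (parity _ _); case: (flips _ _ _); case: (contract_sign _ _ _); case: (contract_sign _ _ _).
Qed.

Lemma ctr2_swapr P x y z t : graph_wf P ->
  x \in hs P -> y \in hs P -> z \in hs P -> t \in hs P ->
  ctr2 P x y t z = ctr2 P x y z t.
Proof.
move=> wP xP yP zP tP; rewrite !ctr2E (orbCA (t \in [:: x; y]) (z \in [:: x; y])).
case: ifPn => //.
case/norP=> nz /norP[nt vw].
by rewrite (ctr_swap (wf_contract wP xP yP vw)) // mem_contract_hs.
Qed.

Lemma ctr2_swapl P x y z t : graph_wf P ->
  x \in hs P -> y \in hs P -> z \in hs P -> t \in hs P ->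
  ctr2 P y x z t = ctr2 P x y z t.
Proof.
move=> wP xP yP zP tP; rewrite !ctr2E [term P y == _]eq_sym.
have E u : (u \in [:: y; x]) = (u \in [:: x; y]) by rewrite !inE orbC.
rewrite !E; case: ifPn => //.
case/norP=> nz /norP[nt vw].
have wv : term P y != term P x by rewrite eq_sym.
have iso := contract_swap_iso wP xP yP vw.
have wxy := wf_contract wP xP yP vw; have wyx := wf_contract wP yP xP wv.
have zP' := mem_contract_hs zP nz; have tP' := mem_contract_hs tP nt.
rewrite (ctr_iso wxy wyx iso zP' tP') /iso_sign.
rewrite contract_swap_parity // scalerA -signr_addb.
by rewrite [contract_sign P x y (+) _]addbC addbA addbb addFb.
Qed.

Lemma hgd_eq P Q : graph_wf P -> graph_wf Q -> vs P = vs Q -> perm_eq (hs P) (hs Q) ->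
  {in hs P, bar Q =1 bar P} -> {in hs P, term Q =1 term P} ->
  {in hs P, init Q =1 init P} -> hgd k P = hgd k Q.
Proof.
move=> wP wQ ev ph eb et ei.
rewrite (hgd_iso k wP wQ (f := id) (g := id)); last by apply: iso_id => //; rewrite ev.
rewrite map_id ev parity_refl ?uniq_vs // /flips (@eq_in_count _ _ pred0) ?count_pred0.
  by rewrite scale1r.
by move=> h hP /=; rewrite ei // andbN.
Qed.

(* Under these conditions both iterated contractions have the same labels, the
   same vertex order and the same edge directions, so that the sign only comes
   from exchanging the removal of two vertices from the ordered list. *)
Lemma ctr2_anti_generic P x y z t : graph_wf P ->
  x \in hs P -> y \in hs P -> z \in hs P -> t \in hs P ->
  z \notin [:: x; y] -> t \notin [:: x; y] ->
  term P x != term P y -> term P z != term P t ->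
  term P y != term P t -> t != bar P y ->
  ctr2 P x y z t = - ctr2 P z t x y.
Proof.
move=> wP xP yP zP tP zn tn vw uu wu tby.
have xn : x \notin [:: z; t].
  by move: zn tn; rewrite !inE !negb_or ![x == _]eq_sym => /andP[-> _] /andP[-> _].
have yn : y \notin [:: z; t].
  by move: zn tn; rewrite !inE !negb_or ![y == _]eq_sym => /andP[_ ->] /andP[_ ->].
rewrite !ctr2E (negPf zn) (negPf tn) (negPf xn) (negPf yn) (negPf vw) (negPf uu) /=.
have xy : x != y by apply: contraNneq vw => ->.
have zt : z != t by apply: contraNneq uu => ->.
have w1 := wf_contract wP xP yP vw; have w2 := wf_contract wP zP tP uu.
have z1 := mem_contract_hs zP zn; have t1 := mem_contract_hs tP tn.
have x2 := mem_contract_hs xP xn; have y2 := mem_contract_hs yP yn.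
have ybt : y != bar P t by rewrite -(bar_eq wP yP tP) eq_sym.
have nE : (term (contract P x y) z == term (contract P x y) t) =
          (term (contract P z t) x == term (contract P z t) y).
  rewrite /= [term P t == _]eq_sym (negPf wu).
  move/eqP: (vw); move/eqP: (uu); move/eqP: (wu).
  move=> *; eq_cases; congruence.
rewrite !ctrE nE; case: (boolP (_ == _)) => [_|n2]; first by rewrite !scaler0 oppr0.
have n1 := n2; rewrite -nE in n1.
have tE : term (contract P x y) t = term P t.
  by rewrite /= [term P t == _]eq_sym (negPf wu).
have yE : term (contract P z t) y = term P y by rewrite /= (negPf wu).
have -> : hgd k (contract (contract P x y) z t) = hgd k (contract (contract P z t) x y).
  apply: hgd_eq; rewrite ?wf_contract //.
  - rewrite -[LHS]/(rem (term (contract P x y) t) (rem (term P y) (vs P))).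
    rewrite -[RHS]/(rem (term (contract P z t) y) (rem (term P t) (vs P))).
    by rewrite tE yE (remC _ _ (uniq_vs wP)).
  - rewrite /= -!filter_predI; under eq_filter do rewrite /= andbC.
    exact: perm_refl.
  - move=> h; rewrite !mem_filter => /andP[/andP[/eqP hz /eqP ht] /andP[/andP[/eqP hx /eqP hy] hP]].
    have bX := barK wP xP; have bY := barK wP yP; have bZ := barK wP zP.
    have bT := barK wP tP; have bH := barK wP hP.
    move: zn tn; rewrite !inE !negb_or => /andP[/eqP zx /eqP zy] /andP[/eqP tx /eqP ty].
    move/eqP: (zt) => zt'; move/eqP: (xy) => xy'; move/eqP: (ybt) => ybt'; move/eqP: (tby) => tby'.
    rewrite /=; clear - bX bY bZ bT bH zx zy tx ty zt' xy' ybt' tby' hx hy hz ht.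
    by eq_cases; congruence.
  - move=> h; rewrite !mem_filter => /andP[/andP[/eqP hz /eqP ht] /andP[/andP[/eqP hx /eqP hy] hP]].
    move: (vw) (uu) (wu) => /eqP vw' /eqP uu' /eqP wu'.
    move/eqP: n1 => /= n1; clear - vw' uu' wu' n1.
    by move: n1; eq_cases; congruence.
  - move=> h; rewrite !mem_filter => /andP[/andP[/eqP hz /eqP ht] /andP[/andP[/eqP hx /eqP hy] hP]].
    have bX := barK wP xP; have bY := barK wP yP; have bZ := barK wP zP.
    have bT := barK wP tP; have bH := barK wP hP.
    move: zn tn; rewrite !inE !negb_or => /andP[/eqP zx /eqP zy] /andP[/eqP tx /eqP ty].
    move/eqP: (zt) => zt'; move/eqP: (xy) => xy'; move/eqP: (ybt) => ybt'; move/eqP: (tby) => tby'.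
    rewrite /=; clear - bX bY bZ bT bH zx zy tx ty zt' xy' ybt' tby' hx hy hz ht.
    by eq_cases; congruence.
rewrite !scalerA -!signr_addb -scaleNr -signrN; congr ((-1) ^+ nat_of_bool _ *: _).
rewrite /contract_sign tE yE /= (negPf tby) (negPf ybt).
have := index_rem2 (uniq_vs wP) (term_vs wP yP) (term_vs wP tP) wu.
by repeat match goal with
 | |- context [odd ?n] => case: (odd n)
 | |- context [init ?A ?h] => case: (init A h) end.
Qed.

Lemma ctr2_overlap P x y z t : (z \in [:: x; y]) || (t \in [:: x; y]) ->
  ctr2 P x y z t = 0.
Proof. by rewrite ctr2E orbA => ->. Qed.

(** If both pairs join the same two vertices, then [z] and [t] end at the same vertex after the
    first contraction. *)
Lemma ctr2_parallel P x y z t :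
  term P z != term P t ->
  (term P x == term P z) && (term P y == term P t)
  || (term P x == term P t) && (term P y == term P z) ->
  ctr2 P x y z t = 0.
Proof.
move=> uu par; rewrite ctr2E ctrE /=; case: ifP => // _.
case: eqP => [|[]]; first by rewrite scaler0.
move/eqP: uu; case/orP: par => /andP[/eqP E1 /eqP E2] uu; eq_cases; congruence.
Qed.

(** [ctr2_anti_generic] needs one half-edge of each pair such that the two share neither a vertex
    nor an edge; exchanges within the pairs bring any of the four choices into this position. *)
Lemma ctr2_anti P x y z t : graph_wf P ->
  x \in hs P -> y \in hs P -> z \in hs P -> t \in hs P ->
  ctr2 P x y z t = - ctr2 P z t x y.
Proof.
move=> wP xP yP zP tP.
case: (boolP ((z \in [:: x; y]) || (t \in [:: x; y]))) => [ov|].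
  rewrite !ctr2_overlap ?oppr0 //; move: ov; rewrite !inE [x == z]eq_sym [y == z]eq_sym.
  by rewrite [x == t]eq_sym [y == t]eq_sym orbACA.
case/norP=> zn tn.
have xn : (x \in [:: z; t]) = false.
  by move: zn tn; rewrite !inE ![x == _]eq_sym; case: (z == x); case: (t == x).
have yn : (y \in [:: z; t]) = false.
  by move: zn tn; rewrite !inE ![y == _]eq_sym; do 2!case: (_ == x); case: (z == y); case: (t == y).
have [vw|vw] := eqVneq (term P x) (term P y).
  rewrite !ctr2E vw eqxx !orbT xn yn /=; case: ifP => _; first by rewrite oppr0.
  by rewrite ctrE /= vw eqxx scaler0 oppr0.
have [uu|uu] := eqVneq (term P z) (term P t).
  rewrite !ctr2E uu eqxx !orbT (negPf zn) (negPf tn) /= (negPf vw).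
  by rewrite ctrE /= uu eqxx scaler0 oppr0.
case: (boolP ((term P x == term P z) && (term P y == term P t)
  || (term P x == term P t) && (term P y == term P z))) => [par|npar].
  rewrite !ctr2_parallel ?oppr0 // ![_ == term P x]eq_sym ![_ == term P y]eq_sym.
  by rewrite andbC [X in _ || X]andbC orbC andbC orbC; move: par; do 4!case: (_ == _).
have zn' : z \notin [:: y; x] by move: zn; rewrite !inE orbC.
have tn' : t \notin [:: y; x] by move: tn; rewrite !inE orbC.
have wv : term P y != term P x by rewrite eq_sym.
have u' : term P t != term P z by rewrite eq_sym.
case: (boolP ((term P y == term P t) || (t == bar P y))) => [d|]; last first.
  by case/norP=> *; apply: ctr2_anti_generic.
case: (boolP ((term P x == term P t) || (t == bar P x))) => [b|]; last first.
  case/norP=> *; rewrite -ctr2_swapl // -[in RHS]ctr2_swapr //.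
  exact: ctr2_anti_generic.
case: (boolP ((term P y == term P z) || (z == bar P y))) => [c|]; last first.
  case/norP=> *; rewrite -ctr2_swapr // -[in RHS]ctr2_swapl //.
  exact: ctr2_anti_generic.
case: (boolP ((term P x == term P z) || (z == bar P x))) => [a|]; last first.
  case/norP=> *; rewrite -ctr2_swapl // -ctr2_swapr // -[in RHS]ctr2_swapl // -[in RHS]ctr2_swapr //.
  exact: ctr2_anti_generic.
(* Now each of [x], [y] shares a vertex or an edge with each of [z], [t]. No half-edge shares its
   vertex with both members of the other pair, and none is opposite to both, so the common vertices
   fill a diagonal of the two by two table: this is the excluded parallel case. *)
exfalso.
have xy : x != y by apply: contraNneq vw => ->.
have zt : z != t by apply: contraNneq uu => ->.
have bxy : bar P x != bar P y by apply: contraNneq xy => /(bar_inj wP xP yP)->.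
have N1 : ~~ ((z == bar P x) && (z == bar P y)).
  by apply: contraNN bxy => /andP[/eqP<- /eqP<-].
have N2 : ~~ ((t == bar P x) && (t == bar P y)).
  by apply: contraNN bxy => /andP[/eqP<- /eqP<-].
have N3 : ~~ ((z == bar P x) && (t == bar P x)).
  by apply: contraNN zt => /andP[/eqP-> /eqP->].
have N4 : ~~ ((z == bar P y) && (t == bar P y)).
  by apply: contraNN zt => /andP[/eqP-> /eqP->].
have T1 : ~~ ((term P x == term P z) && (term P x == term P t)).
  by apply: contraNN uu => /andP[/eqP<- /eqP<-].
have T2 : ~~ ((term P y == term P z) && (term P y == term P t)).
  by apply: contraNN uu => /andP[/eqP<- /eqP<-].
have T3 : ~~ ((term P x == term P z) && (term P y == term P z)).
  by apply: contraNN vw => /andP[/eqP-> /eqP->].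
have T4 : ~~ ((term P x == term P t) && (term P y == term P t)).
  by apply: contraNN vw => /andP[/eqP-> /eqP->].
move: a b c d npar N1 N2 N3 N4 T1 T2 T3 T4.
case: (z == bar P x); case: (z == bar P y); case: (t == bar P x); case: (t == bar P y) => //=;
case: (term P x == term P z); case: (term P x == term P t); 
case: (term P y == term P z); by case: (term P y == term P t).
Qed.

End Contraction.

(** * Disjoint unions *)

Notation "P ** Q" := (union_data P Q) (at level 40, left associativity).

Lemma wf_union P Q : graph_wf P -> graph_wf Q -> graph_wf (P ** Q).
Proof. by move=> wP wQ; apply: (@union_wf (OGraph wP) (OGraph wQ)). Qed.

Lemma map_id_half_inG (s : seq nat) : [seq (inG n)./2 | n <- s] = s.
Proof. by rewrite -[RHS]map_id; apply: eq_map => n; rewrite half_inG. Qed.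
Lemma map_id_half_inH (s : seq nat) : [seq (inH n)./2 | n <- s] = s.
Proof. by rewrite -[RHS]map_id; apply: eq_map => n; rewrite half_inH. Qed.

Lemma mem_inG_cat n (s t : seq nat) :
  (inG n \in map inG s ++ map inH t) = (n \in s).
Proof.
rewrite mem_cat (mem_map inG_inj) orbC; case: mapP => // -[m _ /eqP].
by rewrite inG_inH.
Qed.

Lemma mem_inH_cat n (s t : seq nat) :
  (inH n \in map inG s ++ map inH t) = (n \in t).
Proof.
rewrite mem_cat (mem_map inH_inj); case: mapP => // -[m _ /eqP].
by rewrite inH_inG.
Qed.

Definition parity_simp := (odd_inG, odd_inH, half_inG, half_inH).

Section UnionFields.
Variables P Q : graph_data.
Lemma bar_union n : bar (P ** Q) n =
  if odd n then inH (bar Q n./2) else inG (bar P n./2).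
Proof. by []. Qed.
Lemma term_union n : term (P ** Q) n =
  if odd n then inH (term Q n./2) else inG (term P n./2).
Proof. by []. Qed.
Lemma init_union n : init (P ** Q) n = if odd n then init Q n./2 else init P n./2.
Proof. by []. Qed.
Lemma bar_inG n : bar (P ** Q) (inG n) = inG (bar P n).
Proof. by rewrite bar_union odd_inG half_inG. Qed.
Lemma bar_inH n : bar (P ** Q) (inH n) = inH (bar Q n).
Proof. by rewrite bar_union odd_inH half_inH. Qed.
Lemma term_inG n : term (P ** Q) (inG n) = inG (term P n).
Proof. by rewrite term_union odd_inG half_inG. Qed.
Lemma term_inH n : term (P ** Q) (inH n) = inH (term Q n).
Proof. by rewrite term_union odd_inH half_inH. Qed.
Lemma init_inG n : init (P ** Q) (inG n) = init P n.
Proof. by rewrite init_union odd_inG half_inG. Qed.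
Lemma init_inH n : init (P ** Q) (inH n) = init Q n.
Proof. by rewrite init_union odd_inH half_inH. Qed.
Lemma vs_union : vs (P ** Q) = map inG (vs P) ++ map inH (vs Q).
Proof. by []. Qed.
Lemma hs_union : hs (P ** Q) = map inG (hs P) ++ map inH (hs Q).
Proof. by []. Qed.
Lemma mem_hs_inG n : (inG n \in hs (P ** Q)) = (n \in hs P).
Proof. exact: mem_inG_cat. Qed.
Lemma mem_hs_inH n : (inH n \in hs (P ** Q)) = (n \in hs Q).
Proof. exact: mem_inH_cat. Qed.
Lemma mem_vs_inG n : (inG n \in vs (P ** Q)) = (n \in vs P).
Proof. exact: mem_inG_cat. Qed.
Lemma mem_vs_inH n : (inH n \in vs (P ** Q)) = (n \in vs Q).
Proof. exact: mem_inH_cat. Qed.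
End UnionFields.

Definition union_simp := (bar_inG, bar_inH, term_inG, term_inH, init_inG, init_inH,
  inj_eq inG_inj, inj_eq inH_inj, inG_inH, inH_inG,
  mem_hs_inG, mem_hs_inH, mem_vs_inG, mem_vs_inH).

Lemma inGH_ind (p : nat -> Prop) : (forall n, p (inG n)) -> (forall n, p (inH n)) ->
  forall n, p n.
Proof.
move=> pG pH n; rewrite -[n]odd_double_half; case: (odd n); first exact: pH.
exact: pG.
Qed.

Lemma union_hs_ind P Q (p : nat -> Prop) :
  {in hs P, forall h, p (inG h)} -> {in hs Q, forall h, p (inH h)} ->
  {in hs (P ** Q), forall h, p h}.
Proof.
move=> pG pH; elim/inGH_ind => n; first by rewrite mem_hs_inG; apply: pG.
by rewrite mem_hs_inH; apply: pH.
Qed.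

Lemma size_union P Q : size (vs (P ** Q)) = (size (vs P) + size (vs Q))%N.
Proof. by rewrite size_cat !size_map. Qed.

Lemma graph_data_eq (P Q : graph_data) : vs P = vs Q -> hs P = hs Q ->
  bar P =1 bar Q -> term P =1 term Q -> init P =1 init Q -> P = Q.
Proof.
case: P Q => [v h b t i] [v' h' b' t' i'] /= -> -> eb et ei.
by rewrite (funext eb) (funext et) (funext ei).
Qed.

Section ContractFields.
Variables (P : graph_data) (x y : nat).
Lemma vs_contract : vs (contract P x y) = rem (term P y) (vs P).
Proof. by []. Qed.
Lemma hs_contract : hs (contract P x y) = [seq h <- hs P | (h != x) && (h != y)].
Proof. by []. Qed.
Lemma bar_contract h : bar (contract P x y) h =
  if bar P h == x then bar P y else if bar P h == y then bar P x else bar P h.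
Proof. by []. Qed.
Lemma term_contract h : term (contract P x y) h =
  if term P h == term P y then term P x else term P h.
Proof. by []. Qed.
Lemma contract_init h : init (contract P x y) h =
  if h == bar P y then init P x else init P h.
Proof. by []. Qed.
End ContractFields.

Definition contract_simp := (bar_contract, term_contract, contract_init).

Lemma filter_map_inG (a : pred nat) s :
  filter a (map inG s) = map inG (filter (fun n => a (inG n)) s).
Proof. exact: filter_map. Qed.
Lemma filter_map_inH (a : pred nat) s :
  filter a (map inH s) = map inH (filter (fun n => a (inH n)) s).
Proof. exact: filter_map. Qed.

(** The labels persist, so the two graphs are equal and not just isomorphic. Contractions inside the
    second factor, whose vertices have shifted indices, are reached through [union_swap_iso]. *)
Lemma contract_unionl P Q x y : graph_wf P -> graph_wf Q ->
  contract (P ** Q) (inG x) (inG y) = contract P x y ** Q.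
Proof.
move=> wP wQ; have /graph_wfP[u1 _ _ _] := wf_union wP wQ.
apply: graph_data_eq.
- rewrite vs_contract rem_filter // !vs_union filter_cat filter_map_inG filter_map_inH.
  rewrite vs_contract rem_filter ?uniq_vs // union_simp; congr (_ ++ _); congr (map _ _).
    by apply: eq_filter => n /=; rewrite (inj_eq inG_inj).
  by rewrite -[RHS]filter_predT; apply: eq_filter => n /=; rewrite inH_inG.
- rewrite hs_contract !hs_union filter_cat filter_map_inG filter_map_inH hs_contract.
  congr (_ ++ _); congr (map _ _).
    by apply: eq_filter => n; rewrite !union_simp.
  by rewrite -[RHS]filter_predT; apply: eq_filter => n; rewrite !union_simp.
- by elim/inGH_ind => n; rewrite !(union_simp, contract_simp) -?fun_if.
- by elim/inGH_ind => n; rewrite !(union_simp, contract_simp) -?fun_if.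
- by elim/inGH_ind => n; rewrite !(union_simp, contract_simp).
Qed.

Lemma index_inG n (s t : seq nat) : n \in s ->
  index (inG n) (map inG s ++ map inH t) = index n s.
Proof. by move=> ns; rewrite index_cat map_f // (index_map inG_inj). Qed.

Lemma contract_sign_unionl P Q x y : graph_wf P -> y \in hs P ->
  contract_sign (P ** Q) (inG x) (inG y) = contract_sign P x y.
Proof.
by move=> wP yP; rewrite /contract_sign !union_simp vs_union index_inG // term_vs.
Qed.

(** * Signs of the isomorphisms between disjoint unions *)

Section UnionIso.
Variables (f1 g1 f2 g2 : nat -> nat) (P1 P2 Q1 Q2 : graph_data).
Hypotheses (wP1 : graph_wf P1) (wP2 : graph_wf P2) (wQ1 : graph_wf Q1) (wQ2 : graph_wf Q2)
  (iso1 : graph_iso f1 g1 P1 Q1) (iso2 : graph_iso f2 g2 P2 Q2).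

Definition union_map (f g : nat -> nat) n := if odd n then inH (g n./2) else inG (f n./2).

Lemma union_map_inG f g n : union_map f g (inG n) = inG (f n).
Proof. by rewrite /union_map odd_inG half_inG. Qed.
Lemma union_map_inH f g n : union_map f g (inH n) = inH (g n).
Proof. by rewrite /union_map odd_inH half_inH. Qed.

Lemma map_union_map f g s t : map (union_map f g) (map inG s ++ map inH t) =
  map inG (map f s) ++ map inH (map g t).
Proof.
rewrite map_cat -!map_comp; congr (_ ++ _); apply: eq_map => n /=.
  exact: union_map_inG.
exact: union_map_inH.
Qed.

Lemma union_graph_iso :
  graph_iso (union_map f1 f2) (union_map g1 g2) (P1 ** P2) (Q1 ** Q2).
Proof.
have [pv1 ph1 eb1 et1] := iso1; have [pv2 ph2 eb2 et2] := iso2.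
split; rewrite ?map_union_map ?perm_cat ?perm_map //.
- by apply: union_hs_ind => h hP; rewrite !(union_map_inG, union_map_inH, union_simp) ?eb1 ?eb2.
- by apply: union_hs_ind => h hP; rewrite !(union_map_inG, union_map_inH, union_simp) ?et1 ?et2.
Qed.

Lemma union_iso_sign : iso_sign (union_map f1 f2) (union_map g1 g2) (P1 ** P2) (Q1 ** Q2)
  = iso_sign f1 g1 P1 Q1 (+) iso_sign f2 g2 P2 Q2.
Proof.
have [pv1 ph1 eb1 et1] := iso1; have [pv2 ph2 eb2 et2] := iso2.
have u1 : uniq (map f1 (vs P1)) by rewrite (perm_uniq pv1) uniq_vs.
have u2 : uniq (map f2 (vs P2)) by rewrite (perm_uniq pv2) uniq_vs.
have [pv _ _ _] := union_graph_iso.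
have uu : uniq (map inG (map f1 (vs P1)) ++ map inH (map f2 (vs P2))).
  by rewrite -map_union_map (perm_uniq pv) uniq_vs // wf_union.
rewrite /iso_sign !vs_union map_union_map parity_cat ?perm_map //.
rewrite (parity_map (in2W inG_inj)) // (parity_map (in2W inH_inj)) //.
rewrite addbACA; congr (_ (+) _); rewrite /flips hs_union count_cat oddD !count_map.
congr (odd _ (+) odd _); apply: eq_count => h.
  rewrite -[LHS]/(init (P1 ** P2) (inG h) && ~~ init (Q1 ** Q2) (union_map g1 g2 (inG h))).
  by rewrite union_map_inG !union_simp.
rewrite -[LHS]/(init (P1 ** P2) (inH h) && ~~ init (Q1 ** Q2) (union_map g1 g2 (inH h))).
by rewrite union_map_inH !union_simp.
Qed.

End UnionIso.

Section UnionComm.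
Variables P Q : graph_data.
Hypotheses (wP : graph_wf P) (wQ : graph_wf Q).

Definition union_swap n := if odd n then inG n./2 else inH n./2.
Lemma union_swap_inG n : union_swap (inG n) = inH n.
Proof. by rewrite /union_swap odd_inG half_inG. Qed.
Lemma union_swap_inH n : union_swap (inH n) = inG n.
Proof. by rewrite /union_swap odd_inH half_inH. Qed.

Lemma map_union_swap s t :
  map union_swap (map inG s ++ map inH t) = map inH s ++ map inG t.
Proof.
rewrite map_cat -!map_comp; congr (_ ++ _); apply: eq_map => n /=.
  exact: union_swap_inG.
exact: union_swap_inH.
Qed.

Lemma union_swap_iso : graph_iso union_swap union_swap (P ** Q) (Q ** P).
Proof.
split.
- by rewrite map_union_swap perm_catC.
- by rewrite map_union_swap perm_catC.
- by apply: union_hs_ind => h hP; rewrite !(union_swap_inG, union_swap_inH, union_simp).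
- by apply: union_hs_ind => h hP; rewrite !(union_swap_inG, union_swap_inH, union_simp).
Qed.

Lemma union_swap_sign :
  iso_sign union_swap union_swap (P ** Q) (Q ** P) = odd (size (vs P) * size (vs Q)).
Proof.
have [pv _ _ _] := union_swap_iso; rewrite /iso_sign.
rewrite map_union_swap parity_catC; last first.
  by rewrite -map_union_swap (perm_uniq pv) uniq_vs // wf_union.
rewrite !size_map /flips (@eq_in_count _ _ pred0) ?count_pred0 ?addbF //.
by apply: union_hs_ind => h hP;
  rewrite !(union_swap_inG, union_swap_inH, union_simp) andbN.
Qed.

End UnionComm.

Section UnionSwap23.
Variables P Q R : graph_data.
Hypotheses (wP : graph_wf P) (wQ : graph_wf Q) (wR : graph_wf R).

(** Together with an exchange of the first two factors it yields all permutations of three graphs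
    without rebracketing the union. *)
Definition union_swap23 n :=
  if odd n then inG (inH n./2) else
  if odd n./2 then inH n./2./2 else inG (inG n./2./2).
Lemma union_swap23_1 n : union_swap23 (inG (inG n)) = inG (inG n).
Proof. by rewrite /union_swap23 !parity_simp. Qed.
Lemma union_swap23_2 n : union_swap23 (inG (inH n)) = inH n.
Proof. by rewrite /union_swap23 !parity_simp. Qed.
Lemma union_swap23_3 n : union_swap23 (inH n) = inG (inH n).
Proof. by rewrite /union_swap23 !parity_simp. Qed.

Definition union_swap23E := (union_swap23_1, union_swap23_2, union_swap23_3).

Lemma map_union_swap23 s t r :
  map union_swap23 (map inG (map inG s ++ map inH t) ++ map inH r) =
  map inG (map inG s) ++ (map inH t ++ map inG (map inH r)).
Proof.
rewrite !map_cat -!map_comp -catA; congr (_ ++ (_ ++ _)); apply: eq_map => n /=;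
  by rewrite union_swap23E.
Qed.

Lemma union_swap23_iso :
  graph_iso union_swap23 union_swap23 (P ** Q ** R) (P ** R ** Q).
Proof.
have pv (s t r : seq nat) : perm_eq (map inG (map inG s) ++ (map inH t ++ map inG (map inH r)))
    (map inG (map inG s ++ map inH r) ++ map inH t).
  by rewrite map_cat -catA perm_cat2l perm_catC.
split; rewrite ?map_union_swap23 //.
- by apply: union_hs_ind; [apply: union_hs_ind|] => h hP; rewrite !(union_swap23E, union_simp).
- by apply: union_hs_ind; [apply: union_hs_ind|] => h hP; rewrite !(union_swap23E, union_simp).
Qed.

Lemma union_swap23_sign :
  iso_sign union_swap23 union_swap23 (P ** Q ** R) (P ** R ** Q)
  = odd (size (vs Q) * size (vs R)).
Proof.
have [pv _ _ _] := union_swap23_iso; rewrite /iso_sign.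
have u3 : uniq (map union_swap23 (vs (P ** Q ** R))).
  by rewrite (perm_uniq pv) uniq_vs // !wf_union.
move: u3; rewrite !vs_union map_union_swap23 map_cat -[in X in _ -> X]catA => u3.
rewrite parity_cat //; last by rewrite perm_catC.
have u2 : uniq (map inH (vs Q) ++ map inG (map inH (vs R))).
  by move: u3; rewrite cat_uniq => /and3P[].
rewrite parity_refl; last by move: u3; rewrite cat_uniq => /and3P[].
rewrite addFb parity_catC // !size_map.
rewrite /flips (@eq_in_count _ _ pred0) ?count_pred0 ?addbF //.
by apply: union_hs_ind; [apply: union_hs_ind|] => h hP;
  rewrite !(union_swap23E, union_simp) andbN.
Qed.

End UnionSwap23.

(** * Connectedness and cut vertices *)

Section Components.
Variables (T T' : finType) (e : rel T) (e' : rel T') (f : T' -> T).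
Hypotheses (se : symmetric e) (se' : symmetric e').
Hypothesis fe : forall x y, e' x y -> connect e (f x) (f y).
Hypothesis fs : forall t, exists t', connect e t (f t').

Lemma connect_n_comp1 : reflect (exists x, forall y, connect e x y) (n_comp e predT == 1%N).
Proof.
have ce := sym_connect_sym se.
apply: (iffP eqP) => [n1|[x cx]]; last first.
  by rewrite -(n_comp_connect ce x); apply: eq_n_comp_r => y; rewrite !inE cx.
have /card1P[x xE] : #|predI (roots e) predT| == 1%N by rewrite -n1.
exists x => y; have := xE (fingraph.root e y); rewrite !inE roots_root // => /esym/eqP <-.
by rewrite ce connect_root.
Qed.

Lemma n_comp_gt0 (x : T) : (0 < n_comp e predT)%N.
Proof.
apply/card_gt0P; exists (fingraph.root e x); rewrite !inE roots_root //.
exact: sym_connect_sym.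
Qed.

Lemma connect_hom x y : connect e' x y -> connect e (f x) (f y).
Proof.
case/connectP => p; elim: p x => [|z p IHp] x /=; first by move=> _ ->.
by case/andP=> /fe/connect_trans xz /IHp{}IHp /IHp; apply: xz.
Qed.

(** By [fs] the map that [f] induces on components is onto, so their number drops exactly when this
    map is not injective. *)
Lemma n_comp_ltP : reflect (exists x y, connect e (f x) (f y) && ~~ connect e' x y)
  (n_comp e predT < n_comp e' predT)%N.
Proof.
have ce := sym_connect_sym se; have ce' := sym_connect_sym se'.
pose r x := fingraph.root e (f x); pose D := [set x | roots e' x].
have nD : n_comp e' predT = #|D|.
  by apply: eq_card => x; rewrite !inE andbT.
have nr : n_comp e predT = #|r @: D|.
  apply: eq_card => x; rewrite !inE andbT; apply/idP/imsetP => [rx|[y _ ->]]; last exact: roots_root.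
  have [t' xt'] := fs x; exists (fingraph.root e' t'); first by rewrite inE roots_root.
  rewrite /r -{1}(eqP rx); apply/eqP; rewrite root_connect // (connect_trans xt') //.
  by apply: connect_hom; apply: connect_root.
rewrite nD nr ltn_neqAle leq_imset_card andbT; apply: (iffP idP).
  move/imset_injP => ni; apply: contrapT => nex; apply: ni => x y.
  rewrite !inE => rx ry /eqP; rewrite root_connect // => cxy.
  rewrite -(eqP rx) -(eqP ry); apply/eqP; rewrite root_connect //.
  by apply: contrapT => /negP nc; apply: nex; exists x, y; rewrite cxy nc.
case=> x [y /andP[cxy nxy]]; apply: contraNN nxy => /imset_injP inj.
rewrite -root_connect //; apply/eqP; apply: inj; rewrite ?inE ?roots_root //.
apply/eqP; rewrite root_connect //.
apply: connect_trans (connect_trans _ cxy) _.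
  by rewrite ce; apply/connect_hom/connect_root.
by apply/connect_hom/connect_root.
Qed.

End Components.

(** The unions of components, as sets of vertices. They replace paths, which are hard to follow
    through the merging of vertices and the regluing of edges. *)
Definition closed_set (P : graph_data) (S : pred nat) : Prop :=
  {in hs P, forall h, S (term P (bar P h)) = S (term P h)}.

(** The smallest closed set that contains [v]. *)
Definition component (P : graph_data) (v : nat) : pred nat :=
  fun u => `[< forall S, closed_set P S -> S v -> S u >].

Section ComponentFacts.
Variable P : graph_data.

Lemma closed_setC S : closed_set P S -> closed_set P (predC S).
Proof. by move=> cS h hP /=; rewrite cS. Qed.

Lemma component_refl v : component P v v.
Proof. by apply/asboolP. Qed.

Lemma component_min S v u : closed_set P S -> component P v u -> S v -> S u.
Proof. by move=> cS /asboolP; apply. Qed.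

Lemma component_eq S v u : closed_set P S -> component P v u -> S v = S u.
Proof.
move=> cS cvu; apply/idP/idP; first exact: component_min cvu.
by apply: contraTT; apply: (component_min (closed_setC cS) cvu).
Qed.

Hypothesis wP : graph_wf P.

Lemma component_closed v : closed_set P (component P v).
Proof.
move=> h hP; apply/asboolP/asboolP => c S cS Sv; first by rewrite -cS // c.
by rewrite cS // c.
Qed.

Lemma component_sym v u : component P v u = component P u v.
Proof.
suff H x y : component P x y -> component P y x by apply/idP/idP; apply: H.
by move=> /asboolP c; apply/asboolP => S cS; apply: contraTT => ?; apply: (c (predC S)) => //; apply: closed_setC.
Qed.

Lemma has_half_edge v : v \in vs P -> exists2 h, h \in hs P & term P h = v.
Proof.
case/graph_wfP: wP => _ _ _ vP /vP v3; have : (0 < count (fun h => term P h == v) (hs P))%N.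
  exact: leq_trans v3.
by rewrite -has_count => /hasP[h hP /eqP<-]; exists h.
Qed.

Lemma mem_cells_inl K v : (inl v \in cells P K) = (v \in vs P) && K v.
Proof.
rewrite mem_cat; apply/orP/andP => [[/mapP[u]|/mapP[//]]|[vP Kv]].
  by rewrite mem_filter => /andP[Ku uP] [->].
by left; rewrite map_f // mem_filter Kv.
Qed.

Lemma mem_cells_inr K h : (inr h \in cells P K) = (h \in hs P).
Proof.
rewrite mem_cat (mem_map (f := inr)) => [|a b []//].
by rewrite orbC; case: (boolP (h \in hs P)) => //= _; apply/mapP => -[].
Qed.

Lemma incident_sym K (c d : seq_sub (cells P K)) :
  incident P (val c) (val d) = incident P (val d) (val c).
Proof.
case: c d => [[v|h] /= c] [[u|h'] /= d] //.
by rewrite !mem_cells_inr in c d; rewrite bar_eq // eq_sym.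
Qed.

Notation inc K := (fun c d : seq_sub (cells P K) => incident P (val c) (val d)).

Lemma connect_inl_component K (c d : seq_sub (cells P K)) S : closed_set P S ->
  connect (inc K) c d ->
  let s x := match x with inl v => S v | inr h => S (term P h) end in
  s (val c) = s (val d).
Proof.
move=> cS cd s.
have cl : closed (inc K) [pred x | s (val x)].
  case=> [[v|h] /= c'] [[u|h'] /= d'] //=; rewrite !inE /=.
  - by move/eqP->.
  - by move/eqP->.
  - by rewrite mem_cells_inr in c'; move/eqP<-; rewrite cS.
by have := closed_connect cl cd; rewrite !inE.
Qed.

Lemma connectedP : reflect
  (exists2 v, v \in vs P & {in vs P, forall u, component P v u}) (connected P).
Proof.
have se : symmetric (inc predT) by move=> c d; apply: incident_sym.
rewrite /connected /ncomp; apply: (iffP (connect_n_comp1 se)).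
  case=> c cc.
  have [v vP] : exists v, v \in vs P.
    case: c {cc} => [[v|h] /=]; first by rewrite mem_cells_inl => /andP[]; exists v.
    by rewrite mem_cells_inr => hP; exists (term P h); apply: term_vs.
  exists v => // u uP; apply/asboolP => S cS Sv.
  have vc : inl v \in cells P predT by rewrite mem_cells_inl vP.
  have uc : inl u \in cells P predT by rewrite mem_cells_inl uP.
  have ce := sym_connect_sym se.
  have := @connect_inl_component predT (SeqSub vc) (SeqSub uc) S cS.
  rewrite /= Sv => <- //; apply: connect_trans (cc _); rewrite ce; exact: cc.
case=> v vP vc; have cv : inl v \in cells P predT by rewrite mem_cells_inl vP.
have ce := sym_connect_sym se.
exists (SeqSub cv).
(* The vertices joined to [v] by a path of cells. The existential makes sense for every number [u],
   also when [inl u] is not a cell. *)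
pose S u := [exists d : seq_sub (cells P predT),
   (val d == inl u) && connect (inc predT) (SeqSub cv) d].
have SE u (uc : inl u \in cells P predT) : S u = connect (inc predT) (SeqSub cv) (SeqSub uc).
  apply/existsP/idP => [[d /andP[/eqP du]]|c]; last by exists (SeqSub uc); rewrite /= eqxx.
  by have -> : d = SeqSub uc by apply: val_inj.
have cS : closed_set P S.
  suff H h : h \in hs P -> S (term P (bar P h)) -> S (term P h).
    move=> h hP; apply/idP/idP; first exact: H.
    by move=> Sh; apply: H; rewrite ?bar_hs ?barK.
  move=> hP.
  have hc : inr h \in cells P predT by rewrite mem_cells_inr.
  have hc' : inr (bar P h) \in cells P predT by rewrite mem_cells_inr bar_hs.
  have tc : inl (term P h) \in cells P predT by rewrite mem_cells_inl term_vs.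
  have tc' : inl (term P (bar P h)) \in cells P predT by rewrite mem_cells_inl term_vs ?bar_hs.
  rewrite (SE _ tc) (SE _ tc') => c'; apply: connect_trans c' _.
  apply: (@connect_trans _ _ (SeqSub hc')); first by apply: connect1; rewrite /= eqxx.
  apply: (@connect_trans _ _ (SeqSub hc)); first by apply: connect1; rewrite /= barK.
  by apply: connect1; rewrite /= eqxx.
have Su u : u \in vs P -> S u.
  move=> uP; apply: (component_min cS (vc u uP)); rewrite (SE _ cv); exact: connect0.
case=> [[u|h] dc].
  by rewrite -SE Su //; move: dc; rewrite mem_cells_inl => /andP[].
have hP : h \in hs P by move: dc; rewrite mem_cells_inr.
have tc : inl (term P h) \in cells P predT by rewrite mem_cells_inl term_vs.
apply: (@connect_trans _ _ (SeqSub tc)); first by rewrite -SE Su // term_vs.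
by apply: connect1; rewrite /= eqxx.
Qed.

Lemma ncomp_gt0 v : v \in vs P -> (0 < ncomp P predT)%N.
Proof.
move=> vP; have cv : inl v \in cells P predT by rewrite mem_cells_inl vP.
apply: n_comp_gt0 (SeqSub cv); move=> c d; exact: incident_sym.
Qed.

Lemma connectedPP u v S : connected P -> closed_set P S -> u \in vs P -> v \in vs P -> S u = S v.
Proof.
move=> /connectedP[w wv wc] cS uP vP.
by rewrite -(component_eq cS (wc u uP)) -(component_eq cS (wc v vP)).
Qed.

(* A vertex c is a cut vertex when the edges can be split into two parts that
   meet at c only, and both reach c. *)
Definition cut_witness c (Z : pred nat) : Prop :=
  [/\ {in hs P, forall h, Z (bar P h) = Z h},
      {in hs P &, forall h h', term P h = term P h' -> term P h != c -> Z h = Z h'},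
      exists2 g, g \in hs P & (term P g == c) && Z g
    & exists2 g, g \in hs P & (term P g == c) && ~~ Z g].

(** By [n_comp_ltP] a cut vertex separates two cells that are connected in [P], and [Z] can be taken
    as the set of half-edges still reached from one of them. Conversely, two half-edges at [c] on
    different sides are such cells. *)
Lemma cut_vertexP c : reflect (exists Z, cut_witness c Z) (cut_vertex P c).
Proof.
have se K : symmetric (inc K) by move=> a b; apply: incident_sym.
pose K := predC1 c.
have sub x : x \in cells P K -> x \in cells P predT.
  by case: x => [v|h]; rewrite ?mem_cells_inl ?mem_cells_inr // => /andP[->].
pose f (x : seq_sub (cells P K)) := SeqSub (sub _ (valP x)).
have fe x y : inc K x y -> connect (inc predT) (f x) (f y) by move=> xy; apply: connect1.
have fs : c \in vs P -> forall t, exists t', connect (inc predT) t (f t').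
  move=> cP [[v|h] tc].
    have [vc|vc] := eqVneq v c.
      have [h hP hc] := has_half_edge cP.
      have hc' : inr h \in cells P K by rewrite mem_cells_inr.
      by exists (SeqSub hc'); apply: connect1; rewrite /= hc vc.
    have tc' : inl v \in cells P K.
      by move: tc; rewrite !mem_cells_inl => /andP[-> _]; rewrite /= vc.
    by exists (SeqSub tc'); rewrite (_ : f _ = SeqSub tc) //; apply: val_inj.
  have tc' : inr h \in cells P K by move: tc; rewrite !mem_cells_inr.
  by exists (SeqSub tc'); rewrite (_ : f _ = SeqSub tc) //; apply: val_inj.
rewrite /cut_vertex /ncomp; apply: (iffP andP) => [[cP /(n_comp_ltP (se _) (se _) fe (fs cP))]|].
  case=> x [y /andP[cxy nxy]].
  pose Z h := [exists d : seq_sub (cells P K), (val d == inr h) && connect (inc K) x d].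
  have ZE h (hc : inr h \in cells P K) : Z h = connect (inc K) x (SeqSub hc).
    apply/existsP/idP => [[d /andP[/eqP du]]|a]; last by exists (SeqSub hc); rewrite /= eqxx.
    by have -> : d = SeqSub hc by apply: val_inj.
  have tr a b : inc K a b -> connect (inc K) x a = connect (inc K) x b.
    move=> ab; apply/idP/idP => xa; apply: connect_trans xa _; apply: connect1 => //.
    by rewrite incident_sym.
  (* If all half-edges at [c] were on one side, [c] could be added to that side, and [x] and [y]
     would be separated in [P] already. *)
  have nb b : ~ {in hs P, forall h, term P h = c -> Z h = b}.
    move=> hb.
    pose a (d : seq_sub (cells P predT)) := if val d == inl c then b else
      [exists d' : seq_sub (cells P K), (val d' == val d) && connect (inc K) x d'].
    have aE d (dc : val d \in cells P K) : a d = connect (inc K) x (SeqSub dc).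
      rewrite /a; case: eqP => [E|_]; first by exfalso; have := dc; rewrite E mem_cells_inl /= eqxx andbF.
      apply/existsP/idP => [[d' /andP[/eqP dd]]|q]; last by exists (SeqSub dc); rewrite /= eqxx.
      by have -> : d' = SeqSub dc by apply: val_inj.
    have afE d : a (f d) = connect (inc K) x d.
      rewrite (aE (f d) (valP d)); congr connect; exact: val_inj.
    have ca : closed (inc predT) a.
      suff H p q : inc predT p q -> p \in a -> q \in a.
        move=> p q pq; apply/idP/idP; apply: H; first exact: pq.
        by have := pq; rewrite incident_sym.
      move=> pq; change (a p -> a q).
      have [Ep|Np] := boolP (val p \in cells P K); have [Eq|Nq] := boolP (val q \in cells P K).
      - by rewrite (aE p Ep) (aE q Eq) (tr (SeqSub Ep) (SeqSub Eq)).
      - rewrite (aE p Ep).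
        case: q pq Nq => [[v|h] qc] pq /=; last by rewrite mem_cells_inr -(mem_cells_inr predT) qc.
        rewrite mem_cells_inl /= => Nq; have vP := qc; rewrite mem_cells_inl andbT in vP.
        rewrite vP negbK /= in Nq; rewrite [a _]/a /= (eqP Nq) eqxx.
        case: p pq Ep => [[u|h] pc] //= pq Ep.
        by rewrite -ZE (hb h) -?(eqP Nq) //; [rewrite mem_cells_inr in Ep|apply/eqP].
      - rewrite (aE q Eq).
        case: p pq Np => [[v|h] qc] pq /=; last by rewrite mem_cells_inr -(mem_cells_inr predT) qc.
        rewrite mem_cells_inl /= => Nq; have vP := qc; rewrite mem_cells_inl andbT in vP.
        rewrite vP negbK /= in Nq; rewrite [a _]/a /= (eqP Nq) eqxx.
        case: q pq Eq => [[u|h] pc] //= pq Ep.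
        by rewrite -ZE (hb h) -?(eqP Nq) //; [rewrite mem_cells_inr in Ep|apply/eqP].
      - case: p q pq Np Nq => [[v|h] pc] [[u|h'] qc] //= _;
          by rewrite ?(mem_cells_inr K) -?(mem_cells_inr predT) ?pc ?qc.
    have : a (f x) = a (f y) := closed_connect ca cxy; rewrite !afE connect0 => /esym xy.
    by rewrite xy in nxy.
  exists Z; split.
  - move=> h hP; have hc : inr h \in cells P K by rewrite mem_cells_inr.
    have hc' : inr (bar P h) \in cells P K by rewrite mem_cells_inr bar_hs.
    by rewrite (ZE _ hc) (ZE _ hc'); apply: tr; rewrite /= barK.
  - move=> h h' hP hP' tt tc; have hc : inr h \in cells P K by rewrite mem_cells_inr.
    have hc' : inr h' \in cells P K by rewrite mem_cells_inr.
    have vc : inl (term P h) \in cells P K by rewrite mem_cells_inl term_vs.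
    rewrite (ZE _ hc) (ZE _ hc') (tr (SeqSub hc) (SeqSub vc)) /= ?eqxx //.
    by rewrite (tr (SeqSub vc) (SeqSub hc')) /= ?tt.
  - apply: contrapT => nex; apply: (nb false) => h hP hc; apply: contrapT => Zh; apply: nex.
    by exists h; rewrite // hc eqxx; case: (Z h) Zh.
  - apply: contrapT => nex; apply: (nb true) => h hP hc; apply: contrapT => Zh; apply: nex.
    by exists h; rewrite // hc eqxx; case: (Z h) Zh.
case=> Z [Zb Zt [g gP /andP[/eqP gc Zg]] [g' gP' /andP[/eqP gc' Zg']]].
have cP : c \in vs P by rewrite -gc term_vs.
split=> //; apply/(n_comp_ltP (se _) (se _) fe (fs cP)).
have g1 : inr g \in cells P K by rewrite mem_cells_inr.
have g2 : inr g' \in cells P K by rewrite mem_cells_inr.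
have c1 : inl c \in cells P predT by rewrite mem_cells_inl cP.
exists (SeqSub g1), (SeqSub g2); apply/andP; split.
  apply: (@connect_trans _ _ (SeqSub c1)); apply: connect1; rewrite /= ?gc ?gc' //.
(* A vertex other than [c] is put on the common side of its half-edges. *)
pose a (d : seq_sub (cells P K)) := match val d with
  | inl v => has (fun h => (term P h == v) && Z h) (hs P) | inr h => Z h end.
have ca : closed (inc K) a.
  have av (v h : nat) : inl v \in cells P K -> h \in hs P -> term P h == v ->
      has (fun h => (term P h == v) && Z h) (hs P) = Z h.
    rewrite mem_cells_inl /= => /andP[_ vc] hP /eqP hv.
    apply/hasP/idP => [[h' hP' /andP[/eqP hv' Zh]]|Zh]; last by exists h; rewrite // hv eqxx.
    by rewrite -(Zt h' h) ?hv ?hv'.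
  case=> [[v|h] /= c'] [[u|h'] /= d'] //= vh; rewrite !unfold_in /a /=.
  - by apply: av => //; move: d'; rewrite mem_cells_inr.
  - by apply/esym/av => //; move: c'; rewrite mem_cells_inr.
  - by rewrite -(eqP vh) Zb //; move: c'; rewrite mem_cells_inr.
by apply/negP => /(closed_connect ca) E; have : Z g = Z g' := E; rewrite Zg (negPf Zg').
Qed.

End ComponentFacts.

Section CutFacts.
Variable P : graph_data.
Hypothesis wP : graph_wf P.

Lemma has_cut_vertexP :
  reflect (exists c Z, cut_witness P c Z) (has_cut_vertex P).
Proof.
apply: (iffP hasP) => [[c _ /(cut_vertexP wP)[Z cZ]]|[c [Z cZ]]]; first by exists c, Z.
exists c; last by apply/(cut_vertexP wP); exists Z.
by case: cZ => _ _ [g gP /andP[/eqP<- _]] _; apply: term_vs.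
Qed.

(** The form in which the bound on valences is used: some half-edge at [v] survives a contraction
    that removes [a] and [b]. *)
Lemma third_half_edge v a b : v \in vs P ->
  exists h, [/\ h \in hs P, term P h = v, h != a & h != b].
Proof.
move=> vP; have /graph_wfP[_ uh _ /(_ v vP) v3] := wP.
suff : has (fun h => [&& term P h == v, h != a & h != b]) (hs P).
  by case/hasP => h hP /and3P[/eqP hv ha hb]; exists h.
apply: contraTT v3 => /hasPn nh; rewrite -ltnNge ltnS.
apply: (@leq_trans (count_mem a (hs P) + count_mem b (hs P))); last first.
  by rewrite !count_uniq_mem // -[2%N]/(1 + 1)%N leq_add ?leq_b1.
rewrite -count_predUI; apply: leq_trans (leq_addr _ _).
rewrite [X in (X <= _)%N](@eq_in_count _ _ (predI (fun h => term P h == v) (predU (pred1 a) (pred1 b)))).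
  by apply: sub_count => h /= /andP[].
move=> h /nh /=.
by case: (term P h == v); case: (h == a); case: (h == b).
Qed.

Lemma connected_intro v : v \in vs P ->
  (forall S, closed_set P S -> S v -> {in vs P, forall u, S u}) -> connected P.
Proof.
move=> vP H; apply/connectedP => //; exists v => // u uP.
by apply/asboolP => S cS Sv; apply: H uP.
Qed.

Lemma cut_witnessC c Z : cut_witness P c Z -> cut_witness P c (predC Z).
Proof.
case=> Zb Zt Zg [g gP Zg']; split => /=.
- by move=> h hP; rewrite Zb.
- by move=> h h' hP hP' tt tc; rewrite (Zt _ _ hP hP').
- by exists g.
- by case: Zg => g1 g1P /andP[E Z1]; exists g1; rewrite // negbK E.
Qed.

(* A cut edge of a graph has a cut vertex at its end, since the valences are at
   least 3. *)
Lemma closed_set_off_edge y S : connected P -> ~~ has_cut_vertex P -> y \in hs P ->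
  {in hs P, forall h, h != y -> h != bar P y -> S (term P (bar P h)) = S (term P h)} ->
  closed_set P S.
Proof.
move=> cP nc yP hS; set w := term P y.
suff Sy : S (term P (bar P y)) = S w.
  move=> h hP; have [->//|hy] := eqVneq h y.
  have [->|hby] := eqVneq h (bar P y); first by rewrite barK.
  exact: hS.
apply: contraNeq nc => Sy; apply/has_cut_vertexP.
(* One side consists of the edge of [y] and of everything that [S] separates from [w]; a third
   half-edge at [w] lies on the other side. *)
pose Z h := if (h == y) || (h == bar P y) then true else S (term P h) != S w.
have byP := bar_hs wP yP.
have [h3 [h3P h3w h3y h3b]] := third_half_edge y (bar P y) (term_vs wP yP).
exists w, Z; split.
- move=> h hP; have E2 : (bar P h == bar P y) = (h == y).
    by apply/eqP/eqP => [/(bar_inj wP hP yP)|->].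
  rewrite /Z E2 bar_eq // orbC; case: ifPn => // /norP[hy hby].
  by rewrite hS.
- have ZE h : h \in hs P -> term P h != w -> Z h = (S (term P h) != S w).
    move=> hP hw; rewrite /Z; have [hy|_] := eqVneq h y.
      by rewrite hy eqxx in hw.
    by case: eqVneq => //= ->; rewrite Sy.
  by move=> h h' hP hP' tt tc; rewrite !ZE -?tt.
- by exists y; rewrite // eqxx /Z eqxx.
- by exists h3; rewrite // h3w eqxx /Z (negPf h3y) (negPf h3b) h3w eqxx.
Qed.

End CutFacts.

(** * Components and cut vertices of a contraction *)

Section ContractCut.
Variables (P : graph_data) (x y : nat).
Hypotheses (wP : graph_wf P) (xP : x \in hs P) (yP : y \in hs P)
  (vw : term P x != term P y).

Definition merge u := if u == term P y then term P x else u.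

Lemma merge_id u : u \in vs (contract P x y) -> merge u = u.
Proof. by rewrite vs_contract (mem_rem_uniq _ (uniq_vs wP)) inE /merge => /andP[/negPf->]. Qed.

Lemma merge_vs u : u \in vs P -> merge u \in vs (contract P x y).
Proof.
rewrite vs_contract (mem_rem_uniq _ (uniq_vs wP)) inE /merge => uP.
by case: (eqVneq u (term P y)) => [_|uy]; apply/andP; rewrite ?vw ?term_vs.
Qed.

Lemma mem_vs_contract u : u \in vs (contract P x y) -> u \in vs P.
Proof. exact: mem_rem. Qed.

Lemma term_merge h : term (contract P x y) h = merge (term P h).
Proof. by []. Qed.

Lemma merge_y : merge (term P y) = term P x.
Proof. by rewrite /merge eqxx. Qed.

Lemma merge_x : merge (term P x) = term P x.
Proof. by rewrite /merge (negPf vw). Qed.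

Lemma closed_set_contract S : closed_set (contract P x y) S ->
  {in hs P, forall h, h \notin [:: x; y; bar P x; bar P y] ->
     S (merge (term P (bar P h))) = S (merge (term P h))}
  /\ S (merge (term P (bar P x))) = S (merge (term P (bar P y))).
Proof.
move=> cS; split=> [h hP|].
  rewrite !inE !negb_or => /and4P[hx hy hbx hby].
  have := cS h (mem_contract_hs hP _); rewrite !inE negb_or hx hy => /(_ isT).
  by rewrite bar_contract !bar_eq // (negPf hbx) (negPf hby) !term_merge.
have [Eyx|Nyx] := eqVneq (bar P x) y.
  by have -> : bar P y = x; rewrite -?Eyx ?barK // Eyx merge_y merge_x.
have bxP : bar P x \in hs (contract P x y).
  by rewrite mem_contract_hs ?bar_hs // !inE negb_or (bar_neq wP).
by have := cS _ bxP; rewrite bar_contract barK // eqxx !term_merge => ->.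
Qed.

(** The removed edges run from the merged vertex to the ends of the new edge, so [S] respects them
    if it has both on one side. Hence a contraction of a connected graph can only fall apart by
    separating the new edge from the merged vertex. *)
Lemma closed_set_merge S : closed_set (contract P x y) S ->
  S (merge (term P (bar P x))) = S (term P x) -> closed_set P (S \o merge).
Proof.
move=> cS Sx h hP /=; have [Sh Sb] := closed_set_contract cS.
have [->|hx] := eqVneq h x; first by rewrite Sx merge_x.
have [->|hy] := eqVneq h y; first by rewrite -Sb Sx merge_y.
have [->|hbx] := eqVneq h (bar P x); first by rewrite barK // merge_x Sx.
have [->|hby] := eqVneq h (bar P y); first by rewrite barK // merge_y -Sb Sx.
by apply: Sh; rewrite // !inE !negb_or hx hy hbx.
Qed.

Lemma bar_contract_ind (p : nat -> nat -> Prop) :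
  (forall h, h \in hs P -> h \notin [:: x; y; bar P x; bar P y] -> p h (bar P h)) ->
  (bar P x != y -> p (bar P x) (bar P y) /\ p (bar P y) (bar P x)) ->
  {in hs (contract P x y), forall h, p h (bar (contract P x y) h)}.
Proof.
move=> ph pb h; rewrite hs_contract mem_filter => /andP[/andP[hx hy] hP].
rewrite bar_contract !bar_eq //.
have [E|hbx] := eqVneq h (bar P x).
  by rewrite E in hy *; case: (pb hy).
have [E|hby] := eqVneq h (bar P y).
  have : bar P x != y by rewrite (bar_eq wP xP yP) eq_sym -E.
  by rewrite E => /pb[].
by apply: ph; rewrite // !inE !negb_or hx hy hbx.
Qed.

(** Everything that changes, the new edge and the merged vertex, belongs to the side of [x] and [y],
    so the same partition of half-edges still works, at the image of [c]. *)
Lemma cut_contract_same c Z : cut_witness P c Z -> Z x = Z y ->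
  has_cut_vertex (contract P x y).
Proof.
have wC := wf_contract wP xP yP vw.
move=> cZ Zxy; wlog Zx : Z cZ Zxy / Z x = false.
  move=> H; case Zx : (Z x); last exact: H cZ Zxy Zx.
  by apply: (H _ (cut_witnessC cZ)); rewrite /= -?Zxy Zx.
have Zy : Z y = false by rewrite -Zxy.
have [Zb Zt [g gP /andP[/eqP gc Zg]] [g' gP' /andP[/eqP gc' Zg']]] := cZ.
apply/has_cut_vertexP => //; exists (merge c), Z; split.
- apply: (@bar_contract_ind (fun h h' => Z h' = Z h)) => [h hP _|_]; first exact: Zb.
  by rewrite !Zb // Zx Zy.
- move=> h h'; rewrite hs_contract !mem_filter => /andP[_ hP] /andP[_ hP'].
  rewrite !term_merge => tt tc.
  (* If [c] is not one of the two merged vertices, all half-edges at the merged vertex are on the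
     side of [x] and [y]. *)
  have Zm a : a \in hs P -> merge (term P a) = term P x -> merge c != term P x -> Z a = false.
    move=> aP ax cx; have xc : term P x != c by apply: contraNneq cx => <-; rewrite merge_x.
    have yc : term P y != c by apply: contraNneq cx => <-; rewrite merge_y.
    move: ax; rewrite /merge; case: eqP => [ay _|_ ax].
      by rewrite (Zt a y) ?ay.
    by rewrite (Zt a x) ?ax.
  have [mx|mx] := eqVneq (merge (term P h)) (term P x).
    rewrite (Zm h) // ?(Zm h') // -?tt -?mx // eq_sym //.
  apply: Zt => //; last by apply: contraNneq tc => ->.
  move: tt mx; rewrite /merge; case: (eqVneq (term P h) _) => [->|_]; first by rewrite eqxx.
  by case: eqP => [_ -> |_ ->]; rewrite ?eqxx.
- exists g; last by rewrite term_merge gc eqxx.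
  by rewrite mem_contract_hs // !inE; apply/negP => /orP[]/eqP E; rewrite E ?Zx ?Zy in Zg.
- have tx := term_vs wP xP; have ty := term_vs wP yP.
  (* The side of [x] and [y] has lost these two half-edges. If [c] is one of their vertices, a third
     half-edge at the other one, now merged with [c], shows that this side still reaches [c]. *)
  have [cy|cy] := eqVneq c (term P y).
    have [h [hP hx h1 h2]] := third_half_edge wP x y tx.
    exists h; first by rewrite mem_contract_hs // !inE negb_or h1.
    rewrite term_merge hx cy merge_x merge_y eqxx (Zt h x) // ?Zx // hx.
    by rewrite cy.
  have [cx|cx] := eqVneq c (term P x).
    have [h [hP hy h1 h2]] := third_half_edge wP x y ty.
    exists h; first by rewrite mem_contract_hs // !inE negb_or h1.
    by rewrite term_merge hy cx merge_x merge_y eqxx (Zt h y) // ?Zy // hy eq_sym.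
  exists g'; last by rewrite term_merge gc' eqxx Zg'.
  rewrite mem_contract_hs // !inE; apply/negP => /orP[]/eqP E.
    by rewrite -gc' E eqxx in cx.
  by rewrite -gc' E eqxx in cy.
Qed.

(* If x and y lie on different sides of the cut, and the new edge is separated
   by S from the merged vertex, then either the new edge is a bridge or the
   merged vertex is a wedge point. *)
Lemma cut_contract : connected P -> has_cut_vertex P ->
  ~~ connected (contract P x y) -> has_cut_vertex (contract P x y).
Proof.
have wC := wf_contract wP xP yP vw.
move=> cP /(has_cut_vertexP wP)[c [Z cZ]] nC.
have tx := term_vs wP xP; have ty := term_vs wP yP.
have [|Zxy] := eqVneq (Z x) (Z y); first exact: cut_contract_same cZ.
wlog Zx : Z cZ Zxy / Z x = true.
  move=> H; case Zx : (Z x); first exact: H cZ Zxy Zx.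
  apply: (H _ (cut_witnessC cZ)); rewrite /= Zx //.
  by move: Zxy; rewrite Zx; case: (Z y).
have Zy : Z y = false by case: (Z y) Zxy; rewrite Zx.
have [Zb Zt [g gP /andP[/eqP gc Zg]] [g' gP' /andP[/eqP gc' Zg']]] := cZ.
have cV : c \in vs P by rewrite -gc term_vs.
have bxy : bar P x != y by apply/eqP => E; move: (Zb x xP); rewrite E Zx Zy.
(* As the contraction is disconnected, [S] contains the merged vertex but not the ends of the new
   edge. *)
have [S cS [Sm Sb]] : exists2 S, closed_set (contract P x y) S &
    S (term P x) /\ ~~ S (merge (term P (bar P x))).
  apply: contrapT => nS; move/negP: nC; apply.
  have mx := merge_vs tx; rewrite merge_x in mx.
  apply: (connected_intro wC mx) => S cS Sx u uC.
  have Sb : S (merge (term P (bar P x))).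
    by apply: contrapT => /negP Sb; apply: nS; exists S.
  have cS' : closed_set P (S \o merge) by apply: closed_set_merge; rewrite // Sb Sx.
  have := connectedPP wP cP cS' (mem_vs_contract uC) tx.
  by rewrite /= merge_x (merge_id uC) Sx.
have bxC : bar P x \in hs (contract P x y).
  by rewrite mem_contract_hs ?bar_hs // !inE negb_or (bar_neq wP).
have Sby : S (merge (term P (bar P y))) = false.
  by have [_ <-] := closed_set_contract cS; apply: negbTE.
apply/has_cut_vertexP => //.
case Sc : (S (merge c)); last first.
  (* Here [c] is outside [S], so within [S] the two sides of [Z], one coming from [x] and one from
     [y], meet only at the merged vertex: this is the wedge point. *)
  have cx : c != term P x by apply: contraFneq Sc => ->; rewrite merge_x.
  have cy : c != term P y by apply: contraFneq Sc => ->; rewrite merge_y.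
  exists (term P x), (fun h => S (term (contract P x y) h) && Z h); split.
  - apply: (@bar_contract_ind (fun h h' => (S (term (contract P x y) h') && Z h')
       = (S (term (contract P x y) h) && Z h))) => [h hP hn|_].
      by have [/(_ h hP hn) E _] := closed_set_contract cS; rewrite !term_merge E Zb.
    by rewrite !term_merge Sby (negPf Sb).
  - move=> h h'; rewrite hs_contract !mem_filter => /andP[_ hP] /andP[_ hP'].
    rewrite !term_merge => tt tc; rewrite -tt; case Sh : (S _) => //=.
    apply: Zt => //.
      move: tt tc; rewrite /merge; case: (eqVneq (term P h) _) => [_|_]; first by rewrite eqxx.
      by case: eqP => [_ ->|_ ->]; rewrite ?eqxx.
    by apply: contraTneq Sh => ->; rewrite Sc.
  - have [h [hP hx h1 h2]] := third_half_edge wP x y tx.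
    exists h; first by rewrite mem_contract_hs // !inE negb_or h1.
    by rewrite term_merge hx merge_x eqxx Sm (Zt h x) ?Zx // hx eq_sym.
  - have [h [hP hy h1 h2]] := third_half_edge wP x y ty.
    exists h; first by rewrite mem_contract_hs // !inE negb_or h1.
    by rewrite term_merge hy merge_y eqxx Sm (Zt h y) ?Zy // hy eq_sym.
(* Here [c] is in [S], so outside [S] the two sides of [Z] share no vertex and are linked by the new
   edge only. It is a bridge, and its end at [bar x] is a cut vertex. *)
have Zbx : Z (bar P x) by rewrite Zb.
have Zby : Z (bar P y) = false by rewrite Zb.
have byx : bar P y != bar P x by apply: contraFneq Zby => ->.
have mS a : ~~ S (merge (term P a)) -> merge (term P a) = term P a.
  by rewrite /merge; case: eqP => // _; rewrite Sm.
have notc a : ~~ S (merge (term P a)) -> term P a != c by apply: contraNneq => ->.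
exists (merge (term P (bar P x))),
  (fun h => [&& ~~ S (term (contract P x y) h), Z h & h != bar P x]); split.
- apply: (@bar_contract_ind (fun h h' =>
     [&& ~~ S (term (contract P x y) h'), Z h' & h' != bar P x]
     = [&& ~~ S (term (contract P x y) h), Z h & h != bar P x])) => [h hP hn|_].
    have [/(_ h hP hn) E _] := closed_set_contract cS; rewrite !term_merge E Zb //.
    move: hn; rewrite !inE !negb_or => /and4P[hx hy hbx hby].
    rewrite hbx; case: eqP => [/(bar_inj wP hP xP) hE|//].
    by rewrite hE eqxx in hx.
  by rewrite Zby !andbF eqxx !andbF.
- move=> h h'; rewrite hs_contract !mem_filter => /andP[_ hP] /andP[_ hP'].
  rewrite !term_merge => tt tc; rewrite -tt; case Sh : (S _) => //=.
  have th := mS h (negbT Sh).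
  have th' : merge (term P h') = term P h' by apply: mS; rewrite -tt Sh.
  rewrite (Zt h h') //; last first.
  + exact: (notc h (negbT Sh)).
  + by rewrite -th tt th'.
  have h1 : h != bar P x by apply: contraNneq tc => ->.
  have h2 : h' != bar P x by apply: contraNneq tc => h2; rewrite tt h2.
  by rewrite h1 h2.
- have [h [hP hx h1 h2]] := third_half_edge wP (bar P x) y (term_vs wP (bar_hs wP xP)).
  have hx' : h != x.
    apply: contraNneq Sb => E; rewrite -hx E merge_x //.
  exists h; first by rewrite mem_contract_hs // !inE negb_or hx'.
  rewrite term_merge hx eqxx Sb h1 (Zt h (bar P x)) ?bar_hs ?Zbx // hx.
  exact: notc.
- by exists (bar P x); rewrite // term_merge eqxx /= eqxx !andbF.
Qed.

End ContractCut.

(** * Components and cut vertices of disjoint unions *)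

Section UnionComponents.
Variables P Q : graph_data.
Hypotheses (wP : graph_wf P) (wQ : graph_wf Q).

Lemma closed_set_union S :
  closed_set (P ** Q) S <-> closed_set P (S \o inG) /\ closed_set Q (S \o inH).
Proof.
split=> [cS|[cP cQ]].
  split=> h hP /=.
    by have := cS (inG h); rewrite !union_simp; apply.
  by have := cS (inH h); rewrite !union_simp; apply.
by apply: union_hs_ind => h hP; rewrite !union_simp; [apply: cP|apply: cQ].
Qed.

Lemma closed_set_odd S S' : closed_set P S -> closed_set Q S' ->
  closed_set (P ** Q) (fun n => if odd n then S' n./2 else S n./2).
Proof.
move=> cS cS'; apply/closed_set_union.
by split=> h hP; rewrite /comp !parity_simp; [apply: cS|apply: cS'].
Qed.

Lemma component_unionl v u : component (P ** Q) (inG v) (inG u) = component P v u.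
Proof.
apply/asboolP/asboolP => c S cS Sv.
  have := c _ (closed_set_odd cS (fun _ _ => erefl : pred0 _ = pred0 _)).
  by rewrite !parity_simp; apply.
by case/closed_set_union: cS => cP _; apply: (c (S \o inG)).
Qed.

Lemma component_unionr v u : component (P ** Q) (inH v) (inH u) = component Q v u.
Proof.
apply/asboolP/asboolP => c S cS Sv.
  have := c _ (closed_set_odd (fun _ _ => erefl : pred0 _ = pred0 _) cS).
  by rewrite !parity_simp; apply.
by case/closed_set_union: cS => _ cQ; apply: (c (S \o inH)).
Qed.

Lemma component_union_lr v u : component (P ** Q) (inG v) (inH u) = false.
Proof.
apply/asboolP => c; have := c _ (closed_set_odd (fun _ _ => erefl : predT _ = predT _)
  (fun _ _ => erefl : pred0 _ = pred0 _)).
by rewrite !parity_simp => /(_ isT).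
Qed.

Lemma component_union_rl v u : component (P ** Q) (inH v) (inG u) = false.
Proof. by rewrite component_sym component_union_lr. Qed.

Lemma union_disconnected v u : v \in vs P -> u \in vs Q -> ~~ connected (P ** Q).
Proof.
move=> vP uQ; apply/negP => c.
have := @connectedPP _ (wf_union wP wQ) (inG v) (inH u) odd c.
rewrite !union_simp odd_inG odd_inH vP uQ => E; suff : false by [].
by rewrite E //; apply/closed_set_union; split=> h hP; rewrite /comp !parity_simp.
Qed.

Lemma cut_witness_union c Z : cut_witness (P ** Q) c Z ->
  has_cut_vertex P || has_cut_vertex Q.
Proof.
case=> Zb Zt [g gP /andP[/eqP gc Zg]] [g' gP' /andP[/eqP gc' Zg']].
have ZbG : {in hs P, forall h, Z (inG (bar P h)) = Z (inG h)}.
  by move=> h hP; rewrite -(bar_inG P Q) Zb ?union_simp.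
have ZbH : {in hs Q, forall h, Z (inH (bar Q h)) = Z (inH h)}.
  by move=> h hP; rewrite -(bar_inH P Q) Zb ?union_simp.
elim/inGH_ind: c Zt gc gc' => c Zt gc gc'; apply/orP; [left|right].
  apply/has_cut_vertexP => //; exists c, (Z \o inG); split=> //.
  - by move=> h h' hP hP' tt tc; apply: Zt; rewrite ?union_simp ?tt // -tt.
  - elim/inGH_ind: g gP gc Zg => g; rewrite !union_simp; last by move=> _ /eqP; rewrite union_simp.
    by move=> gP /inG_inj gc Zg; exists g; rewrite // gc eqxx.
  - elim/inGH_ind: g' gP' gc' Zg' => g'; rewrite !union_simp; last by move=> _ /eqP; rewrite union_simp.
    by move=> gP' /inG_inj gc' Zg'; exists g'; rewrite // gc' eqxx.
apply/has_cut_vertexP => //; exists c, (Z \o inH); split=> //.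
- by move=> h h' hP hP' tt tc; apply: Zt; rewrite ?union_simp ?tt // -tt.
- elim/inGH_ind: g gP gc Zg => g; rewrite !union_simp; first by move=> _ /eqP; rewrite union_simp.
  by move=> gP /inH_inj gc Zg; exists g; rewrite // gc eqxx.
- elim/inGH_ind: g' gP' gc' Zg' => g'; rewrite !union_simp; first by move=> _ /eqP; rewrite union_simp.
  by move=> gP' /inH_inj gc' Zg'; exists g'; rewrite // gc' eqxx.
Qed.

Variables x y : nat.
Hypotheses (xP : x \in hs P) (yQ : y \in hs Q).

Let xU : inG x \in hs (P ** Q). Proof. by rewrite union_simp. Qed.
Let yU : inH y \in hs (P ** Q). Proof. by rewrite union_simp. Qed.
Lemma union_term_neq : term (P ** Q) (inG x) != term (P ** Q) (inH y).
Proof. by rewrite !union_simp. Qed.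
Let vw := union_term_neq.

(** All of [Q] is put on the side of [x]; then both contracted half-edges are on one side of a cut
    of the union, and [cut_contract_same] applies. *)
Lemma cut_union_contract : has_cut_vertex P ->
  has_cut_vertex (contract (P ** Q) (inG x) (inH y)).
Proof.
case/(has_cut_vertexP wP) => c [Z [Zb Zt [g gP /andP[/eqP gc Zg]] [g' gP' /andP[/eqP gc' Zg']]]].
have wU := wf_union wP wQ.
apply: (@cut_contract_same _ _ _ wU xU yU vw (inG c) (fun n => if odd n then Z x else Z n./2)).
  split.
  - by apply: union_hs_ind => h hP; rewrite !union_simp !parity_simp ?Zb.
  - move=> h h'; elim/inGH_ind: h => h; elim/inGH_ind: h' => h' hP hP' /eqP;
      rewrite !union_simp in hP hP' *; rewrite ?odd_inH //.
    by rewrite !parity_simp => /eqP tt tc; apply: Zt.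
  - by exists (inG g); rewrite !union_simp ?parity_simp // gc eqxx.
  - by exists (inG g'); rewrite !union_simp ?parity_simp // gc' eqxx.
by rewrite !parity_simp.
Qed.

(** Without a cut vertex [Q] has no bridge, so it stays connected when the edge of [y] is removed
    and lies in the component of the merged vertex. The lost edge of [x] is then replaced by a path
    through [Q] and the new edge. *)
Lemma connected_union_contract : connected P -> connected Q -> ~~ has_cut_vertex Q ->
  connected (contract (P ** Q) (inG x) (inH y)).
Proof.
move=> cP cQ nQ; have wU := wf_union wP wQ.
have wC := wf_contract wU xU yU vw.
have tC : term (P ** Q) (inG x) \in vs (contract (P ** Q) (inG x) (inH y)).
  by have := merge_vs wU xU vw (term_vs wU xU); rewrite merge_x // vw.
apply: (connected_intro wC tC) => S cS Sx.
have [S1 S2] := closed_set_contract wU xU yU vw cS.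
pose M := S \o merge (P ** Q) (inG x) (inH y).
have Mx : M (inG (term P x)).
  by rewrite /M /= -(term_inG P Q) merge_x ?vw.
have My : M (inH (term Q y)).
  by rewrite /M /= -(term_inH P Q) merge_y.
have cMQ : closed_set Q (M \o inH).
  apply: (closed_set_off_edge wQ cQ nQ yQ) => h hQ hy hby.
  have := S1 (inH h); rewrite !inE !union_simp (negPf hy) (negPf hby) /=.
  by apply.
have MQ u : u \in vs Q -> M (inH u).
  move=> uQ; have := connectedPP wQ cQ cMQ uQ (term_vs wQ yQ).
  by rewrite /= My.
have Mbx : M (inG (term P (bar P x))).
  have := S2; rewrite !union_simp => E; rewrite /M /= E.
  by apply: MQ; rewrite term_vs // bar_hs.
have cMP : closed_set P (M \o inG).
  move=> h hP; have [->|hx] := eqVneq h x; first by rewrite /= Mx Mbx.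
  have [->|hbx] := eqVneq h (bar P x); first by rewrite barK //= Mx Mbx.
  have := S1 (inG h); rewrite !inE !union_simp (negPf hx) (negPf hbx) /=.
  by apply.
move=> u uC; rewrite -(merge_id wU (x := inG x) (y := inH y) uC) -[S _]/(M u).
have := mem_vs_contract uC; elim/inGH_ind: u {uC} => u; rewrite !union_simp => uU.
  have := connectedPP wP cP cMP uU (term_vs wP xP).
  by rewrite /= Mx.
exact: MQ.
Qed.

End UnionComponents.

Section IsoInvariance.
Variables (f g : nat -> nat) (P Q : graph_data).
Hypotheses (wP : graph_wf P) (wQ : graph_wf Q) (iso : graph_iso f g P Q).

Let fi := iso_vs_inj wQ iso.

Lemma iso_vs_ex w : w \in vs Q -> exists2 u, u \in vs P & w = f u.
Proof. by have [pv _ _ _] := iso; rewrite -(perm_mem pv) => /mapP. Qed.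

Lemma iso_hs_ex w : w \in hs Q -> exists2 u, u \in hs P & w = g u.
Proof. by have [_ ph _ _] := iso; rewrite -(perm_mem ph) => /mapP. Qed.

Lemma component_iso v u : v \in vs P -> u \in vs P ->
  component Q (f v) (f u) = component P v u.
Proof.
move=> vP uP; have [_ _ eb et] := iso; apply/asboolP/asboolP => c S cS Sv; last first.
  apply: (c (S \o f)) => // h hP /=.
  by rewrite -!et ?bar_hs // -eb // cS // (iso_hs iso).
(* [f] is known to be injective only on the vertices of [P], so [S] is transported by taking
   images. *)
pose S' w := has (fun u => (f u == w) && S u) (vs P).
have SE w : w \in vs P -> S' (f w) = S w.
  move=> wV; apply/hasP/idP => [[z zP /andP[/eqP/fi <-]]|Sw] //.
  by exists w; rewrite // eqxx.
rewrite -SE //; apply: c; last by rewrite SE.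
move=> h' /iso_hs_ex[h hP ->].
by rewrite eb // !et ?bar_hs // !SE ?term_vs ?bar_hs // cS.
Qed.

Lemma connected_iso : connected Q = connected P.
Proof.
apply/(connectedP wQ)/(connectedP wP) => [[w /iso_vs_ex[v vP ->] vc]|[v vP vc]].
  by exists v => // u uP; rewrite -component_iso // vc // (iso_vs iso).
exists (f v) => [|w /iso_vs_ex[u uP ->]]; first exact: (iso_vs iso).
by rewrite component_iso // vc.
Qed.

Lemma has_cut_vertex_iso : has_cut_vertex Q -> has_cut_vertex P.
Proof.
have [_ _ eb et] := iso.
case/(has_cut_vertexP wQ) => c [Z [Zb Zt [g1 g1Q /andP[/eqP gc Zg]] [g2 g2Q /andP[/eqP gc2 Zg2]]]].
have [h1 h1P h1E] := iso_hs_ex g1Q; have [h2 h2P h2E] := iso_hs_ex g2Q.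
have t1 : f (term P h1) = c by rewrite -et // -h1E.
apply/has_cut_vertexP => //; exists (term P h1), (Z \o g); split.
- by move=> h hP /=; rewrite -eb // Zb // (iso_hs iso).
- move=> h h' hP hP' tt tc /=; apply: Zt; rewrite ?(iso_hs iso) ?et ?tt //.
  by rewrite -tt -t1 (inj_in_eq fi) ?term_vs.
- by exists h1; rewrite // eqxx /= -h1E.
- exists h2; rewrite // /= -h2E Zg2 andbT; apply/eqP/fi; rewrite ?term_vs //.
  by rewrite -et // -h2E gc2.
Qed.

End IsoInvariance.

(** * Splitting a graph into two unions of components *)

Definition restrict (P : graph_data) (S : pred nat) : graph_data := {|
  vs := filter S (vs P);
  hs := [seq h <- hs P | S (term P h)];
  bar := bar P; term := term P; init := init P |}.

Section Restrict.
Variables (P : graph_data) (S : pred nat).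
Hypotheses (wP : graph_wf P) (cS : closed_set P S).

Lemma wf_restrict : graph_wf (restrict P S).
Proof.
have /graph_wfP[uv uh hP vP] := wP.
apply/and4P; split; rewrite /= ?filter_uniq //.
- apply/allP => h; rewrite mem_filter => /andP[Sh hin]; have [a b c d e] := hP h hin.
  by rewrite !mem_filter a b c d e cS // Sh !eqxx.
- apply/allP => v; rewrite mem_filter => /andP[Sv /vP vin].
  rewrite count_filter; apply: leq_trans vin _; apply: sub_count => h /= /eqP->.
  by rewrite eqxx.
Qed.

Lemma closed_set_restrict S' : closed_set (restrict P S) S' ->
  closed_set P (fun u => S u && S' u).
Proof.
move=> cS' h hP /=; rewrite cS //; case Sh : (S _) => //=.
by apply: cS'; rewrite mem_filter Sh.
Qed.

End Restrict.

Lemma half_map_union s t : map half (map inG s ++ map inH t) = s ++ t.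
Proof.
rewrite map_cat -!map_comp; congr (_ ++ _).
  exact: map_id_half_inG.
exact: map_id_half_inH.
Qed.

Section Split.
Variables (P : graph_data) (S : pred nat).
Hypotheses (wP : graph_wf P) (cS : closed_set P S).

Let R := restrict P (predC S) ** restrict P S.

(** [half] undoes [inG] and [inH] alike, so it carries the union of the two parts back to the labels
    of [P]. *)
Lemma split_iso : graph_iso half half R P.
Proof.
have perm_split (a : pred nat) (s : seq nat) : perm_eq ([seq u <- s | ~~ a u] ++ [seq u <- s | a u]) s.
  by rewrite perm_catC; apply/permPl/perm_filterC.
split.
- by rewrite vs_union half_map_union; apply: (perm_split S).
- by rewrite hs_union half_map_union; apply: (perm_split (fun h => S (term P h))).
- by apply: union_hs_ind => h _; rewrite !(union_simp, parity_simp).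
- by apply: union_hs_ind => h _; rewrite !(union_simp, parity_simp).
Qed.

End Split.

Lemma connected_restrict_component P v : graph_wf P -> v \in vs P ->
  connected (restrict P (component P v)).
Proof.
move=> wP vP; have cK := component_closed (P := P) v.
apply: (@connected_intro _ (wf_restrict wP cK) v).
  by rewrite mem_filter component_refl.
move=> S cS Sv u; rewrite mem_filter => /andP[vu _].
have := component_min (closed_set_restrict cK cS) vu.
by rewrite component_refl Sv => /(_ isT)/andP[].
Qed.

Section ContractSplit.
Variables (P : graph_data) (x y : nat).
Hypotheses (wP : graph_wf P) (xP : x \in hs P) (yP : y \in hs P)
  (vw : term P x != term P y).
(** [P] becomes connected when the vertices of [x] and [y] are identified. This covers a connected
    [P] as well as a union of two connected graphs with one of [x], [y] in each. *)
Hypothesis glued : forall S, closed_set P S -> S (term P x) = S (term P y) ->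
  {in vs P &, forall u v, S u = S v}.

(** By [closed_set_merge] every component contains the merged vertex or the new edge, so there are
    at most two: that of the merged vertex and its complement. *)
Lemma contract_split : ~~ connected (contract P x y) ->
  exists2 v, v \in vs (contract P x y) &
    let K := component (contract P x y) v in
    connected (restrict (contract P x y) K) /\
    connected (restrict (contract P x y) (predC K)).
Proof.
move=> nC; have wC := wf_contract wP xP yP vw.
have tx := term_vs wP xP; have ty := term_vs wP yP.
have mx : term P x \in vs (contract P x y).
  by have := merge_vs wP xP vw tx; rewrite merge_x.
have mb : merge P x y (term P (bar P x)) \in vs (contract P x y).
  by apply: merge_vs; rewrite ?term_vs ?bar_hs.
have const S : closed_set (contract P x y) S ->
    S (merge P x y (term P (bar P x))) = S (term P x) ->
    {in vs (contract P x y) &, forall u v, S u = S v}.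
  move=> cS Sb; have cM := closed_set_merge wP xP yP vw cS Sb.
  move=> u v uC vC; have := glued cM _ (mem_vs_contract uC) (mem_vs_contract vC).
  by rewrite /= (merge_id wP uC) (merge_id wP vC) merge_x // merge_y; apply.
exists (term P x) => //= ; set K := component _ _.
have cK : closed_set (contract P x y) K by apply: component_closed.
split; first exact: connected_restrict_component.
have Kx : K (term P x) by apply: component_refl.
have nKb : ~~ K (merge P x y (term P (bar P x))).
  apply: contraNN nC => Kb; apply/(connectedP wC); exists (term P x) => // u uC.
  by rewrite -/K (const K cK _ _ _ uC mx) ?Kx.
apply: (@connected_intro _ (wf_restrict wC (closed_setC cK)) (merge P x y (term P (bar P x)))).
  by rewrite mem_filter /= nKb.
move=> S cS Sb u; rewrite mem_filter => /andP[/= nKu uC].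
have cS' := closed_setC (closed_set_restrict (closed_setC cK) (closed_setC cS)).
have := const _ cS' _ _ _ uC mx; rewrite /= nKu nKb Sb Kx /= => /(_ erefl).
by case: (S u).
Qed.

End ContractSplit.

(** * Linear maps on spaces of graphs *)

Fact connected_class_key : unit. Proof. exact: tt. Qed.

Section Lifts.
Variables (k : fieldType).
Implicit Types U V W : lmodType k.

(** The functions of graphs that respect the relations of [HG] and thus extend to it. *)
Definition covariant (U : lmodType k) (F : graph_data -> U) : Prop :=
  forall f g P Q, graph_wf P -> graph_wf Q -> graph_iso f g P Q ->
    F Q = (-1) ^+ iso_sign f g P Q *: F P.

Definition hglift (U : lmodType k) (F : graph_data -> U) : HG k -> U :=
  qlift (mlift (fun G : ograph => F G)).

Lemma hgliftE U (F : graph_data -> U) u :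
  hglift F u = mlift (fun G : ograph => F G) (repr u).
Proof. by []. Qed.

Lemma hglift_ext U (F F' : graph_data -> U) u :
  (forall P, graph_wf P -> F P = F' P) -> hglift F u = hglift F' u.
Proof.
by move=> FF'; rewrite !hgliftE; apply: eq_bigr => -[P wP] _; rewrite /= FF'.
Qed.

Lemma hglift_funD U (F F' : graph_data -> U) a u :
  hglift (fun P => a *: F P + F' P) u = a *: hglift F u + hglift F' u.
Proof. by rewrite !hgliftE mliftD mliftZ. Qed.

Section Covariant.
Variables (U : lmodType k) (F : graph_data -> U).
Hypothesis cF : covariant F.

Lemma covariant_rel r : @orientation_relation k r -> mlift (fun G : ograph => F G) r = 0.
Proof.
case=> -[P wP] [[Q wQ] [[f g] /= iso ->]].
rewrite (linB (mlift_linear _)) (linZ _ (mlift_linear _)) !mliftU /=.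
by rewrite (cF wP wQ iso) iso_parityE subrr.
Qed.

Lemma hglift_linear : linear (hglift F).
Proof. exact: qlift_linear (mlift_linear _) covariant_rel. Qed.

Lemma hglift_hg (G : ograph) : hglift F (hg k G) = F G.
Proof.
rewrite /hglift /hg (qliftE _ (mlift_linear _) covariant_rel); exact: mliftU.
Qed.

Lemma hglift_hgd P : graph_wf P -> hglift F (hgd k P) = F P.
Proof. by move=> wP; rewrite -[P]/(ograph_data (OGraph wP)) hgd_hg hglift_hg. Qed.

End Covariant.

Lemma hgd_covariant : covariant (hgd k).
Proof. by move=> f g P Q wP wQ iso; rewrite (hgd_iso k wP wQ iso). Qed.

Lemma covariant_lin U V (L : U -> V) F :
  linear L -> covariant F -> covariant (fun P => L (F P)).
Proof. by move=> lL cF f g P Q wP wQ iso; rewrite (cF _ _ _ _ wP wQ iso) linZ. Qed.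

Lemma hg_ind_lin U (f g : HG k -> U) : linear f -> linear g ->
  (forall P, graph_wf P -> f (hgd k P) = g (hgd k P)) -> f =1 g.
Proof.
move=> lf lg fg; apply: quotient_ind_lin => // v.
apply: (@malg_ind_lin _ _ _ (fun v => f (coset _ v)) (fun v => g (coset _ v))).
- exact: lin_comp lf (coset_is_linear _).
- exact: lin_comp lg (coset_is_linear _).
- by case=> P wP; have := fg P wP; rewrite -[P]/(ograph_data (OGraph wP)) hgd_hg.
Qed.

(** The value 0 on disconnected graphs makes this covariant on all graphs, so that it extends to
    [HG]. *)
Definition gcc : graph_data -> GC k := locked_with connected_class_key (fun P =>
  if pselect (graph_wf P /\ connected P) is left wc
  then gc k (CGraph (cgraph_graph := OGraph (proj1 wc)) (proj2 wc)) else 0).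

Lemma gcc_gc (G : cgraph) : gcc G = gc k G.
Proof.
case: G => -[P wP] cP.
have E (w : graph_wf P) (c : connected P) :
    CGraph (cgraph_graph := OGraph w) c = CGraph (cgraph_graph := OGraph wP) cP.
  move: c; rewrite (bool_irrelevance w wP) => c.
  by congr CGraph; apply: bool_irrelevance.
by rewrite /gcc unlock; case: pselect => [wc|[]//]; rewrite E.
Qed.

Lemma gcc_wf P (wP : graph_wf P) (cP : connected P) :
  gcc P = gc k (CGraph (cgraph_graph := OGraph wP) cP).
Proof. by rewrite -gcc_gc. Qed.

Lemma gcc0 P : ~~ connected P -> gcc P = 0.
Proof.
move=> nP; rewrite /gcc unlock; case: pselect => // wc.
by case/negP: nP; case: wc.
Qed.

Lemma gcc_covariant : covariant gcc.
Proof.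
move=> f g P Q wP wQ iso; case: (boolP (connected P)) => cP; last first.
  by rewrite !gcc0 ?scaler0 // (connected_iso wP wQ iso).
have cQ : connected Q by rewrite (connected_iso wP wQ iso).
rewrite (gcc_wf wP cP) (gcc_wf wQ cQ) /gc -(linZ _ (coset_is_linear _)).
congr coset; apply: val_inj => /=.
by rewrite (@hg_iso k (OGraph wP) (OGraph wQ) f g) // iso_parityE.
Qed.

Lemma gcc_cut P : graph_wf P -> connected P -> has_cut_vertex P -> gcc P = 0.
Proof.
move=> wP cP hP; rewrite (gcc_wf wP cP); apply/coset0P/mem_span.
by exists (CGraph (cgraph_graph := OGraph wP) cP).
Qed.

(** It kills the graphs with a cut vertex and restricts to the quotient map on [GG], so it induces
    the isomorphism from [(GG + HC) / HC] to [GG / C]. *)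
Definition Phi1 : HG k -> GC k := locked_with connected_class_key (hglift gcc).
Lemma Phi1_linear : linear Phi1.
Proof. by rewrite /Phi1 unlock; apply: hglift_linear gcc_covariant. Qed.
Lemma Phi1_hgd P : graph_wf P -> Phi1 (hgd k P) = gcc P.
Proof. by rewrite /Phi1 unlock; apply: hglift_hgd gcc_covariant _. Qed.

Lemma val_GG_linear : linear (val : GG k -> HG k).
Proof. by move=> a u v; rewrite /= ?linearP. Qed.

Lemma Phi1_val (u : GG k) : Phi1 (val u) = coset (@cut_graphs k) u.
Proof.
case: u => v vP; have /asboolP[s [sX vE]] := vP.
have H : exists s' : seq (k * cgraph), v = \sum_(p <- s') p.1 *: hg k p.2.
  rewrite {}vE; elim: s sX {vP} => [|[a w] s IHs] sX; first by exists [::]; rewrite !big_nil.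
  have [|s' E] := IHs; first by move=> p ps; apply: sX; rewrite inE ps orbT.
  have [G /= wE] := sX (a, w) (mem_head _ _).
  by exists ((a, G) :: s'); rewrite !big_cons E wE.
case: H => s' E.
have -> : Subspace vP = \sum_(p <- s') p.1 *: cg k p.2.
  apply: val_inj; rewrite [RHS](lin_sum _ _ _ val_GG_linear) [LHS]E.
  by apply: eq_bigr => p _; rewrite (linZ _ val_GG_linear).
rewrite [val _](lin_sum _ _ _ val_GG_linear) (lin_sum _ _ _ Phi1_linear).
rewrite (lin_sum _ _ _ (coset_is_linear _)); apply: eq_bigr => p _.
rewrite (linZ _ val_GG_linear) (linZ _ Phi1_linear) (linZ _ (coset_is_linear _)).
by rewrite -[val _]/(hg k p.2) -hgd_hg Phi1_hgd ?gcc_gc //; case: (cgraph_graph p.2).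
Qed.

(** A section of [Phi1] that need not be linear; a linear [L] that kills the connected graphs with a
    cut vertex is linear after it ([descent_linear]). *)
Definition lift_gc (p : GC k) : HG k := val (repr p : GG k).

Lemma lift_gcK p : Phi1 (lift_gc p) = p.
Proof. by rewrite /lift_gc Phi1_val coset_repr. Qed.

Section Descent.
Variables (U : lmodType k) (L : HG k -> U).
Hypotheses (lL : linear L) (cL : forall P, graph_wf P -> connected P ->
  has_cut_vertex P -> L (hgd k P) = 0).

Lemma descent0 (u : GG k) : coset (@cut_graphs k) u = 0 -> L (val u) = 0.
Proof.
move/coset0P; apply: (@lin_span0 k _ _ _ (fun u => L (val u))).
  exact: lin_comp lL val_GG_linear.
move=> v [[[P wP] cP] hP ->]; rewrite -[val _]/(hg k (OGraph wP)) -hgd_hg.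
exact: cL.
Qed.

Lemma descent_val (u : GG k) : L (lift_gc (coset (@cut_graphs k) u)) = L (val u).
Proof.
have : L (val (repr (coset (@cut_graphs k) u) - u)) = 0.
  by apply: descent0; rewrite (linB (coset_is_linear _)) coset_repr subrr.
by rewrite (linB val_GG_linear) (linB lL) => /eqP; rewrite subr_eq0 => /eqP.
Qed.

Lemma descent_linear : linear (fun p => L (lift_gc p)).
Proof.
move=> a p q; rewrite -[p]coset_repr -[q]coset_repr -coset_is_linear !descent_val.
by rewrite val_GG_linear lL.
Qed.

Lemma descent_gcc P : graph_wf P -> connected P -> L (lift_gc (gcc P)) = L (hgd k P).
Proof.
move=> wP cP; rewrite (gcc_wf wP cP) descent_val -[val _]/(hg k (OGraph wP)).
by rewrite -hgd_hg.
Qed.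

End Descent.

(** Identities in [GC] may be tested on graphs without cut vertices, for which contractions between
    two graphs stay connected. *)
Lemma gc_ind_lin U (f g : GC k -> U) : linear f -> linear g ->
  (forall P, graph_wf P -> connected P -> ~~ has_cut_vertex P -> f (gcc P) = g (gcc P)) ->
  f =1 g.
Proof.
move=> lf lg fg p; rewrite -[p]lift_gcK.
have := @hg_ind_lin _ (fun u => f (Phi1 u)) (fun u => g (Phi1 u)).
apply; [exact: lin_comp lf Phi1_linear|exact: lin_comp lg Phi1_linear|].
move=> P wP; rewrite Phi1_hgd //.
case: (boolP (connected P)) => cP; last by rewrite gcc0 // (lin0 lf) (lin0 lg).
case: (boolP (has_cut_vertex P)) => hP; last exact: fg.
by rewrite gcc_cut // (lin0 lf) (lin0 lg).
Qed.

End Lifts.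

(** * Splitting off a component *)

Section RestrictIso.
Variables (f g : nat -> nat) (P Q : graph_data) (S S' : pred nat).
Hypotheses (wP : graph_wf P) (wQ : graph_wf Q) (iso : graph_iso f g P Q).
Hypothesis SS' : {in vs P, forall u, S' (f u) = S u}.

Lemma restrict_iso : graph_iso f g (restrict P S) (restrict Q S').
Proof.
have [pv ph eb et] := iso; split.
- rewrite perm_sym (perm_trans (y := filter S' (map f (vs P)))) //.
    by rewrite perm_filter // perm_sym.
  by rewrite filter_map (eq_in_filter (a2 := S)) // => u /SS' E; rewrite /= E.
- rewrite perm_sym (perm_trans (y := filter (fun h => S' (term Q h)) (map g (hs P)))) //.
    by rewrite perm_filter // perm_sym.
  rewrite filter_map (eq_in_filter (a2 := fun h => S (term P h))) // => h hP.
  by rewrite /= et // SS' // term_vs.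
- by move=> h; rewrite mem_filter => /andP[_ /eb].
- by move=> h; rewrite mem_filter => /andP[_ /et].
Qed.

End RestrictIso.

(** The sign between [P] and the product of its parts outside and inside [S], in this order. *)
Definition split_parity (P : graph_data) (S : pred nat) : bool :=
  parity (vs P) ([seq u <- vs P | ~~ S u] ++ [seq u <- vs P | S u]).

Lemma perm_split (T : eqType) (a : pred T) (s : seq T) :
  perm_eq s ([seq u <- s | ~~ a u] ++ [seq u <- s | a u]).
Proof. by rewrite perm_sym perm_catC; apply/permPl/perm_filterC. Qed.

Lemma iso_sign_restrict f g P Q (S S' : pred nat) :
  graph_wf P -> graph_wf Q -> graph_iso f g P Q ->
  {in vs P, forall u, S' (f u) = S u} ->
  iso_sign f g (restrict P (predC S)) (restrict Q (predC S'))
   (+) iso_sign f g (restrict P S) (restrict Q S')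
   (+) split_parity P S (+) split_parity Q S' = iso_sign f g P Q.
Proof.
move=> wP wQ iso SS'; have [pv ph eb et] := iso.
have fi := iso_vs_inj wQ iso.
have cSS' : {in vs P, forall u, predC S' (f u) = predC S u} by move=> u uP; rewrite /= SS'.
have [pv1 _ _ _] := restrict_iso wP iso SS'.
have [pv2 _ _ _] := restrict_iso wP iso cSS'.
have uf : uniq (map f (vs P)) by rewrite (map_inj_in_uniq fi) uniq_vs.
have pP := perm_split S (vs P); have pQ := perm_split S' (vs Q).
have pfP := perm_map f pP.
have E : flips g P Q = flips g (restrict P (predC S)) (restrict Q (predC S'))
    (+) flips g (restrict P S) (restrict Q S').
  rewrite /flips -oddD -count_cat; congr odd; apply/permP.
  exact: perm_split (fun h => S (term P h)) _.
have pm : perm_eq (map f [seq u <- vs P | ~~ S u] ++ map f [seq u <- vs P | S u])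
   ([seq u <- vs Q | ~~ S' u] ++ [seq u <- vs Q | S' u]).
  exact: perm_cat pv2 pv1.
have um : uniq (map f [seq u <- vs P | ~~ S u] ++ map f [seq u <- vs P | S u]).
  by rewrite -map_cat -(perm_uniq pfP).
rewrite /iso_sign E /split_parity.
rewrite map_cat in pfP.
rewrite (parity_trans uf pfP (perm_trans pm _)); last by rewrite perm_sym.
rewrite -{1}map_cat (parity_map fi pP).
rewrite (parity_trans um pm); last by rewrite perm_sym.
rewrite (parity_cat um pv2 pv1) (parity_sym (uniq_vs wQ) pQ).
by repeat match goal with
 | |- context [parity ?s ?t] => case: (parity s t)
 | |- context [flips ?h ?A ?B] => case: (flips h A B) end.
Qed.

Section RootSum.
Variables (k : fieldType) (char0 : [pchar k] =i pred0).
Implicit Types U V W : lmodType k.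

Definition bicovariant U (F : graph_data -> graph_data -> U) : Prop :=
  (forall Q, graph_wf Q -> covariant (F^~ Q)) /\ (forall P, graph_wf P -> covariant (F P)).

Definition root_term U (F : graph_data -> graph_data -> U) (P : graph_data) (v : nat) : U :=
  let K := component P v in
  (size [seq u <- vs P | K u])%:R^-1 *:
    ((-1) ^+ split_parity P K *: F (restrict P (predC K)) (restrict P K)).

(* Sum over the components K of P of F (P \ K) K, each one weighted by 1 as it
   is reached from all of its vertices. *)
Definition root_sum U (F : graph_data -> graph_data -> U) (P : graph_data) : U :=
  \sum_(v <- vs P) root_term F P v.

Lemma natr_size_neq0 (T : eqType) (s : seq T) v : v \in s -> (size s)%:R != 0 :> k.
Proof.
by move=> vs'; rewrite (iffLR (pcharf0P k) char0); apply: contraTneq vs' => /size0nil->.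
Qed.

Lemma root_sum_covariant U (F : graph_data -> graph_data -> U) :
  bicovariant F -> covariant (root_sum F).
Proof.
case=> cFl cFr f g P Q wP wQ iso; have [pv _ _ _] := iso.
rewrite /root_sum -(perm_big _ pv) big_map scaler_sumr; apply: eq_big_seq => v vP.
rewrite /root_term; set K := component P v; set K' := component Q (f v).
have cK : closed_set P K by apply: component_closed.
have cK' : closed_set Q K' by apply: component_closed.
have KK' : {in vs P, forall u, K' (f u) = K u} by move=> u uP; exact: (component_iso wP wQ iso).
have cKK' : {in vs P, forall u, predC K' (f u) = predC K u} by move=> u uP; rewrite /= KK'.
have i1 := restrict_iso wP iso KK'; have i2 := restrict_iso wP iso cKK'.
have w1 := wf_restrict wP cK; have w2 := wf_restrict wP (closed_setC cK).
have w1' := wf_restrict wQ cK'; have w2' := wf_restrict wQ (closed_setC cK').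
have -> : size [seq u <- vs Q | K' u] = size [seq u <- vs P | K u].
  by rewrite -[RHS]/(size (vs (restrict P K))) (iso_size i1).
rewrite (cFl _ w1' _ _ _ _ w2 w2' i2) (cFr _ w2 _ _ _ _ w1 w1' i1).
rewrite -(iso_sign_restrict wP wQ iso KK') [RHS]scalerA [X in _ = X *: _]mulrC -scalerA.
congr (_ *: _); rewrite !scalerA -!signr_addb; congr ((-1) ^+ nat_of_bool _ *: _).
by repeat match goal with
 | |- context [split_parity ?s ?t] => case: (split_parity s t)
 | |- context [iso_sign ?h ?h' ?A ?B] => case: (iso_sign h h' A B) end.
Qed.

Lemma covariant_eq U (F : graph_data -> U) f g P Q : covariant F ->
  graph_wf P -> graph_wf Q -> graph_iso f g P Q -> map f (vs P) = vs Q ->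
  {in hs P, forall h, init Q (g h) = init P h} -> F P = F Q.
Proof.
move=> cF wP wQ iso ev ei; rewrite (cF _ _ _ _ wP wQ iso) /iso_sign ev.
rewrite parity_refl ?uniq_vs // /flips (@eq_in_count _ _ pred0) ?count_pred0 ?scale1r //.
by move=> h hP /=; rewrite ei // andbN.
Qed.

Lemma restrictT P (S : pred nat) : graph_wf P -> {in vs P, forall u, S u} -> restrict P S = P.
Proof.
move=> wP hS; apply: graph_data_eq => //=; apply/all_filterP/allP => // h hP.
by rewrite hS // term_vs.
Qed.

Section Union.
Variables (Q B : graph_data).
Hypotheses (wQ : graph_wf Q) (wB : graph_wf B).

Lemma restrict_union_l (S S' : pred nat) : {in vs Q, forall u, S (inG u) = S' u} ->
  {in vs B, forall u, S (inH u)} -> restrict (Q ** B) S = restrict Q S' ** B.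
Proof.
move=> SS' SB; apply: graph_data_eq => //.
  rewrite [LHS]/= filter_cat filter_map_inG filter_map_inH.
  congr (_ ++ _); first by congr map; apply: eq_in_filter.
  by congr map; apply/all_filterP/allP.
rewrite -[LHS]/(filter _ (map inG (hs Q) ++ map inH (hs B))).
rewrite filter_cat filter_map_inG filter_map_inH; congr (_ ++ _); congr map.
  by apply: eq_in_filter => h hQ; rewrite term_inG SS' // term_vs.
by apply/all_filterP/allP => h hB; rewrite term_inH SB // term_vs.
Qed.

Lemma restrict_union_G U (F : graph_data -> U) (S S' : pred nat) : covariant F ->
  closed_set (Q ** B) S ->
  {in vs Q, forall u, S (inG u) = S' u} -> {in vs B, forall u, S (inH u) = false} ->
  F (restrict (Q ** B) S) = F (restrict Q S').
Proof.
move=> cF cS SS' SB.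
have cS' : closed_set Q S'.
  move=> h hQ; rewrite -!SS' ?term_vs ?bar_hs //.
  by have := cS (inG h); rewrite !union_simp; apply.
have vE : vs (restrict (Q ** B) S) = map inG (vs (restrict Q S')).
  rewrite [LHS]/= filter_cat filter_map_inG filter_map_inH.
  by rewrite (eq_in_filter SS') (@eq_in_filter _ _ pred0 (vs B) SB) filter_pred0 cats0.
have hE : hs (restrict (Q ** B) S) = map inG (hs (restrict Q S')).
  rewrite -[LHS]/(filter _ (map inG (hs Q) ++ map inH (hs B))).
  rewrite filter_cat filter_map_inG filter_map_inH.
  rewrite (eq_in_filter (a2 := fun h => S' (term Q h))); last first.
    by move=> h hQ; rewrite term_inG SS' // term_vs.
  rewrite (eq_in_filter (s := hs B) (a2 := pred0)) ?filter_pred0 ?cats0 // => h hB.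
  by rewrite term_inH SB // term_vs.
apply: (covariant_eq (f := half) (g := half) cF (wf_restrict (wf_union wQ wB) cS)
  (wf_restrict wQ cS')).
- split; rewrite ?vE ?hE ?map_id_half_inG -?map_comp ?map_id_half_inG //.
  + by move=> h /mapP[n _ ->]; rewrite [bar _ (inG n)]bar_inG !half_inG.
  + by move=> h /mapP[n _ ->]; rewrite [term _ (inG n)]term_inG !half_inG.
- by rewrite vE -map_comp map_id_half_inG.
- by move=> h; rewrite hE => /mapP[n _ ->]; rewrite half_inG [init _ (inG n)]init_inG.
Qed.

Lemma restrict_union_H U (F : graph_data -> U) (S : pred nat) : covariant F ->
  closed_set (Q ** B) S ->
  {in vs Q, forall u, S (inG u) = false} -> {in vs B, forall u, S (inH u)} ->
  F (restrict (Q ** B) S) = F B.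
Proof.
move=> cF cS SQ SB.
have vE : vs (restrict (Q ** B) S) = map inH (vs B).
  rewrite [LHS]/= filter_cat filter_map_inG filter_map_inH.
  rewrite (@eq_in_filter _ _ pred0 (vs Q) SQ) filter_pred0 /=.
  by congr map; apply/all_filterP/allP.
have hE : hs (restrict (Q ** B) S) = map inH (hs B).
  rewrite -[LHS]/(filter _ (map inG (hs Q) ++ map inH (hs B))).
  rewrite filter_cat filter_map_inG filter_map_inH.
  rewrite (eq_in_filter (s := hs Q) (a2 := pred0)) ?filter_pred0; last first.
    by move=> h hQ; rewrite term_inG SQ // term_vs.
  by congr map; apply/all_filterP/allP => h hB; rewrite term_inH SB // term_vs.
apply: (covariant_eq (f := half) (g := half) cF (wf_restrict (wf_union wQ wB) cS) wB).
- split; rewrite ?vE ?hE -?map_comp ?map_id_half_inH //.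
  + by move=> h /mapP[n _ ->]; rewrite [bar _ (inH n)]bar_inH !half_inH.
  + by move=> h /mapP[n _ ->]; rewrite [term _ (inH n)]term_inH !half_inH.
- by rewrite vE -map_comp map_id_half_inH.
- by move=> h; rewrite hE => /mapP[n _ ->]; rewrite half_inH [init _ (inH n)]init_inH.
Qed.

(** The component [B] already stands last and contributes without a sign. A component [K] of [Q] has
    to be moved behind [B], which costs the product of their sizes. *)
Lemma root_sum_union U (F : graph_data -> graph_data -> U) : bicovariant F -> connected B ->
  root_sum F (Q ** B) = F Q B +
  \sum_(v <- vs Q) let K := component Q v in
   (size [seq u <- vs Q | K u])%:R^-1 *:
    ((-1) ^+ (split_parity Q K (+) odd (size [seq u <- vs Q | K u] * size (vs B)))
      *: F (restrict Q (predC K) ** B) (restrict Q K)).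
Proof.
move=> [cFl cFr] cB; have wU := wf_union wQ wB.
rewrite /root_sum vs_union big_cat !big_map [RHS]addrC; congr (_ + _); last first.
  have [b bB _] := connectedP wB cB.
  have E v : v \in vs B -> root_term F (Q ** B) (inH v) = (size (vs B))%:R^-1 *: F Q B.
    move=> vB; rewrite /root_term; set K := component _ _.
    have cK : closed_set (Q ** B) K by apply: component_closed.
    have KQ : {in vs Q, forall u, K (inG u) = false}.
      by move=> u uQ; apply: component_union_rl.
    have KB : {in vs B, forall u, K (inH u)}.
      move=> u uB; rewrite /K component_unionr //.
      apply/asboolP => S cS Sv; by rewrite -(connectedPP wB cB cS vB uB).
    have vE : [seq u <- vs (Q ** B) | K u] = map inH (vs B).
      rewrite vs_union filter_cat filter_map_inG filter_map_inH.
      rewrite (@eq_in_filter _ _ pred0 (vs Q) KQ) filter_pred0 /=.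
      by congr map; apply/all_filterP/allP.
    have vE' : [seq u <- vs (Q ** B) | ~~ K u] = map inG (vs Q).
      rewrite vs_union filter_cat filter_map_inG filter_map_inH.
      rewrite (eq_in_filter (s := vs B) (a2 := pred0)) ?filter_pred0 ?cats0; last first.
        by move=> u /KB /= ->.
      by congr map; apply/all_filterP/allP => u /KQ /= ->.
    have nKQ : {in vs Q, forall u, predC K (inG u) = predT u} by move=> u uQ; apply: negbT (KQ u uQ).
    have nKB : {in vs B, forall u, predC K (inH u) = false} by move=> u uB; apply: negbF (KB u uB).
    rewrite /split_parity vE vE' size_map parity_refl ?uniq_vs // scale1r; congr (_ *: _).
    rewrite (restrict_union_G (cFl _ (wf_restrict wU cK)) (closed_setC cK) nKQ nKB).
    rewrite (restrictT wQ) // (restrict_union_H (cFr _ wQ) cK KQ KB) //.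
  rewrite (eq_big_seq _ E) big_const_seq count_predT iter_addr_0 -scaler_nat scalerA.
  by rewrite mulfV ?scale1r // (natr_size_neq0 bB).
apply: eq_big_seq => v vQ; rewrite /root_term /=; set K := component _ _.
set K' := component Q v.
have cK : closed_set (Q ** B) K by apply: component_closed.
have KQ : {in vs Q, forall u, K (inG u) = K' u}.
  by move=> u uQ; apply: component_unionl.
have KB : {in vs B, forall u, K (inH u) = false}.
  by move=> u uB; apply: component_union_lr.
have nKQ : {in vs Q, forall u, predC K (inG u) = predC K' u} by move=> u uQ; congr (~~ _); apply: KQ.
have nKB : {in vs B, forall u, predC K (inH u)} by move=> u uB; apply: negbT (KB u uB).
have vE : [seq u <- vs (Q ** B) | K u] = map inG [seq u <- vs Q | K' u].
  rewrite vs_union filter_cat filter_map_inG filter_map_inH.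
  by rewrite (eq_in_filter KQ) (@eq_in_filter _ _ pred0 (vs B) KB) filter_pred0 cats0.
have vE' : [seq u <- vs (Q ** B) | ~~ K u] = map inG [seq u <- vs Q | ~~ K' u] ++ map inH (vs B).
  rewrite vs_union filter_cat filter_map_inG filter_map_inH.
  congr (_ ++ _); congr map; last by apply/all_filterP/allP.
  exact: eq_in_filter.
rewrite (restrict_union_l nKQ nKB).
rewrite (restrict_union_G (cFr _ _) cK KQ KB); last first.
  by apply: wf_union => //; apply/wf_restrict/closed_setC/component_closed.
rewrite vE size_map; congr (_ *: ((-1) ^+ nat_of_bool _ *: _)).
rewrite /split_parity vE vE' vs_union.
set s1 := [seq u <- vs Q | K' u]; set s2 := [seq u <- vs Q | ~~ K' u].
have uU := uniq_vs wU; rewrite vs_union in uU.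
have p1 : perm_eq (map inG (vs Q) ++ map inH (vs B)) (map inG (s2 ++ s1) ++ map inH (vs B)).
  by rewrite perm_cat2r perm_map // perm_split.
have p2 : perm_eq (map inG (s2 ++ s1) ++ map inH (vs B))
   ((map inG s2 ++ map inH (vs B)) ++ map inG s1).
  by rewrite map_cat -!catA perm_cat2l perm_catC.
rewrite (parity_trans uU p1 p2) parity_cat ?perm_map ?perm_split //.
rewrite (parity_map (in2W inG_inj)) ?perm_split // parity_refl ?addbF; last first.
  by rewrite (map_inj_uniq inH_inj) uniq_vs.
congr (_ (+) _); have u2 := uU; rewrite (perm_uniq p1) in u2.
move: u2; rewrite map_cat -!catA => u2.
rewrite parity_cat //; last by rewrite perm_catC.
rewrite parity_refl; last by move: u2; rewrite cat_uniq => /and3P[].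
rewrite addFb parity_catC ?size_map //.
by rewrite cat_uniq in u2; case/and3P: u2.
Qed.

End Union.

(** It vanishes also on graphs with three or more components, since the complement of a component is
    then disconnected. *)
Definition phi2 : graph_data -> tensor (GC k) (GC k) :=
  root_sum (fun A B => gcc k A \ox gcc k B).
Lemma phi2_bicovariant :
  bicovariant (fun A B => gcc k A \ox gcc k B : tensor (GC k) (GC k)).
Proof.
split=> [Q wQ|P wP].
  exact: covariant_lin (tpure_linl _) (gcc_covariant k).
exact: covariant_lin (tpure_linr _) (gcc_covariant k).
Qed.

Lemma phi2_covariant : covariant phi2.
Proof. exact: root_sum_covariant phi2_bicovariant. Qed.

Section Phi3.
Variables (W : lmodType k) (m : tensor (GC k) (GC k) -> GC k -> W).
Hypotheses (ml : forall w, linear (m^~ w)) (mr : forall X, linear (m X)).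

Definition phi3 : graph_data -> W := root_sum (fun A B => m (phi2 A) (gcc k B)).

Lemma phi3_bicovariant : bicovariant (fun A B => m (phi2 A) (gcc k B)).
Proof.
split=> [Q wQ|P wP]; first exact: covariant_lin (ml _) phi2_covariant.
exact: covariant_lin (mr _) (gcc_covariant k).
Qed.

Lemma phi3_covariant : covariant phi3.
Proof. exact: root_sum_covariant phi3_bicovariant. Qed.

End Phi3.

Lemma connected_nonempty P : graph_wf P -> connected P -> vs P != [::].
Proof. by move=> wP /(connectedP wP)[v vP _]; apply: contraTneq vP => ->. Qed.

Lemma connected_component P v : graph_wf P -> connected P -> v \in vs P ->
  {in vs P, forall u, component P v u}.
Proof.
by move=> wP cP vP u uP; apply/asboolP => S cS; rewrite (connectedPP wP cP cS vP uP).
Qed.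

(** The complement of the only component is empty, and the empty graph does not count as
    connected. *)
Lemma phi2_connected P : graph_wf P -> connected P -> phi2 P = 0.
Proof.
move=> wP cP; apply: big1_seq => v /= vP; rewrite /root_term gcc0.
  by rewrite (lin0 (tpure_linl _)) !scaler0.
set K := component P v.
have cK : closed_set P (predC K) by apply/closed_setC/component_closed.
apply/negP => /(connected_nonempty (wf_restrict wP cK))/negP; apply; apply/eqP.
apply: etrans (filter_pred0 (vs P)); apply: eq_in_filter => u uP.
exact: negbF (connected_component wP cP vP uP).
Qed.

Lemma phi2_union Q B : graph_wf Q -> graph_wf B -> connected B ->
  phi2 (Q ** B) = gcc k Q \ox gcc k B
    + (-1) ^+ (size (vs Q) * size (vs B)) *: (gcc k B \ox gcc k Q).
Proof.
move=> wQ wB cB; rewrite /phi2 (root_sum_union wQ wB phi2_bicovariant cB); congr (_ + _).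
(* If [Q] is disconnected, both sides vanish: outside each component of [Q] something is left beside
   [B]. *)
case: (boolP (connected Q)) => cQ; last first.
  rewrite (gcc0 k cQ) (lin0 (tpure_linr _)) scaler0; apply: big1_seq => v /= vQ.
  set K := component Q v.
  have cK : closed_set Q (predC K) by apply/closed_setC/component_closed.
  have wK := wf_restrict wQ cK.
  have [b bB _] := connectedP wB cB.
  rewrite gcc0 ?(lin0 (tpure_linl _)) ?scaler0 //.
  have [u uQ nu] : exists2 u, u \in vs Q & ~~ K u.
    apply: contrapT => nex; move/negP: cQ; apply; apply/connectedP => //.
    exists v => // u uQ; apply: contrapT => /negP nu; apply: nex; by exists u.
  apply: (@union_disconnected _ _ wK wB u b) => //.
  by rewrite mem_filter /= nu.
have [q qQ _] := connectedP wQ cQ.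
(* Now [Q] is a single component and the first factor is the union of an empty graph with [B]. The
   terms of all vertices agree, and their weights add up to 1. *)
have E v : v \in vs Q -> (let K := component Q v in
   (size [seq u <- vs Q | K u])%:R^-1 *:
    ((-1) ^+ (split_parity Q K (+) odd (size [seq u <- vs Q | K u] * size (vs B)))
      *: (gcc k (restrict Q (predC K) ** B) \ox gcc k (restrict Q K))))
  = (size (vs Q))%:R^-1 *: ((-1) ^+ (size (vs Q) * size (vs B)) *: (gcc k B \ox gcc k Q)).
  move=> vQ; set K := component Q v => /=.
  have KQ := connected_component wQ cQ vQ; rewrite -/K in KQ.
  have cK : closed_set Q (predC K) by apply/closed_setC/component_closed.
  have wK := wf_restrict wQ cK.
  have vK : [seq u <- vs Q | K u] = vs Q by apply/all_filterP/allP.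
  have vK' : [seq u <- vs Q | ~~ K u] = [::].
    by apply: etrans (filter_pred0 (vs Q)); apply: eq_in_filter => u uQ; exact: negbF (KQ u uQ).
  rewrite (restrictT wQ KQ) /split_parity vK vK' cat0s (parity_refl (uniq_vs wQ)) addFb signr_odd.
  have cT : closed_set (restrict Q (predC K) ** B) predT by [].
  suff -> : gcc k (restrict Q (predC K) ** B) = gcc k B by [].
  have nK : {in vs (restrict Q (predC K)), forall u, predT (inG u) = false}.
    by move=> u; rewrite [vs _]vK'.
  have := restrict_union_H wK wB (gcc_covariant k) cT nK (fun _ _ => isT).
  by rewrite (restrictT (wf_union wK wB) (fun _ _ => isT)).
rewrite (eq_big_seq _ E) big_const_seq count_predT iter_addr_0 -scaler_nat scalerA.
by rewrite mulfV ?scale1r // (natr_size_neq0 qQ).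
Qed.

End RootSum.

(** * The bracket and the cobracket *)

Lemma iso_refl P : graph_iso id id P P.
Proof. exact: iso_id. Qed.

Lemma iso_sign_refl P : graph_wf P -> iso_sign id id P P = false.
Proof. by move=> wP; rewrite /iso_sign map_id parity_refl ?uniq_vs // flips_id. Qed.

Section Brackets.
Variables (k : fieldType) (char0 : [pchar k] =i pred0).
Implicit Types U V W : lmodType k.

Lemma big_hs_iso U f g P Q (F : nat -> U) : graph_iso f g P Q ->
  \sum_(h <- hs Q) F h = \sum_(h <- hs P) F (g h).
Proof. by case=> _ ph _ _; rewrite -(perm_big _ ph) big_map. Qed.

Lemma ctr_unionl P Q x y : graph_wf P -> graph_wf Q -> y \in hs P ->
  ctr k (P ** Q) (inG x) (inG y) = if term P x == term P y then 0
    else (-1) ^+ contract_sign P x y *: hgd k (contract P x y ** Q).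
Proof.
by move=> wP wQ yP; rewrite ctrE !union_simp contract_sign_unionl // contract_unionl.
Qed.

Definition contraction_sum (P : graph_data) : HG k :=
  \sum_(x <- hs P) \sum_(y <- hs P) ctr k P x y.

Lemma contraction_sum_covariant : covariant contraction_sum.
Proof.
move=> f g P Q wP wQ iso; rewrite /contraction_sum (big_hs_iso _ iso) scaler_sumr.
apply: eq_big_seq => x xP; rewrite (big_hs_iso _ iso) scaler_sumr.
by apply: eq_big_seq => y yP; apply: ctr_iso.
Qed.

Definition bracket_sum (P Q : graph_data) : HG k :=
  \sum_(x <- hs P) \sum_(y <- hs Q) ctr k (P ** Q) (inG x) (inH y).

Lemma bracket_sum_covariant : bicovariant bracket_sum.
Proof.
split=> [R wR|R wR] f g P Q wP wQ iso.
  have iso' := union_graph_iso iso (iso_refl R).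
  have wU := wf_union wP wR; have wU' := wf_union wQ wR.
  have sE := union_iso_sign wQ wR iso (iso_refl R).
  rewrite iso_sign_refl // addbF in sE.
  rewrite /bracket_sum (big_hs_iso _ iso) scaler_sumr; apply: eq_big_seq => x xP.
  rewrite scaler_sumr; apply: eq_big_seq => y yP.
  rewrite -sE -(ctr_iso k wU wU' iso') ?union_simp //.
  by rewrite union_map_inG union_map_inH.
have iso' := union_graph_iso (iso_refl R) iso.
have wU := wf_union wR wP; have wU' := wf_union wR wQ.
have sE := union_iso_sign wR wQ (iso_refl R) iso.
rewrite iso_sign_refl // addFb in sE.
rewrite /bracket_sum scaler_sumr; apply: eq_big_seq => x xP.
rewrite (big_hs_iso _ iso) scaler_sumr; apply: eq_big_seq => y yP.
rewrite -sE -(ctr_iso k wU wU' iso') ?union_simp //.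
by rewrite union_map_inG union_map_inH.
Qed.

Lemma bracket_sumC P Q : graph_wf P -> graph_wf Q ->
  bracket_sum Q P = (-1) ^+ (size (vs P) * size (vs Q)) *: bracket_sum P Q.
Proof.
move=> wP wQ; rewrite /bracket_sum exchange_big scaler_sumr; apply: eq_big_seq => x xP /=.
rewrite scaler_sumr; apply: eq_big_seq => y yQ.
have wU := wf_union wP wQ; have wU' := wf_union wQ wP.
rewrite -signr_odd -(union_swap_sign wP wQ) -(ctr_iso k wU wU' (union_swap_iso P Q)) ?union_simp //.
by rewrite union_swap_inG union_swap_inH ctr_swap ?union_simp.
Qed.

Lemma graph_bracketE (G H : ograph) : graph_bracket k G H = bracket_sum G H.
Proof.
apply: eq_big_seq => x xG; apply: eq_big_seq => y yH.
by rewrite contractionE ?union_simp.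
Qed.

Lemma Phi1_ctr P x y : graph_wf P -> x \in hs P -> y \in hs P ->
  Phi1 (ctr k P x y) = if term P x == term P y then 0
    else (-1) ^+ contract_sign P x y *: gcc k (contract P x y).
Proof.
move=> wP xP yP; rewrite ctrE; case: ifPn => vw; first exact: lin0 (@Phi1_linear k).
by rewrite (linZ _ (@Phi1_linear k)) Phi1_hgd // wf_contract.
Qed.

Lemma gcc_cut_or P : graph_wf P -> has_cut_vertex P -> gcc k P = 0.
Proof.
by move=> wP hP; case: (boolP (connected P)) => cP; [apply: gcc_cut|apply: gcc0].
Qed.

Lemma bracket_sum_cut P Q : graph_wf P -> graph_wf Q -> has_cut_vertex P ->
  Phi1 (bracket_sum P Q) = 0.
Proof.
move=> wP wQ hP; rewrite (lin_sum _ _ _ (@Phi1_linear k)); apply: big1_seq => x /= xP.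
rewrite (lin_sum _ _ _ (@Phi1_linear k)); apply: big1_seq => y /= yQ.
have wU := wf_union wP wQ; have vw := union_term_neq P Q x y.
have xU : inG x \in hs (P ** Q) by rewrite union_simp.
have yU : inH y \in hs (P ** Q) by rewrite union_simp.
rewrite Phi1_ctr // (negPf vw) gcc_cut_or ?scaler0 //; first exact: wf_contract.
exact: cut_union_contract.
Qed.

Definition hg_bracket : HG k -> HG k -> HG k := locked_with connected_class_key
  (fun u v => hglift (fun P => hglift (bracket_sum P) v) u).

Let hg_bracket_unlock u v :
  hg_bracket u v = hglift (fun P => hglift (bracket_sum P) v) u.
Proof. by rewrite /hg_bracket unlock. Qed.

Lemma hg_bracket_linearr u : linear (hg_bracket u).
Proof.
move=> a v v'; rewrite !hg_bracket_unlock -hglift_funD; apply: hglift_ext => P wP.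
exact: hglift_linear (proj2 bracket_sum_covariant P wP) _ _ _.
Qed.

Lemma hglift_bracket_covariant v : covariant (fun P => hglift (bracket_sum P) v).
Proof.
move=> f g P Q wP wQ iso.
rewrite (@hglift_ext k _ (bracket_sum Q)
   (fun R => (-1) ^+ iso_sign f g P Q *: bracket_sum P R + 0)).
  rewrite (hglift_funD (bracket_sum P) (fun=> 0)) [X in _ + X]big1 ?addr0 // => G _.
  exact: scaler0.
by move=> R wR; rewrite addr0 (proj1 bracket_sum_covariant R wR _ _ _ _ wP wQ iso).
Qed.

Lemma hg_bracket_linearl v : linear (hg_bracket^~ v).
Proof.
by move=> a u w; rewrite !hg_bracket_unlock; apply: hglift_linear (hglift_bracket_covariant v) _ _ _.
Qed.

Lemma hg_bracketE P Q : graph_wf P -> graph_wf Q ->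
  hg_bracket (hgd k P) (hgd k Q) = bracket_sum P Q.
Proof.
move=> wP wQ; rewrite hg_bracket_unlock (hglift_hgd (hglift_bracket_covariant _)) //.
exact: hglift_hgd (proj2 bracket_sum_covariant P wP) _ _.
Qed.

Lemma hg_bracket_cutl P v : graph_wf P -> has_cut_vertex P ->
  Phi1 (hg_bracket (hgd k P) v) = 0.
Proof.
move=> wP hP; apply: (@hg_ind_lin k _ (fun v => Phi1 (hg_bracket (hgd k P) v)) (fun=> 0)).
- exact: lin_comp (@Phi1_linear k) (hg_bracket_linearr _).
- by move=> a u w; rewrite scaler0 addr0.
- by move=> Q wQ; rewrite hg_bracketE // bracket_sum_cut.
Qed.

Lemma hg_bracket_cutr P v : graph_wf P -> has_cut_vertex P ->
  Phi1 (hg_bracket v (hgd k P)) = 0.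
Proof.
move=> wP hP; apply: (@hg_ind_lin k _ (fun v => Phi1 (hg_bracket v (hgd k P))) (fun=> 0)).
- exact: lin_comp (@Phi1_linear k) (hg_bracket_linearl _).
- by move=> a u w; rewrite scaler0 addr0.
- move=> Q wQ; rewrite hg_bracketE // bracket_sumC // (linZ _ (@Phi1_linear k)).
  by rewrite bracket_sum_cut // scaler0.
Qed.

Definition gc_bracket : GC k -> GC k -> GC k := locked_with connected_class_key
  (fun p q => Phi1 (hg_bracket (lift_gc p) (lift_gc q))).

Let gc_bracket_unlock p q :
  gc_bracket p q = Phi1 (hg_bracket (lift_gc p) (lift_gc q)).
Proof. by rewrite /gc_bracket unlock. Qed.

Lemma gc_bracket_linearl q : linear (gc_bracket^~ q).
Proof.
move=> a u v; rewrite !gc_bracket_unlock; move: a u v.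
apply: (@descent_linear k _ (fun u => Phi1 (hg_bracket u (lift_gc q)))).
  exact: lin_comp (@Phi1_linear k) (hg_bracket_linearl _).
by move=> P wP _ hP; apply: hg_bracket_cutl.
Qed.

Lemma gc_bracket_linearr p : linear (gc_bracket p).
Proof.
move=> a u v; rewrite !gc_bracket_unlock; move: a u v.
apply: (@descent_linear k _ (fun u => Phi1 (hg_bracket (lift_gc p) u))).
  exact: lin_comp (@Phi1_linear k) (hg_bracket_linearr _).
by move=> P wP _ hP; apply: hg_bracket_cutr.
Qed.

Lemma gc_bracketE P Q : graph_wf P -> connected P -> graph_wf Q -> connected Q ->
  gc_bracket (gcc k P) (gcc k Q) = Phi1 (bracket_sum P Q).
Proof.
move=> wP cP wQ cQ; rewrite gc_bracket_unlock.
rewrite (@descent_gcc k _ (fun u => Phi1 (hg_bracket u (lift_gc (gcc k Q))))) //; last first.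
- by move=> R wR _ hR; apply: hg_bracket_cutl.
- exact: lin_comp (@Phi1_linear k) (hg_bracket_linearl _).
rewrite (@descent_gcc k _ (fun u => Phi1 (hg_bracket (hgd k P) u))) //; last first.
- by move=> R wR _ hR; apply: hg_bracket_cutr.
- exact: lin_comp (@Phi1_linear k) (hg_bracket_linearr _).
by rewrite hg_bracketE.
Qed.

Definition Phi2 : HG k -> tensor (GC k) (GC k) :=
  locked_with connected_class_key (hglift (@phi2 k)).
Lemma Phi2_linear : linear Phi2.
Proof. by rewrite /Phi2 unlock; apply: hglift_linear (phi2_covariant k). Qed.
Lemma Phi2_hgd P : graph_wf P -> Phi2 (hgd k P) = phi2 k P.
Proof. by rewrite /Phi2 unlock; apply: hglift_hgd (phi2_covariant k) _. Qed.

Lemma Phi2_ctr P x y : graph_wf P -> x \in hs P -> y \in hs P ->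
  Phi2 (ctr k P x y) = if term P x == term P y then 0
    else (-1) ^+ contract_sign P x y *: phi2 k (contract P x y).
Proof.
move=> wP xP yP; rewrite ctrE; case: ifPn => vw; first exact: lin0 Phi2_linear.
by rewrite (linZ _ Phi2_linear) Phi2_hgd // wf_contract.
Qed.

Lemma connected_glued P x y : graph_wf P -> connected P ->
  forall S, closed_set P S -> S (term P x) = S (term P y) ->
  {in vs P &, forall u v, S u = S v}.
Proof. by move=> wP cP S cS _ u v uP vP; apply: (connectedPP wP cP cS). Qed.

Lemma contract_split_cases P x y : graph_wf P -> x \in hs P -> y \in hs P ->
  term P x != term P y ->
  (forall S, closed_set P S -> S (term P x) = S (term P y) ->
     {in vs P &, forall u v, S u = S v}) ->
  connected (contract P x y) \/
  exists A B, [/\ graph_wf A, connected A, graph_wf B, connected B &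
    graph_iso half half (A ** B) (contract P x y)].
Proof.
move=> wP xP yP vw gl; case: (boolP (connected (contract P x y))) => cC; [by left|right].
have [v vC [c1 c2]] := contract_split wP xP yP vw gl cC.
have wC := wf_contract wP xP yP vw.
have cK : closed_set (contract P x y) (component (contract P x y) v) by apply: component_closed.
exists (restrict (contract P x y) (predC (component (contract P x y) v))),
  (restrict (contract P x y) (component (contract P x y) v)); split=> //.
- exact: wf_restrict (closed_setC cK).
- exact: wf_restrict cK.
- exact: split_iso.
Qed.

Lemma phi2_contract_cut P x y : graph_wf P -> connected P -> has_cut_vertex P ->
  x \in hs P -> y \in hs P -> term P x != term P y -> phi2 k (contract P x y) = 0.
Proof.
move=> wP cP hP xP yP vw; have wC := wf_contract wP xP yP vw.
case: (boolP (connected (contract P x y))) => cC; first exact: phi2_connected.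
have hC := cut_contract wP xP yP vw cP hP cC.
have [cC'|[A [B [wA cA wB cB iso]]]] := contract_split_cases wP xP yP vw (connected_glued (x := x) (y := y) wP cP).
  by rewrite cC' in cC.
have wU := wf_union wA wB.
rewrite (phi2_covariant k wU wC iso) (phi2_union char0 wA wB cB).
have /(has_cut_vertexP wU)[c [Z cZ]] := has_cut_vertex_iso wU wC iso hC.
case/orP: (cut_witness_union wA wB cZ) => h.
  by rewrite (gcc_cut_or wA h) (lin0 (tpure_linl _)) (lin0 (tpure_linr _)) scaler0 addr0 scaler0.
by rewrite (gcc_cut_or wB h) (lin0 (tpure_linl _)) (lin0 (tpure_linr _)) scaler0 addr0 scaler0.
Qed.

Definition hg_contraction : HG k -> HG k := hglift contraction_sum.
Lemma hg_contraction_linear : linear hg_contraction.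
Proof. exact: hglift_linear contraction_sum_covariant. Qed.

(* Unordered pairs of half-edges are summed as ordered ones, whence the factor. *)
Definition gc_cobracket : GC k -> tensor (GC k) (GC k) := locked_with connected_class_key
  (fun p => 2%:R^-1 *: Phi2 (hg_contraction (lift_gc p))).

Let L_linear : linear (fun u => 2%:R^-1 *: Phi2 (hg_contraction u)).
Proof. exact: lin_scale (lin_comp Phi2_linear hg_contraction_linear). Qed.

Let L_cut P : graph_wf P -> connected P -> has_cut_vertex P ->
  2%:R^-1 *: Phi2 (hg_contraction (hgd k P)) = 0.
Proof.
move=> wP cP hP; rewrite /hg_contraction (hglift_hgd contraction_sum_covariant) //.
rewrite /contraction_sum (lin_sum _ _ _ Phi2_linear) big1_seq ?scaler0 // => x /= xP.
rewrite (lin_sum _ _ _ Phi2_linear) big1_seq // => y /= yP.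
rewrite Phi2_ctr //; case: ifPn => // vw.
by rewrite phi2_contract_cut // scaler0.
Qed.

Lemma gc_cobracket_linear : linear gc_cobracket.
Proof. by rewrite /gc_cobracket unlock; apply: descent_linear L_linear L_cut. Qed.

Lemma gc_cobracketE P : graph_wf P -> connected P ->
  gc_cobracket (gcc k P) = 2%:R^-1 *: Phi2 (contraction_sum P).
Proof.
move=> wP cP; rewrite /gc_cobracket unlock.
apply: etrans (descent_gcc L_linear L_cut wP cP) _.
by rewrite /hg_contraction (hglift_hgd contraction_sum_covariant wP).
Qed.

End Brackets.

(** * Graded linear maps *)

Section GradedExtension.
Variables (k : fieldType).
Implicit Types U V W : lmodType k.

(* The linear extension of the function that is L n on the elements of degree n. *)
Definition gext U (L : nat -> GC k -> U) (p : GC k) : U :=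
  hglift (fun P => L (size (vs P)) (gcc k P)) (lift_gc p).

Section Gext.
Variables (U : lmodType k) (L : nat -> GC k -> U).
Hypothesis lL : forall n, linear (L n).

Lemma gext_covariant : covariant (fun P => L (size (vs P)) (gcc k P)).
Proof.
move=> f g P Q wP wQ iso.
by rewrite (gcc_covariant k wP wQ iso) (iso_size iso) (linZ _ (lL _)).
Qed.

Let hL_cut P : graph_wf P -> connected P -> has_cut_vertex P ->
  hglift (fun P => L (size (vs P)) (gcc k P)) (hgd k P) = 0.
Proof.
by move=> wP cP hP; rewrite (hglift_hgd gext_covariant wP) gcc_cut // (lin0 (lL _)).
Qed.

Lemma gext_linear : linear (gext L).
Proof. exact: descent_linear (hglift_linear gext_covariant) hL_cut. Qed.

Lemma gext_gcc P : graph_wf P -> connected P -> gext L (gcc k P) = L (size (vs P)) (gcc k P).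
Proof.
move=> wP cP; apply: etrans (descent_gcc (hglift_linear gext_covariant) hL_cut wP cP) _.
exact: (hglift_hgd gext_covariant wP).
Qed.

End Gext.

(** Linearity in the family, for nested extensions: the inner one depends linearly on the outer
    argument. *)
Lemma gext_funD U (L M : nat -> GC k -> U) a p :
  gext (fun n v => a *: L n v + M n v) p = a *: gext L p + gext M p.
Proof. exact: (hglift_funD (fun P => L (size (vs P)) (gcc k P))). Qed.

Lemma eq_gext U (L M : nat -> GC k -> U) p : (forall n v, L n v = M n v) -> gext L p = gext M p.
Proof. by move=> LM; apply: hglift_ext => P wP; apply: LM. Qed.

Lemma hom_ind_lin U n (f g : GC k -> U) : linear f -> linear g ->
  (forall P, graph_wf P -> connected P -> ~~ has_cut_vertex P -> size (vs P) = n ->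
     f (gcc k P) = g (gcc k P)) ->
  forall u, u \in @GC_hom k n -> f u = g u.
Proof.
move=> lf lg fg; apply: lin_span => // v [[[P wP] cP] nP ->].
rewrite -gcc_gc; case: (boolP (has_cut_vertex P)) => hP; last exact: fg.
by rewrite gcc_cut // (lin0 lf) (lin0 lg).
Qed.

Lemma gext_hom U (L : nat -> GC k -> U) n u : (forall n, linear (L n)) ->
  u \in @GC_hom k n -> gext L u = L n u.
Proof.
move=> lL; apply: hom_ind_lin; [exact: gext_linear|exact: lL|].
by move=> P wP cP _ <-; apply: gext_gcc.
Qed.

Definition gext2 U (L : nat -> nat -> GC k -> GC k -> U) (u v : GC k) : U :=
  gext (fun a u' => gext (fun b v' => L a b u' v') v) u.

Section Gext2.
Variables (U : lmodType k) (L : nat -> nat -> GC k -> GC k -> U).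
Hypotheses (lL : forall a b v, linear (fun u => L a b u v))
  (rL : forall a b u, linear (L a b u)).

Let inner_linear a v : linear (fun u' => gext (fun b v' => L a b u' v') v).
Proof.
move=> c u u'; rewrite -gext_funD; apply: eq_gext => n w; exact: lL.
Qed.

Lemma gext2_linearl v : linear (gext2 L ^~ v).
Proof. by apply: gext_linear => a; apply: inner_linear. Qed.

Lemma gext2_linearr u : linear (gext2 L u).
Proof.
move=> c v v'; rewrite /gext2 -gext_funD; apply: eq_gext => a w.
exact: (gext_linear (fun b => rL a b w)).
Qed.

Lemma gext2_hom a b u v : u \in @GC_hom k a -> v \in @GC_hom k b -> gext2 L u v = L a b u v.
Proof.
move=> ua vb; rewrite /gext2 (gext_hom (fun a => inner_linear a v) ua).
exact: (gext_hom (fun b => rL a b u) vb).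
Qed.

End Gext2.

Lemma gcc_hom P : graph_wf P -> gcc k P \in @GC_hom k (size (vs P)).
Proof.
move=> wP; case: (boolP (connected P)) => cP; last by rewrite gcc0 ?rpred0.
by rewrite (gcc_wf k wP cP); apply: mem_span; exists (CGraph (cgraph_graph := OGraph wP) cP).
Qed.

Lemma gc_generated (p : GC k) :
  exists s : seq (k * cgraph), p = \sum_(q <- s) q.1 *: gc k q.2.
Proof.
rewrite -(lift_gcK p) /lift_gc; case: (repr p) => v /= /asboolP[s [sX ->]].
rewrite (lin_sum _ _ _ (@Phi1_linear k)).
elim: s sX => [|[a w] s IHs] sX; first by exists [::]; rewrite !big_nil.
have [|s' E] := IHs; first by move=> q qs; apply: sX; rewrite inE qs orbT.
have [G /= wE] := sX (a, w) (mem_head _ _).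
exists ((a, G) :: s'); rewrite !big_cons E /= (linZ _ (@Phi1_linear k)) wE.
by rewrite -hgd_hg Phi1_hgd ?gcc_gc //; case: (cgraph_graph G).
Qed.

Lemma gc_grading : grading (@GC_hom k).
Proof.
split.
- by move=> n; apply: span_submod_closed.
- move=> p; have [s ->] := gc_generated p; elim: s => [|[a G] s [t E]].
    by exists [::]; rewrite !big_nil.
  have gh : a *: gc k G \in @GC_hom k (size (vs G)) by rewrite rpredZ // mem_span //; exists G.
  by exists (Homog gh :: t); rewrite !big_cons E.
- move=> N u uh su n nN.
  (* The projection to the component of degree [n]. *)
  pose pr := gext (fun m v => if m == n then v else 0 : GC k).
  have lpr m : linear (fun v => if m == n then v else 0 : GC k).
    by case: (m == n) => // a v w; rewrite scaler0 addr0.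
  have lp : linear pr := gext_linear lpr.
  have := congr1 pr su; rewrite (lin_sum _ _ _ lp) (lin0 lp).
  rewrite (bigD1 (Ordinal nN)) //= big1 ?addr0 => [|i ni].
    by rewrite /pr (gext_hom lpr (uh n)) eqxx.
  by rewrite /pr (gext_hom lpr (uh i)) ifN.
Qed.

End GradedExtension.

(** * The Jacobi identity *)

Section Jacobi.
Variables (k : fieldType).
Implicit Types U V W : lmodType k.

Definition ctr2_sum (P : graph_data) (a b c d : seq nat) : HG k :=
  \sum_(x <- a) \sum_(y <- b) \sum_(z <- c) \sum_(t <- d) ctr2 k P x y z t.

Lemma exchange_big4 U (a b c d : seq nat) (F : nat -> nat -> nat -> nat -> U) :
  \sum_(x <- a) \sum_(y <- b) \sum_(z <- c) \sum_(t <- d) F x y z t =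
  \sum_(z <- c) \sum_(t <- d) \sum_(x <- a) \sum_(y <- b) F x y z t.
Proof.
under eq_bigr do rewrite exchange_big.
rewrite exchange_big; apply: eq_bigr => z _.
under eq_bigr do rewrite exchange_big.
by rewrite exchange_big.
Qed.

Section Ctr2Sum.
Variables (P : graph_data) (a b c d : seq nat).
Hypotheses (wP : graph_wf P) (aP : {subset a <= hs P}) (bP : {subset b <= hs P})
  (cP : {subset c <= hs P}) (dP : {subset d <= hs P}).

Lemma ctr2_sum_anti : ctr2_sum P a b c d = - ctr2_sum P c d a b.
Proof.
rewrite /ctr2_sum exchange_big4 -sumrN; apply: eq_big_seq => z /cP zP.
rewrite -sumrN; apply: eq_big_seq => t /dP tP.
rewrite -sumrN; apply: eq_big_seq => x /aP xP.
rewrite -sumrN; apply: eq_big_seq => y /bP yP.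
exact: ctr2_anti.
Qed.

Lemma ctr2_sum_swapl : ctr2_sum P b a c d = ctr2_sum P a b c d.
Proof.
rewrite /ctr2_sum exchange_big; apply: eq_big_seq => x /aP xP.
apply: eq_big_seq => y /bP yP; apply: eq_big_seq => z /cP zP; apply: eq_big_seq => t /dP tP.
exact: ctr2_swapl.
Qed.

Lemma ctr2_sum_swapr : ctr2_sum P a b d c = ctr2_sum P a b c d.
Proof.
apply: eq_big_seq => x /aP xP; apply: eq_big_seq => y /bP yP.
rewrite exchange_big; apply: eq_big_seq => z /cP zP; apply: eq_big_seq => t /dP tP.
exact: ctr2_swapr.
Qed.

Lemma ctr2_sum_iso f g Q : graph_wf Q -> graph_iso f g P Q ->
  ctr2_sum Q (map g a) (map g b) (map g c) (map g d)
  = (-1) ^+ iso_sign f g P Q *: ctr2_sum P a b c d.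
Proof.
move=> wQ iso; rewrite /ctr2_sum big_map scaler_sumr; apply: eq_big_seq => x /aP xP.
rewrite big_map scaler_sumr; apply: eq_big_seq => y /bP yP.
rewrite big_map scaler_sumr; apply: eq_big_seq => z /cP zP.
rewrite big_map scaler_sumr; apply: eq_big_seq => t /dP tP.
exact: ctr2_iso.
Qed.

End Ctr2Sum.

Lemma hg_bracket_ctr P R x y : graph_wf P -> graph_wf R -> x \in hs P -> y \in hs P ->
  hg_bracket (ctr k P x y) (hgd k R) =
  \sum_(z <- hs P) \sum_(t <- hs R) ctr2 k (P ** R) (inG x) (inG y) (inG z) (inH t).
Proof.
move=> wP wR xP yP; have lb := hg_bracket_linearl (hgd k R).
under [RHS]eq_bigr do under eq_bigr do rewrite ctr2E !inE !union_simp ?orbF.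
rewrite ctrE; case: ifPn => vw.
  rewrite (lin0 lb); apply/esym/big1 => z _; apply: big1 => t _.
  by rewrite !orbT.
have wC := wf_contract wP xP yP vw.
rewrite (linZ _ lb) hg_bracketE // /bracket_sum hs_contract big_filter scaler_sumr.
rewrite big_mkcond; apply: eq_bigr => z _; rewrite scaler_sumr.
rewrite contract_sign_unionl // contract_unionl //.
case: (boolP ((z != x) && (z != y))).
  move=> /andP[/negPf-> /negPf->]; apply: eq_bigr => t _; by [].
rewrite negb_and !negbK => zxy; apply/esym/big1 => t _.
by rewrite orbC zxy orbT.
Qed.

Lemma hg_contraction_ctr P x y : graph_wf P -> x \in hs P -> y \in hs P ->
  hg_contraction (ctr k P x y) = \sum_(z <- hs P) \sum_(t <- hs P) ctr2 k P x y z t.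
Proof.
move=> wP xP yP; have lb := @hg_contraction_linear k.
under [RHS]eq_bigr do under eq_bigr do rewrite ctr2E.
rewrite ctrE; case: ifPn => vw.
  rewrite (lin0 lb); apply/esym/big1 => z _; apply: big1 => t _.
  by rewrite !orbT.
have wC := wf_contract wP xP yP vw.
rewrite (linZ _ lb) /hg_contraction (hglift_hgd (@contraction_sum_covariant k) wC).
rewrite /contraction_sum hs_contract big_filter scaler_sumr.
rewrite big_mkcond; apply: eq_bigr => z _; rewrite !inE.
case: (boolP ((z != x) && (z != y))); last first.
  rewrite negb_and !negbK => -> /=; by rewrite big1.
move=> /andP[/negPf-> /negPf->]; rewrite scaler_sumr big_filter big_mkcond.
apply: eq_bigr => t _; rewrite !inE /= orbF.
by case: (t == x); case: (t == y).
Qed.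

(** The half-edges of the first, second and third factor of [A ** B ** C]. *)
Definition lab0 (A : graph_data) := map inG (map inG (hs A)).
Definition lab1 (B : graph_data) := map inG (map inH (hs B)).
Definition lab2 (C : graph_data) := map inH (hs C).

Lemma lab0_sub A B C : {subset lab0 A <= hs (A ** B ** C)}.
Proof. by move=> _ /mapP[_ /mapP[h hA ->] ->]; rewrite !union_simp. Qed.
Lemma lab1_sub A B C : {subset lab1 B <= hs (A ** B ** C)}.
Proof. by move=> _ /mapP[_ /mapP[h hB ->] ->]; rewrite !union_simp. Qed.
Lemma lab2_sub A B C : {subset lab2 C <= hs (A ** B ** C)}.
Proof. by move=> _ /mapP[h hC ->]; rewrite !union_simp. Qed.

(** The rotation from [A ** B ** C] to [C ** A ** B]: the last two factors are exchanged, then the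
    first two. *)
Definition cycle_map n := union_map union_swap id (union_swap23 n).

Lemma cycle_map0 A : map cycle_map (lab0 A) = lab1 A.
Proof.
rewrite /lab0 /lab1 -!map_comp; apply: eq_map => n.
by rewrite /= /cycle_map union_swap23E union_map_inG union_swap_inG.
Qed.
Lemma cycle_map1 A : map cycle_map (lab1 A) = lab2 A.
Proof.
rewrite /lab2 /lab1 -!map_comp; apply: eq_map => n.
by rewrite /= /cycle_map union_swap23E union_map_inH.
Qed.
Lemma cycle_map2 A : map cycle_map (lab2 A) = lab0 A.
Proof.
rewrite /lab0 /lab2 -!map_comp; apply: eq_map => n.
by rewrite /= /cycle_map union_swap23E union_map_inG union_swap_inH.
Qed.

Lemma ctr2_sum_cycle A B C a b c d : graph_wf A -> graph_wf B -> graph_wf C ->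
  {subset a <= hs (A ** B ** C)} -> {subset b <= hs (A ** B ** C)} ->
  {subset c <= hs (A ** B ** C)} -> {subset d <= hs (A ** B ** C)} ->
  (-1) ^+ (size (vs C) * (size (vs A) + size (vs B))) *: ctr2_sum (A ** B ** C) a b c d
  = ctr2_sum (C ** A ** B) (map cycle_map a) (map cycle_map b) (map cycle_map c)
      (map cycle_map d).
Proof.
move=> wA wB wC sa sb sc sd.
have w1 := wf_union (wf_union wA wB) wC.
have w2 := wf_union (wf_union wA wC) wB.
have w3 := wf_union (wf_union wC wA) wB.
have i1 := union_swap23_iso A B C.
have i2 := union_graph_iso (union_swap_iso A C) (iso_refl B).
have s1 := union_swap23_sign wA wB wC.
have s2 := union_iso_sign (wf_union wC wA) wB (union_swap_iso A C) (iso_refl B).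
rewrite (union_swap_sign wA wC) (iso_sign_refl wB) addbF in s2.
have sub l : {subset l <= hs (A ** B ** C)} -> {subset map union_swap23 l <= hs (A ** C ** B)}.
  by move=> sl _ /mapP[h /sl hl ->]; apply: (iso_hs i1).
have cE l : map cycle_map l = map (union_map union_swap id) (map union_swap23 l).
  by rewrite -map_comp.
rewrite !cE (ctr2_sum_iso w2 (sub a sa) (sub b sb) (sub c sc) (sub d sd) w3 i2).
rewrite (ctr2_sum_iso w1 sa sb sc sd w2 i1) s1 s2 scalerA -signr_addb -oddD signr_odd.
by congr (_ ^+ _ *: _); rewrite mulnDr mulnC [(size (vs C) * size (vs B))%N]mulnC.
Qed.

Lemma gc_bracket_Phi1_ctr P R x y : graph_wf P -> graph_wf R -> connected R ->
  x \in hs P -> y \in hs P -> (term P x != term P y -> connected (contract P x y)) ->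
  gc_bracket (Phi1 (ctr k P x y)) (gcc k R) = Phi1 (hg_bracket (ctr k P x y) (hgd k R)).
Proof.
move=> wP wR cR xP yP cc; rewrite (Phi1_ctr k wP xP yP) ctrE; case: ifPn => vw.
  by rewrite (lin0 (gc_bracket_linearl _)) (lin0 (hg_bracket_linearl _)) (lin0 (@Phi1_linear k)).
have wC := wf_contract wP xP yP vw.
rewrite (linZ _ (gc_bracket_linearl _)) (linZ _ (hg_bracket_linearl _)) (linZ _ (@Phi1_linear k)).
by rewrite (gc_bracketE k wC (cc vw) wR cR) (hg_bracketE k wC wR).
Qed.

(** The half-edge of [C] is contracted with a remaining one of [A] or of [B]. As [B] has no cut
    vertex, the inner contractions are connected, so [gc_bracketE] applies to them. *)
Lemma gc_bracket2 A B C : graph_wf A -> graph_wf B -> graph_wf C ->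
  connected A -> connected B -> connected C -> ~~ has_cut_vertex B ->
  gc_bracket (gc_bracket (gcc k A) (gcc k B)) (gcc k C) =
  Phi1 (ctr2_sum (A ** B ** C) (lab0 A) (lab1 B) (lab0 A) (lab2 C)) +
  Phi1 (ctr2_sum (A ** B ** C) (lab0 A) (lab1 B) (lab1 B) (lab2 C)).
Proof.
move=> wA wB wC cA cB cC nB; rewrite (gc_bracketE k wA cA wB cB) -(linD (@Phi1_linear k)).
have wU := wf_union wA wB.
rewrite (lin_sum _ _ _ (@Phi1_linear k)) (lin_sum _ _ _ (gc_bracket_linearl _)).
rewrite /ctr2_sum -big_split (lin_sum _ _ _ (@Phi1_linear k)) !big_map /=.
apply: eq_big_seq => x xA.
rewrite (lin_sum _ _ _ (@Phi1_linear k)) (lin_sum _ _ _ (gc_bracket_linearl _)).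
rewrite -big_split (lin_sum _ _ _ (@Phi1_linear k)) !big_map /=.
apply: eq_big_seq => y yB.
have xU : inG x \in hs (A ** B) by rewrite union_simp.
have yU : inH y \in hs (A ** B) by rewrite union_simp.
have cU : connected (contract (A ** B) (inG x) (inH y)) by apply: connected_union_contract.
rewrite (gc_bracket_Phi1_ctr wU wC cC xU yU (fun _ => cU)); congr Phi1.
rewrite (hg_bracket_ctr wU wC xU yU) hs_union big_cat !big_map /=.
by congr (_ + _); apply: eq_bigr => z _; rewrite big_map.
Qed.

Lemma gcc_jacobi A B C : graph_wf A -> graph_wf B -> graph_wf C ->
  connected A -> connected B -> connected C ->
  ~~ has_cut_vertex A -> ~~ has_cut_vertex B -> ~~ has_cut_vertex C ->
  gc_bracket (gc_bracket (gcc k A) (gcc k B)) (gcc k C)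
  + (-1) ^+ (size (vs A) * (size (vs B) + size (vs C)))
      *: gc_bracket (gc_bracket (gcc k B) (gcc k C)) (gcc k A)
  + (-1) ^+ (size (vs C) * (size (vs A) + size (vs B)))
      *: gc_bracket (gc_bracket (gcc k C) (gcc k A)) (gcc k B) = 0.
Proof.
move=> wA wB wC cA cB cC nA nB nC.
have lP := @Phi1_linear k.
have w1 := wf_union (wf_union wA wB) wC.
have s0 := @lab0_sub; have s1 := @lab1_sub; have s2 := @lab2_sub.
pose S := ctr2_sum (A ** B ** C).
have E2 a b c d : {subset a <= hs (B ** C ** A)} -> {subset b <= hs (B ** C ** A)} ->
    {subset c <= hs (B ** C ** A)} -> {subset d <= hs (B ** C ** A)} ->
    (-1) ^+ (size (vs A) * (size (vs B) + size (vs C))) *: Phi1 (ctr2_sum (B ** C ** A) a b c d)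
    = Phi1 (S (map cycle_map a) (map cycle_map b) (map cycle_map c) (map cycle_map d)).
  by move=> *; rewrite -(linZ _ lP) ctr2_sum_cycle.
have cyc_sub l : {subset l <= hs (C ** A ** B)} -> {subset map cycle_map l <= hs (B ** C ** A)}.
  move=> sl _ /mapP[h /sl hl ->]; move: h hl.
  apply: union_hs_ind => [|h hB]; last by rewrite /cycle_map union_swap23E union_map_inG union_swap_inH !union_simp.
  by apply: union_hs_ind => h hC; rewrite /cycle_map union_swap23E ?union_map_inG ?union_map_inH ?union_swap_inG !union_simp.
have E3 a b c d : {subset a <= hs (C ** A ** B)} -> {subset b <= hs (C ** A ** B)} ->
    {subset c <= hs (C ** A ** B)} -> {subset d <= hs (C ** A ** B)} ->
    (-1) ^+ (size (vs C) * (size (vs A) + size (vs B))) *: Phi1 (ctr2_sum (C ** A ** B) a b c d)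
    = Phi1 (S (map cycle_map (map cycle_map a)) (map cycle_map (map cycle_map b))
         (map cycle_map (map cycle_map c)) (map cycle_map (map cycle_map d))).
  move=> sa sb sc sd; rewrite -E2; try exact: cyc_sub.
  rewrite -(ctr2_sum_cycle wC wA wB sa sb sc sd) (linZ _ lP) scalerA -exprD; congr (_ *: _).
  by rewrite -[LHS]signr_odd -[RHS]signr_odd !oddD !oddM !oddD; case: (odd _); case: (odd _); case: (odd _).
rewrite (gc_bracket2 wA wB wC cA cB cC nB).
rewrite (gc_bracket2 wB wC wA cB cC cA nC).
rewrite (gc_bracket2 wC wA wB cC cA cB nA).
rewrite !scalerDr.
rewrite (E2 _ _ _ _ (s0 _ _ _) (s1 _ _ _) (s0 _ _ _) (s2 _ _ _)).
rewrite (E2 _ _ _ _ (s0 _ _ _) (s1 _ _ _) (s1 _ _ _) (s2 _ _ _)).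
rewrite (E3 _ _ _ _ (s0 _ _ _) (s1 _ _ _) (s0 _ _ _) (s2 _ _ _)).
rewrite (E3 _ _ _ _ (s0 _ _ _) (s1 _ _ _) (s1 _ _ _) (s2 _ _ _)).
rewrite !(cycle_map0, cycle_map1, cycle_map2) -/S.
(* Six sums are left: each contracts two of the three types of pairs AB, BC, CA, in a given order.
   The two orders cancel. *)
have S1 : S (lab2 C) (lab0 A) (lab0 A) (lab1 B) = - S (lab0 A) (lab1 B) (lab0 A) (lab2 C).
  by rewrite /S (ctr2_sum_anti w1 (s2 _ _ _) (s0 _ _ _) (s0 _ _ _) (s1 _ _ _))
    (ctr2_sum_swapr w1 (s0 _ _ _) (s1 _ _ _) (s0 _ _ _) (s2 _ _ _)).
have S2 : S (lab1 B) (lab2 C) (lab1 B) (lab0 A) = - S (lab0 A) (lab1 B) (lab1 B) (lab2 C).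
  by rewrite /S (ctr2_sum_anti w1 (s1 _ _ _) (s2 _ _ _) (s1 _ _ _) (s0 _ _ _))
    (ctr2_sum_swapl w1 (s0 _ _ _) (s1 _ _ _) (s1 _ _ _) (s2 _ _ _)).
have S3 : S (lab2 C) (lab0 A) (lab2 C) (lab1 B) = - S (lab1 B) (lab2 C) (lab2 C) (lab0 A).
  rewrite /S (ctr2_sum_anti w1 (s2 _ _ _) (s0 _ _ _) (s2 _ _ _) (s1 _ _ _)).
  by rewrite (ctr2_sum_swapl w1 (s1 _ _ _) (s2 _ _ _) (s2 _ _ _) (s0 _ _ _)).
rewrite S1 S2 S3 !(linN lP).
by rewrite !addrA !addrK subrr.
Qed.

End Jacobi.

(** * The co-Jacobi identity *)

Section CoJacobi.
Variables (k : fieldType) (char0 : [pchar k] =i pred0).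
Implicit Types U V W : lmodType k.
Notation T2 := (tensor (GC k) (GC k)).

Lemma natr2_neq0 : 2%:R != 0 :> k.
Proof. by rewrite (iffLR (pcharf0P k) char0). Qed.

Lemma opp_eq0 U (u : U) : u = - u -> u = 0.
Proof.
move=> E; have : 2%:R *: u = 0 by rewrite scaler_nat mulr2n {1}E addNr.
by move/eqP; rewrite scaler_eq0 (negPf natr2_neq0) => /eqP.
Qed.

Lemma tlift_funD U V W (f g : U -> V -> W) a X :
  tlift (fun u v => a *: f u v + g u v) X = a *: tlift f X + tlift g X.
Proof. by rewrite /tlift /qlift mliftD mliftZ. Qed.

Lemma eq_tlift U V W (f g : U -> V -> W) X :
  (forall u v, f u v = g u v) -> tlift f X = tlift g X.
Proof. by move=> fg; apply: eq_bigr => p _; rewrite fg. Qed.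

Lemma gext2_funD U (L M : nat -> nat -> GC k -> GC k -> U) a u v :
  gext2 (fun m n u v => a *: L m n u v + M m n u v) u v = a *: gext2 L u v + gext2 M u v.
Proof. by rewrite /gext2 -gext_funD; apply: eq_gext => n w; apply: gext_funD. Qed.

Section Tl2.
Variables (U : lmodType k) (L : nat -> nat -> GC k -> GC k -> U).
Hypotheses (lL : forall a b v, linear (fun u => L a b u v))
  (rL : forall a b u, linear (L a b u)).

(** Linear maps on [GC \ox GC] given by formulas in the degrees of both factors. *)
Definition tgext : T2 -> U := locked_with connected_class_key (tlift (gext2 L)).

Lemma tgextE X : tgext X = tlift (gext2 L) X.
Proof. by rewrite /tgext unlock. Qed.

Lemma tgext_linear : linear tgext.
Proof.
by rewrite /tgext unlock; apply: tlift_linear (gext2_linearl lL) (gext2_linearr rL).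
Qed.

Lemma tgext_hom a b u v : u \in @GC_hom k a -> v \in @GC_hom k b ->
  tgext (u \ox v) = L a b u v.
Proof.
move=> ua vb; rewrite tgextE (tliftE (gext2_linearl lL) (gext2_linearr rL)).
exact: gext2_hom.
Qed.

Lemma tgext_gcc P Q : graph_wf P -> graph_wf Q ->
  tgext (gcc k P \ox gcc k Q) = L (size (vs P)) (size (vs Q)) (gcc k P) (gcc k Q).
Proof. by move=> wP wQ; apply: tgext_hom; apply: gcc_hom. Qed.

End Tl2.

(** The map tau of the cobracket symmetry. *)
Definition tflip : T2 -> T2 := tgext (fun a b u v => (-1) ^+ (a * b) *: (v \ox u)).

Lemma tflip_l a b (v : GC k) : linear (fun u : GC k => (-1) ^+ (a * b) *: (v \ox u) : T2).
Proof. by apply: lin_scale; apply: tpure_linr. Qed.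
Lemma tflip_r a b (u : GC k) : linear (fun v : GC k => (-1) ^+ (a * b) *: (v \ox u) : T2).
Proof. by apply: lin_scale; apply: tpure_linl. Qed.
Lemma tflip_linear : linear tflip. Proof. exact: (tgext_linear tflip_l tflip_r). Qed.
Lemma tflip_hom a b u v : u \in @GC_hom k a -> v \in @GC_hom k b ->
  tflip (u \ox v) = (-1) ^+ (a * b) *: (v \ox u).
Proof. exact: (tgext_hom tflip_l tflip_r). Qed.

Lemma tflip_phi2_union A B : graph_wf A -> graph_wf B -> connected B ->
  tflip (phi2 k (A ** B)) = phi2 k (A ** B).
Proof.
move=> wA wB cB; rewrite (phi2_union char0 wA wB cB) (linD tflip_linear).
rewrite (tflip_hom (gcc_hom k wA) (gcc_hom k wB)) (linZ _ tflip_linear).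
rewrite (tflip_hom (gcc_hom k wB) (gcc_hom k wA)) scalerA -exprD.
rewrite [(size (vs B) * _)%N]mulnC addnn -[(-1) ^+ (_.*2)]signr_odd odd_double scale1r.
by rewrite addrC.
Qed.

Lemma tflip_phi2_contract P x y : graph_wf P -> x \in hs P -> y \in hs P ->
  term P x != term P y ->
  (forall S, closed_set P S -> S (term P x) = S (term P y) ->
     {in vs P &, forall u v, S u = S v}) ->
  tflip (phi2 k (contract P x y)) = phi2 k (contract P x y).
Proof.
move=> wP xP yP vw gl; have wC := wf_contract wP xP yP vw.
have [cC|[A [B [wA cA wB cB iso]]]] := contract_split_cases wP xP yP vw gl.
  by rewrite (phi2_connected k wC cC) (lin0 tflip_linear).
rewrite (phi2_covariant k (wf_union wA wB) wC iso) (linZ _ tflip_linear).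
by rewrite tflip_phi2_union.
Qed.

Lemma gc_cobracket_flip p : tflip (gc_cobracket p) = gc_cobracket p.
Proof.
move: p; have lth := gc_cobracket_linear char0.
apply: (@gc_ind_lin k _ (fun p => tflip (gc_cobracket p))); [exact: lin_comp tflip_linear lth|exact: lth|].
move=> P wP cP _; rewrite (gc_cobracketE char0 wP cP) (linZ _ tflip_linear); congr (_ *: _).
rewrite /contraction_sum !(lin_sum _ _ _ (@Phi2_linear k)) (lin_sum _ _ _ tflip_linear).
apply: eq_big_seq => x xP.
rewrite !(lin_sum _ _ _ (@Phi2_linear k)) (lin_sum _ _ _ tflip_linear).
apply: eq_big_seq => y yP; rewrite (Phi2_ctr k wP xP yP).
case: ifPn => vw; first exact: lin0 tflip_linear.
rewrite (linZ _ tflip_linear) tflip_phi2_contract //.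
exact: connected_glued.
Qed.

(* An abstract codomain for m keeps the unifier from unfolding iterated tensor
   products; m is instantiated with the pure tensor. *)
Section Triple.
Variables (T3 : lmodType k) (m : T2 -> GC k -> T3).
Hypotheses (ml : forall w, linear (m^~ w)) (mr : forall X, linear (m X)).

Let m3 (u v w : GC k) : T3 := m (u \ox v) w.

Definition cyc_term (a b c : nat) (u v w : GC k) : T3 :=
  m3 u v w + (-1) ^+ (c * (a + b)) *: m3 w u v
  + (-1) ^+ (a * (b + c)) *: m3 v w u.

Let llr v w : linear (fun u => m3 u v w).
Proof. exact: (lin_comp (ml w) (tpure_linl v)). Qed.
Let lrl u w : linear (fun v => m3 u v w).
Proof. exact: (lin_comp (ml w) (tpure_linr u)). Qed.
Let lrr u v : linear (fun w => m3 u v w).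
Proof. exact: mr. Qed.

Lemma cyc_term_lin1 a b c v w : linear (fun u => cyc_term a b c u v w).
Proof. exact: (lin_add (lin_add (llr v w) (lin_scale _ (lrl w v))) (lin_scale _ (lrr v w))). Qed.
Lemma cyc_term_lin2 a b c u w : linear (fun v => cyc_term a b c u v w).
Proof. exact: (lin_add (lin_add (lrl u w) (lin_scale _ (lrr w u))) (lin_scale _ (llr w u))). Qed.
Lemma cyc_term_lin3 a b c u v : linear (fun w => cyc_term a b c u v w).
Proof. exact: (lin_add (lin_add (lrr u v) (lin_scale _ (llr u v))) (lin_scale _ (lrl v u))). Qed.

(** [X] is sent to [1 + sigma + sigma^2] of [X \ox w], for [w] of degree [c]. *)
Definition cyc (c : nat) (w : GC k) : T2 -> T3 :=
  tgext (fun a b u v => cyc_term a b c u v w).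

Lemma cyc_linear c w : linear (cyc c w).
Proof.
exact: (tgext_linear (fun a b v => cyc_term_lin1 a b c v w) (fun a b u => cyc_term_lin2 a b c u w)).
Qed.

Lemma cyc_linearw c X : linear (fun w => cyc c w X).
Proof.
pose L w (a b : nat) u v := cyc_term a b c u v w.
have cE w : cyc c w X = tlift (gext2 (L w)) X := tgextE _ X.
move=> s w w'; rewrite !cE -[RHS](tlift_funD (gext2 (L w)) (gext2 (L w'))).
apply: eq_tlift => u v; rewrite -(gext2_funD (L w) (L w')).
apply: eq_gext => n u'; apply: eq_gext => n' v'.
exact: cyc_term_lin3.
Qed.

Lemma cyc_hom a b c u v w : u \in @GC_hom k a -> v \in @GC_hom k b ->
  cyc c w (u \ox v) = cyc_term a b c u v w.
Proof.
exact: (tgext_hom (fun a b v => cyc_term_lin1 a b c v w) (fun a b u => cyc_term_lin2 a b c u w)).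
Qed.

(** The operator [(1 + sigma + sigma^2)(theta \ox id)] of the co-Jacobi identity. *)
Definition cobracket_cyc : T2 -> T3 := locked_with connected_class_key
  (tlift (fun u w => gext (fun c w => cyc c w (gc_cobracket u)) w)).

Let cc_l w : linear (fun u => gext (fun c w => cyc c w (gc_cobracket u)) w).
Proof.
move=> a u u'; rewrite -gext_funD; apply: eq_gext => n v.
by rewrite (gc_cobracket_linear char0) cyc_linear.
Qed.
Let cc_r u : linear (gext (fun c w => cyc c w (gc_cobracket u))).
Proof. by apply: gext_linear => c; apply: cyc_linearw. Qed.

Lemma cobracket_cyc_linear : linear cobracket_cyc.
Proof. by rewrite /cobracket_cyc unlock; apply: tlift_linear cc_l cc_r. Qed.

Lemma cobracket_cyc_hom u c w : w \in @GC_hom k c ->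
  cobracket_cyc (u \ox w) = cyc c w (gc_cobracket u).
Proof.
move=> wc; rewrite /cobracket_cyc unlock (tliftE cc_l cc_r).
by apply: gext_hom wc => n; apply: cyc_linearw.
Qed.

Definition Phi3 : HG k -> T3 := locked_with connected_class_key (hglift (phi3 m)).
Lemma Phi3_linear : linear Phi3.
Proof. by rewrite /Phi3 unlock; apply: hglift_linear (phi3_covariant ml mr). Qed.
Lemma Phi3_hgd P : graph_wf P -> Phi3 (hgd k P) = phi3 m P.
Proof. by rewrite /Phi3 unlock; apply: hglift_hgd (phi3_covariant ml mr) _. Qed.

(* The component containing B can be any of the three tensor factors. *)
Lemma phi3_union Q B : graph_wf Q -> graph_wf B -> connected B ->
  tflip (phi2 k Q) = phi2 k Q -> phi3 m (Q ** B) = cyc (size (vs B)) (gcc k B) (phi2 k Q).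
Proof.
move=> wQ wB cB fQ; set b := size (vs B); set w := gcc k B.
have [F2 [lF2 F2E]] : exists F : T2 -> T3, linear F /\ forall P R, graph_wf P -> graph_wf R ->
    F (gcc k P \ox gcc k R) = (-1) ^+ (b * (size (vs P) + size (vs R))) *: m3 w (gcc k P) (gcc k R).
  pose L (n n' : nat) u v := (-1) ^+ (b * (n + n')) *: m3 w u v.
  have l n n' v : linear (fun u => L n n' u v) := lin_scale _ (lrl w v).
  have r n n' u : linear (L n n' u) := lin_scale _ (lrr w u).
  exists (tgext L); split; first exact: tgext_linear l r.
  by move=> P R wP wR; apply: (tgext_gcc l r wP wR).
have [F3 [lF3 F3E]] : exists F : T2 -> T3, linear F /\ forall P R, graph_wf P -> graph_wf R ->
    F (gcc k P \ox gcc k R) = (-1) ^+ (size (vs R) * b) *: m3 (gcc k P) w (gcc k R).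
  pose L (n n' : nat) u v := (-1) ^+ (n' * b) *: m3 u w v.
  have l n n' v : linear (fun u => L n n' u v) := lin_scale _ (llr w v).
  have r n n' u : linear (L n n' u) := lin_scale _ (lrr u w).
  exists (tgext L); split; first exact: tgext_linear l r.
  by move=> P R wP wR; apply: (tgext_gcc l r wP wR).
(* [F2] puts [w] first and [F3] puts it between the two factors. The third cyclic term has [w] in
   the middle but the factors exchanged, hence the tau; on a tau-invariant tensor [w] runs through
   all three positions. *)
have E X : cyc b w X = m X w + F2 X + F3 (tflip X).
  have lE := lin_add (lin_add (ml w) lF2) (lin_comp lF3 tflip_linear).
  move: X; apply: (tensor_ind_lin (cyc_linear b w) lE) => u v.
  move: u; apply: (gc_ind_lin (lin_comp (cyc_linear b w) (tpure_linl v)) (lin_comp lE (tpure_linl v))).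
  move=> P wP _ _; set u := gcc k P; move: v.
  apply: (gc_ind_lin (lin_comp (cyc_linear b w) (tpure_linr u)) (lin_comp lE (tpure_linr u))).
  move=> R wR _ _; have hu := gcc_hom k wP; have hv := gcc_hom k wR.
  have e3 : F3 (tflip (u \ox gcc k R)) =
      (-1) ^+ (size (vs P) * (size (vs R) + b)) *: m3 (gcc k R) w u.
    apply: etrans (congr1 F3 (tflip_hom hu hv)) _; apply: etrans (linZ _ lF3 _) _.
    by rewrite (F3E _ _ wR wP) scalerA -exprD -mulnDr.
  exact: (etrans (cyc_hom b w hu hv)
    (congr2 +%R (congr2 +%R (erefl _) (esym (F2E _ _ wP wR))) (esym e3))).
rewrite E fQ /phi3 (root_sum_union char0 wQ wB (phi3_bicovariant ml mr) cB) -addrA.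
congr (_ + _).
(* For a component [K] of [Q] in the last factor, [phi2] of the rest of [Q] with [B] has [B] second
   or first; these terms match [F3] and [F2]. *)
rewrite -[phi2 k Q]/(\sum_(v <- vs Q) root_term (fun A B => gcc k A \ox gcc k B) Q v).
rewrite (lin_sum _ _ _ lF2) (lin_sum _ _ _ lF3) -big_split; apply: eq_big_seq => v vQ /=.
rewrite /root_term; set K := component Q v.
have cK : closed_set Q K by apply: component_closed.
have w1 := wf_restrict wQ cK; have w2 := wf_restrict wQ (closed_setC cK).
rewrite (phi2_union char0 w2 wB cB) -/w -/b.
set X := _ \ox gcc k (restrict Q K).
have F2X : F2 X = _ := F2E _ _ w2 w1.
have F3X : F3 X = _ := F3E _ _ w2 w1.
rewrite !(linZ _ lF2) !(linZ _ lF3) F2X F3X -scalerDr; congr (_ *: _).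
rewrite -scalerDr (linD (ml _)) (linZ _ (ml _)).
rewrite signr_addb signr_odd -scalerA; congr (_ *: _).
have H (Y Z : T3) (p q : nat) : (-1) ^+ (q * b) *: (Y + (-1) ^+ (p * b) *: Z)
    = (-1) ^+ (b * (p + q)) *: Z + (-1) ^+ (q * b) *: Y.
  rewrite scalerDr addrC scalerA -exprD; congr (_ *: _ + _).
  by congr (_ ^+ _); rewrite -mulnDl mulnC addnC.
exact: H.
Qed.

Lemma phi3_connected P : graph_wf P -> connected P -> phi3 m P = 0.
Proof.
move=> wP cP; apply: big1_seq => v /= vP; rewrite /root_term.
set K := component P v.
suff -> : phi2 k (restrict P (predC K)) = 0 by rewrite (lin0 (ml _)) !scaler0.
rewrite /phi2 /root_sum [vs _](_ : _ = [::]) ?big_nil //.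
apply: etrans (filter_pred0 (vs P)); apply: eq_in_filter => u uP.
exact: negbF (connected_component wP cP vP uP).
Qed.

(** [phi3] needs three components, but such a contraction has at most two. *)
Lemma phi3_contract P x y : graph_wf P -> x \in hs P -> y \in hs P ->
  term P x != term P y ->
  (forall S, closed_set P S -> S (term P x) = S (term P y) ->
     {in vs P &, forall u v, S u = S v}) ->
  phi3 m (contract P x y) = 0.
Proof.
move=> wP xP yP vw gl; have wC := wf_contract wP xP yP vw.
have [cC|[A [B [wA cA wB cB iso]]]] := contract_split_cases wP xP yP vw gl.
  exact: phi3_connected.
rewrite (phi3_covariant ml mr (wf_union wA wB) wC iso).
have f0 : tflip (phi2 k A) = phi2 k A by rewrite (phi2_connected k wA cA) (lin0 tflip_linear).
by rewrite (phi3_union wA wB cB f0) (phi2_connected k wA cA) (lin0 (cyc_linear _ _)) scaler0.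
Qed.

Lemma Phi3_ctr P x y : graph_wf P -> x \in hs P -> y \in hs P ->
  Phi3 (ctr k P x y) = if term P x == term P y then 0
    else (-1) ^+ contract_sign P x y *: phi3 m (contract P x y).
Proof.
move=> wP xP yP; rewrite ctrE; case: ifPn => vw; first exact: lin0 Phi3_linear.
by rewrite (linZ _ Phi3_linear) Phi3_hgd // wf_contract.
Qed.

Lemma Phi3_ctr0 P x y : graph_wf P -> x \in hs P -> y \in hs P ->
  (forall S, closed_set P S -> S (term P x) = S (term P y) ->
     {in vs P &, forall u v, S u = S v}) ->
  Phi3 (ctr k P x y) = 0.
Proof.
move=> wP xP yP gl; rewrite Phi3_ctr //; case: ifPn => // vw.
by rewrite phi3_contract // scaler0.
Qed.

Lemma union_glued A B x y : graph_wf A -> graph_wf B -> connected A -> connected B ->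
  x \in hs A -> y \in hs B ->
  forall S, closed_set (A ** B) S ->
  S (term (A ** B) (inG x)) = S (term (A ** B) (inH y)) ->
  {in vs (A ** B) &, forall u v, S u = S v}.
Proof.
move=> wA wB cA cB xA yB S /closed_set_union[sA sB]; rewrite !union_simp => E.
have tA := term_vs wA xA; have tB := term_vs wB yB.
suff H u : u \in vs (A ** B) -> S u = S (inG (term A x)) by move=> u v /H-> /H->.
elim/inGH_ind: u => u; rewrite union_simp => uU.
  exact: (connectedPP wA cA sA uU tA).
rewrite E; exact: (connectedPP wB cB sB uU tB).
Qed.

(** A contraction inside [A] leaves [B] as a further component, which [phi3_union] inserts in every
    position of a term of theta of [A]. *)
Lemma Phi3_union_diag A B : graph_wf A -> graph_wf B -> connected A -> connected B ->
  2%:R^-1 *: \sum_(x <- hs A) \sum_(y <- hs A) Phi3 (ctr k (A ** B) (inG x) (inG y))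
  = cyc (size (vs B)) (gcc k B) (gc_cobracket (gcc k A)).
Proof.
move=> wA wB cA cB; rewrite (gc_cobracketE char0 wA cA) (linZ _ (cyc_linear _ _)); congr (_ *: _).
rewrite /contraction_sum (lin_sum _ _ _ (@Phi2_linear k)) (lin_sum _ _ _ (cyc_linear _ _)).
apply: eq_big_seq => x xA.
rewrite (lin_sum _ _ _ (@Phi2_linear k)) (lin_sum _ _ _ (cyc_linear _ _)).
apply: eq_big_seq => y yA.
rewrite (ctr_unionl k x wA wB yA) (Phi2_ctr k wA xA yA); case: ifPn => vw.
  by rewrite (lin0 Phi3_linear) (lin0 (cyc_linear _ _)).
have wC := wf_contract wA xA yA vw.
rewrite (linZ _ Phi3_linear) (linZ _ (cyc_linear _ _)) Phi3_hgd ?wf_union //.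
have fl := tflip_phi2_contract wA xA yA vw (connected_glued (x := x) (y := y) wA cA).
by rewrite (phi3_union wC wB cB fl).
Qed.

(** Contractions between [A] and [B] leave at most two components and vanish under [Phi3]; those
    inside [A] or inside [B] give theta of one factor beside the other. *)
Lemma Phi3_contraction_union A B : graph_wf A -> graph_wf B -> connected A -> connected B ->
  2%:R^-1 *: Phi3 (contraction_sum k (A ** B)) = cobracket_cyc (phi2 k (A ** B)).
Proof.
move=> wA wB cA cB; have wU := wf_union wA wB.
have -> : cobracket_cyc (phi2 k (A ** B)) = cyc (size (vs B)) (gcc k B) (gc_cobracket (gcc k A))
    + (-1) ^+ (size (vs A) * size (vs B)) *: cyc (size (vs A)) (gcc k A) (gc_cobracket (gcc k B)).
  apply: etrans (congr1 cobracket_cyc (phi2_union char0 wA wB cB)) _.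
  apply: etrans (linD cobracket_cyc_linear _ _) _.
  apply: (congr2 +%R (cobracket_cyc_hom (gcc k A) (gcc_hom k wB))).
  apply: etrans (linZ _ cobracket_cyc_linear _) _.
  exact: (congr1 _ (cobracket_cyc_hom (gcc k B) (gcc_hom k wA))).
rewrite -(Phi3_union_diag wA wB cA cB) -(Phi3_union_diag wB wA cB cA).
rewrite scalerA [(-1) ^+ _ * _]mulrC -scalerA -scalerDr; congr (_ *: _).
rewrite /contraction_sum hs_union big_cat !big_map (linD Phi3_linear); congr (_ + _).
  rewrite (lin_sum _ _ _ Phi3_linear); apply: eq_big_seq => x xA.
  rewrite big_cat !big_map (linD Phi3_linear) !(lin_sum _ _ _ Phi3_linear) /=.
  rewrite [X in _ + X]big1_seq ?addr0 // => y /= yB.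
  have [xU yU] : inG x \in hs (A ** B) /\ inH y \in hs (A ** B) by rewrite !union_simp.
  exact: (Phi3_ctr0 wU xU yU (union_glued wA wB cA cB xA yB)).
rewrite (lin_sum _ _ _ Phi3_linear) scaler_sumr; apply: eq_big_seq => x xB.
rewrite big_cat !big_map (linD Phi3_linear) !(lin_sum _ _ _ Phi3_linear) /=.
rewrite [X in X + _]big1_seq ?add0r => [|y /= yA].
  rewrite scaler_sumr; apply: eq_big_seq => y yB.
  have wU' := wf_union wB wA.
  rewrite -!(union_swap_inG _) -(linZ _ Phi3_linear) mulnC -signr_odd -(union_swap_sign wB wA).
  by rewrite -(ctr_iso k wU' wU (union_swap_iso B A)) ?union_simp.
have [yU xU] : inG y \in hs (A ** B) /\ inH x \in hs (A ** B) by rewrite !union_simp.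
apply: (Phi3_ctr0 wU xU yU) => S cS /esym E.
exact: (union_glued wA wB cA cB yA xB cS E).
Qed.

(** A second cobracket is a second contraction: a disconnected contraction is a union of two
    connected graphs, as in [Phi3_contraction_union], and for a connected one both sides vanish. *)
Lemma cobracket_cyc_contract P x y : graph_wf P -> connected P -> x \in hs P -> y \in hs P ->
  cobracket_cyc (Phi2 (ctr k P x y)) = 2%:R^-1 *: Phi3 (hg_contraction (ctr k P x y)).
Proof.
move=> wP cP xP yP; rewrite (Phi2_ctr k wP xP yP) ctrE; have lh := @hg_contraction_linear k.
case: ifPn => vw; first by rewrite (lin0 cobracket_cyc_linear) (lin0 lh) (lin0 Phi3_linear) scaler0.
have wC := wf_contract wP xP yP vw.
rewrite (linZ _ cobracket_cyc_linear) (linZ _ lh) (linZ _ Phi3_linear) scalerA mulrC -scalerA.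
congr (_ *: _).
have [cC|[A [B [wA cA wB cB iso]]]] := contract_split_cases wP xP yP vw
    (connected_glued (x := x) (y := y) wP cP).
  rewrite (phi2_connected k wC cC) (lin0 cobracket_cyc_linear).
  rewrite /hg_contraction (hglift_hgd (@contraction_sum_covariant k) wC).
  rewrite (lin_sum _ _ _ Phi3_linear) big1_seq ?scaler0 // => z /= zC.
  rewrite (lin_sum _ _ _ Phi3_linear) big1_seq // => t /= tC.
  by apply: Phi3_ctr0 => //; apply: connected_glued.
have wU := wf_union wA wB.
rewrite (phi2_covariant k wU wC iso) (hgd_covariant k wU wC iso) (linZ _ cobracket_cyc_linear).
rewrite (linZ _ lh) (linZ _ Phi3_linear) [RHS]scalerA mulrC -scalerA; congr (_ *: _).
rewrite /hg_contraction (hglift_hgd (@contraction_sum_covariant k) wU).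
by rewrite (Phi3_contraction_union wA wB cA cB).
Qed.

Lemma gc_cojacobi p : cobracket_cyc (gc_cobracket p) = 0.
Proof.
move: p; apply: (@gc_ind_lin k _ (fun p => cobracket_cyc (gc_cobracket p)) (fun=> 0)).
- exact: lin_comp cobracket_cyc_linear (gc_cobracket_linear char0).
- by move=> a u v; rewrite scaler0 addr0.
move=> P wP cP _; rewrite (gc_cobracketE char0 wP cP) (linZ _ cobracket_cyc_linear).
have -> : cobracket_cyc (Phi2 (contraction_sum k P)) =
    2%:R^-1 *: Phi3 (ctr2_sum k P (hs P) (hs P) (hs P) (hs P)).
  rewrite /contraction_sum /ctr2_sum !(lin_sum _ _ _ (@Phi2_linear k)).
  rewrite (lin_sum _ _ _ cobracket_cyc_linear) (lin_sum _ _ _ Phi3_linear) scaler_sumr.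
  apply: eq_big_seq => x xP.
  rewrite !(lin_sum _ _ _ (@Phi2_linear k)).
  rewrite (lin_sum _ _ _ cobracket_cyc_linear) (lin_sum _ _ _ Phi3_linear) scaler_sumr.
  apply: eq_big_seq => y yP.
  by rewrite (cobracket_cyc_contract wP cP xP yP) (hg_contraction_ctr k wP xP yP).
have s0 : {subset hs P <= hs P} by [].
(* The sum over all ordered pairs of contractions is its own opposite when the two contractions are
   exchanged. *)
have E := opp_eq0 (ctr2_sum_anti k wP s0 s0 s0 s0).
by rewrite E (lin0 Phi3_linear) !scaler0.
Qed.

End Triple.

End CoJacobi.

(** * Compatibility *)

Section Compatibility.
Variables (k : fieldType) (char0 : [pchar k] =i pred0).
Notation T2 := (tensor (GC k) (GC k)).

(* For w of degree h and w' of degree g, brl h w X is [X, w] and brr g w' X is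
   [w', X] in the notation of the compatibility condition. *)
Definition brl_term (h : nat) (w : GC k) (a b : nat) (u v : GC k) : T2 :=
  (-1) ^+ a *: (u \ox gc_bracket v w) + (-1) ^+ (b * h) *: (gc_bracket u w \ox v).

Lemma brl_lin1 h w a b v : linear (fun u => brl_term h w a b u v).
Proof.
exact: (lin_add (lin_scale _ (tpure_linl _))
  (lin_scale _ (lin_comp (tpure_linl v) (gc_bracket_linearl w)))).
Qed.
Lemma brl_lin2 h w a b u : linear (brl_term h w a b u).
Proof.
exact: (lin_add (lin_scale _ (lin_comp (tpure_linr u) (gc_bracket_linearl w)))
  (lin_scale _ (tpure_linr _))).
Qed.
Lemma brl_linw h a b u v : linear (fun w => brl_term h w a b u v).
Proof.
exact: (lin_add (lin_scale _ (lin_comp (tpure_linr u) (gc_bracket_linearr v)))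
  (lin_scale _ (lin_comp (tpure_linl v) (gc_bracket_linearr u)))).
Qed.

Definition brl (h : nat) (w : GC k) : T2 -> T2 := tgext (brl_term h w).

Lemma brl_linear h w : linear (brl h w).
Proof. exact: (tgext_linear (brl_lin1 h w) (brl_lin2 h w)). Qed.
Lemma brl_hom h w a b u v : u \in @GC_hom k a -> v \in @GC_hom k b ->
  brl h w (u \ox v) = brl_term h w a b u v.
Proof. exact: (tgext_hom (brl_lin1 h w) (brl_lin2 h w)). Qed.
Lemma brl_linearw h X : linear (fun w => brl h w X).
Proof.
have cE w : brl h w X = tlift (gext2 (brl_term h w)) X := tgextE _ X.
move=> s w w'; rewrite !cE -[RHS](tlift_funD (gext2 (brl_term h w)) (gext2 (brl_term h w'))).
apply: eq_tlift => u v; rewrite -(gext2_funD (brl_term h w) (brl_term h w')).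
apply: eq_gext => n u'; apply: eq_gext => n' v'.
exact: brl_linw.
Qed.

Definition brr_term (g : nat) (w : GC k) (a b : nat) (u v : GC k) : T2 :=
  gc_bracket w u \ox v + (-1) ^+ (g * a + a) *: (u \ox gc_bracket w v).
Lemma brr_lin1 h w a b v : linear (fun u => brr_term h w a b u v).
Proof.
exact: (lin_add (lin_comp (tpure_linl v) (gc_bracket_linearr w)) (lin_scale _ (tpure_linl _))).
Qed.
Lemma brr_lin2 h w a b u : linear (brr_term h w a b u).
Proof.
exact: (lin_add (tpure_linr _) (lin_scale _ (lin_comp (tpure_linr u) (gc_bracket_linearr w)))).
Qed.
Definition brr (h : nat) (w : GC k) : T2 -> T2 := tgext (brr_term h w).
Lemma brr_linear h w : linear (brr h w).
Proof. exact: (tgext_linear (brr_lin1 h w) (brr_lin2 h w)). Qed.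
Lemma brr_hom h w a b u v : u \in @GC_hom k a -> v \in @GC_hom k b ->
  brr h w (u \ox v) = brr_term h w a b u v.
Proof. exact: (tgext_hom (brr_lin1 h w) (brr_lin2 h w)). Qed.

Lemma scalerD_A (V : lmodType k) (p q : k) (u v : V) :
  p *: (u + q *: v) = p *: u + (p * q) *: v.
Proof. by rewrite scalerDr scalerA. Qed.

(** The terms of the bracket of [A . B] with [R] that use a half-edge of [A]. First [R] is moved
    past [B]; then [B] is a component beside the contraction of [A] with [R]. *)
Lemma phi2_bracket_piece A B R : graph_wf A -> graph_wf B -> graph_wf R ->
  connected A -> connected B -> connected R ->
  Phi2 (\sum_(x <- hs A) \sum_(y <- hs R) ctr k (A ** B ** R) (inG (inG x)) (inH y))
  = (-1) ^+ (size (vs B) * size (vs R)) *: (gc_bracket (gcc k A) (gcc k R) \ox gcc k B)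
    + (-1) ^+ (size (vs A) * size (vs B) + size (vs B)) *: (gcc k B \ox gc_bracket (gcc k A) (gcc k R)).
Proof.
move=> wA wB wR cA cB cR.
have w1 := wf_union (wf_union wA wB) wR; have w2 := wf_union wA wR.
have w3 := wf_union w2 wB; have iso := union_swap23_iso A B R.
set a := size (vs A); set b := size (vs B); set r := size (vs R).
pose F (u : GC k) : T2 := (-1) ^+ (b * r) *: (u \ox gcc k B)
  + (-1) ^+ (a * b + b) *: (gcc k B \ox u).
have lF : linear F := lin_add (lin_scale _ (tpure_linl _)) (lin_scale _ (tpure_linr _)).
rewrite -[RHS]/(F (gc_bracket (gcc k A) (gcc k R))) (gc_bracketE k wA cA wR cR).
rewrite /bracket_sum (lin_sum _ _ _ (@Phi1_linear k)) (lin_sum _ _ _ lF).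
rewrite (lin_sum _ _ _ (@Phi2_linear k)); apply: eq_big_seq => x xA.
rewrite (lin_sum _ _ _ (@Phi1_linear k)) (lin_sum _ _ _ lF).
rewrite (lin_sum _ _ _ (@Phi2_linear k)); apply: eq_big_seq => y yR.
have xU : inG x \in hs (A ** R) by rewrite union_simp.
have yU : inH y \in hs (A ** R) by rewrite union_simp.
have xW : inG (inG x) \in hs (A ** B ** R) by rewrite !union_simp.
have yW : inH y \in hs (A ** B ** R) by rewrite !union_simp.
have E : ctr k (A ** B ** R) (inG (inG x)) (inH y) =
    (-1) ^+ (b * r) *: ctr k (A ** R ** B) (inG (inG x)) (inG (inH y)).
  have := ctr_iso k w1 w3 iso xW yW; rewrite !union_swap23E => ->.
  by rewrite (union_swap23_sign wA wB wR) scalerA signr_odd -exprD addnn -signr_odd odd_double scale1r.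
have vw := negPf (union_term_neq A R x y).
rewrite E (linZ _ (@Phi2_linear k)) (ctr_unionl k _ w2 wB yU) (Phi1_ctr k w2 xU yU) vw.
have wC := wf_contract w2 xU yU (negbT vw).
rewrite (linZ _ (@Phi2_linear k)) (Phi2_hgd k (wf_union wC wB)) (linZ _ lF) scalerA mulrC -scalerA.
congr (_ *: _); rewrite (phi2_union char0 wC wB cB) /F.
apply: etrans (scalerD_A _ _ _ _) _; apply: (congr2 +%R (erefl _)).
apply: (congr1 (fun c : k => c *: (gcc k B \ox gcc k (contract (A ** R) (inG x) (inH y)) : T2))).
rewrite -exprD.
(* The contraction has [a + r - 1] vertices; the [- 1] is the origin of the summand [b] in the
   exponent. *)
have sC := size_contract w2 (inG x) yU; rewrite size_union -/a -/r in sC.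
rewrite -/b -[LHS]signr_odd -[RHS]signr_odd; congr (_ ^+ nat_of_bool _).
have : odd (size (vs (contract (A ** R) (inG x) (inH y)))) = ~~ (odd a (+) odd r).
  by rewrite -oddD -sC /= negbK.
by rewrite !oddD !oddM => ->; case: (odd a); case: (odd b); case: (odd r).
Qed.

Lemma bracket_sum_unionl A B R : graph_wf A -> graph_wf B -> graph_wf R ->
  bracket_sum k (A ** B) R =
  \sum_(x <- hs A) \sum_(y <- hs R) ctr k (A ** B ** R) (inG (inG x)) (inH y)
  + (-1) ^+ (size (vs A) * size (vs B)) *:
    \sum_(x <- hs B) \sum_(y <- hs R) ctr k (B ** A ** R) (inG (inG x)) (inH y).
Proof.
move=> wA wB wR; rewrite /bracket_sum hs_union big_cat !big_map /=; congr (_ + _).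
rewrite scaler_sumr; apply: eq_big_seq => x xB.
rewrite scaler_sumr; apply: eq_big_seq => y yR.
have wBA := wf_union wB wA; have wAB := wf_union wA wB.
have iso := union_graph_iso (union_swap_iso B A) (iso_refl R).
have s2 := union_iso_sign wAB wR (union_swap_iso B A) (iso_refl R).
rewrite (union_swap_sign wB wA) (iso_sign_refl wR) addbF in s2.
have xW : inG (inG x) \in hs (B ** A ** R) by rewrite !union_simp.
have yW : inH y \in hs (B ** A ** R) by rewrite !union_simp.
have := ctr_iso k (wf_union wBA wR) (wf_union wAB wR) iso xW yW.
by rewrite union_map_inG union_map_inH union_swap_inG s2 signr_odd mulnC.
Qed.

(** The bracket with [R] is a graded derivation of the disjoint union, because a contraction with
    [R] uses a half-edge of [A] or one of [B]. *)
Lemma brl_phi2_union A B R : graph_wf A -> graph_wf B -> graph_wf R ->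
  connected A -> connected B -> connected R ->
  brl (size (vs R)) (gcc k R) (phi2 k (A ** B)) = Phi2 (bracket_sum k (A ** B) R).
Proof.
move=> wA wB wR cA cB cR; rewrite (bracket_sum_unionl wA wB wR).
rewrite (linD (@Phi2_linear k)) (linZ _ (@Phi2_linear k)).
rewrite (phi2_bracket_piece wA wB wR cA cB cR) (phi2_bracket_piece wB wA wR cB cA cR).
apply: etrans (congr1 (brl _ _) (phi2_union char0 wA wB cB)) _.
apply: etrans (linD (brl_linear _ _) _ _) _.
apply: etrans (congr2 +%R (brl_hom _ _ (gcc_hom k wA) (gcc_hom k wB))
  (etrans (linZ _ (brl_linear _ _) _)
     (congr1 _ (brl_hom _ _ (gcc_hom k wB) (gcc_hom k wA))))) _.
rewrite /brl_term.
set a := size (vs A); set b := size (vs B); set r := size (vs R).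
set X1 : T2 := gcc k A \ox _; set X2 : T2 := _ \ox gcc k B.
set X3 : T2 := gcc k B \ox _; set X4 : T2 := _ \ox gcc k A.
move: X1 X2 X3 X4 => X1 X2 X3 X4.
have H (V : lmodType k) (Y1 Y2 Y3 Y4 : V) :
  (-1) ^+ a *: Y1 + (-1) ^+ (b * r) *: Y2
  + (-1) ^+ (a * b) *: ((-1) ^+ b *: Y3 + (-1) ^+ (a * r) *: Y4) =
  (-1) ^+ (b * r) *: Y2 + (-1) ^+ (a * b + b) *: Y3
  + (-1) ^+ (a * b) *: ((-1) ^+ (a * r) *: Y4 + (-1) ^+ (b * a + a) *: Y1).
  rewrite !scalerDr !scalerA -!exprD addnA [(b * a)%N]mulnC addnn.
  have -> : (-1) ^+ ((a * b).*2 + a) = (-1) ^+ a :> k.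
    by rewrite -signr_odd oddD odd_double signr_odd.
  rewrite [in LHS]addrC -!addrA [RHS]addrCA; congr (_ + _).
  by rewrite [RHS]addrCA; congr (_ + _); rewrite addrC.
exact: H.
Qed.

Lemma brl_contract P R x y : graph_wf P -> graph_wf R -> connected P -> connected R ->
  ~~ has_cut_vertex R -> x \in hs P -> y \in hs P ->
  brl (size (vs R)) (gcc k R) (Phi2 (ctr k P x y)) = Phi2 (hg_bracket (ctr k P x y) (hgd k R)).
Proof.
move=> wP wR cP cR nR xP yP; rewrite (Phi2_ctr k wP xP yP) ctrE.
have lb := hg_bracket_linearl (hgd k R); have lL := brl_linear (size (vs R)) (gcc k R).
case: ifPn => vw; first by rewrite (lin0 lL) (lin0 lb) (lin0 (@Phi2_linear k)).
have wC := wf_contract wP xP yP vw.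
rewrite (linZ _ lL) (linZ _ lb) (linZ _ (@Phi2_linear k)) (hg_bracketE k wC wR); congr (_ *: _).
have [cC|[A [B [wA cA wB cB iso]]]] := contract_split_cases wP xP yP vw
    (connected_glued (x := x) (y := y) wP cP).
  (* A connected first contraction contributes to neither side: as [R] has no cut vertex, the
     contraction with [R] is connected too, and [phi2] kills it. *)
  rewrite (phi2_connected k wC cC) (lin0 lL) /bracket_sum.
  rewrite (lin_sum _ _ _ (@Phi2_linear k)) big1_seq // => z /= zC.
  rewrite (lin_sum _ _ _ (@Phi2_linear k)) big1_seq // => t /= tR.
  have wU := wf_union wC wR.
  have zU : inG z \in hs (contract P x y ** R) by rewrite union_simp.
  have tU : inH t \in hs (contract P x y ** R) by rewrite union_simp.
  have vw' := union_term_neq (contract P x y) R z t.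
  rewrite (Phi2_ctr k wU zU tU) (negPf vw') phi2_connected ?scaler0 //.
    exact: wf_contract.
  exact: connected_union_contract.
have wU := wf_union wA wB.
rewrite (phi2_covariant k wU wC iso) (proj1 (@bracket_sum_covariant k) R wR _ _ _ _ wU wC iso).
by rewrite (linZ _ lL) (linZ _ (@Phi2_linear k)) (brl_phi2_union wA wB wR cA cB cR).
Qed.

Let l1 (P : graph_data) := map inG (hs P).
Let l2 (P : graph_data) := map inH (hs P).

Lemma brl_cobracket P R : graph_wf P -> graph_wf R -> connected P -> connected R ->
  ~~ has_cut_vertex R ->
  brl (size (vs R)) (gcc k R) (gc_cobracket (gcc k P)) =
  2%:R^-1 *: Phi2 (ctr2_sum k (P ** R) (l1 P) (l1 P) (l1 P) (l2 R)).
Proof.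
move=> wP wR cP cR nR; rewrite (gc_cobracketE char0 wP cP) (linZ _ (brl_linear _ _)).
congr (_ *: _); rewrite /contraction_sum /ctr2_sum !(lin_sum _ _ _ (@Phi2_linear k)).
rewrite (lin_sum _ _ _ (brl_linear _ _)) big_map; apply: eq_big_seq => x xP.
rewrite !(lin_sum _ _ _ (@Phi2_linear k)) (lin_sum _ _ _ (brl_linear _ _)).
rewrite big_map; apply: eq_big_seq => y yP.
rewrite (brl_contract wP wR cP cR nR xP yP) (hg_bracket_ctr k wP wR xP yP).
by congr (Phi2 _); rewrite big_map; apply: eq_bigr => z _; rewrite big_map.
Qed.

Lemma l1_sub P R : {subset l1 P <= hs (P ** R)}.
Proof. by move=> _ /mapP[h hP ->]; rewrite union_simp. Qed.
Lemma l2_sub P R : {subset l2 R <= hs (P ** R)}.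
Proof. by move=> _ /mapP[h hP ->]; rewrite union_simp. Qed.

Lemma ctr2_sum_catl P s t a b c : ctr2_sum k P a b (s ++ t) c = ctr2_sum k P a b s c + ctr2_sum k P a b t c.
Proof.
rewrite /ctr2_sum -big_split; apply: eq_bigr => x _ /=.
by rewrite -big_split; apply: eq_bigr => y _ /=; rewrite big_cat.
Qed.
Lemma ctr2_sum_catr P s t a b c : ctr2_sum k P a b c (s ++ t) = ctr2_sum k P a b c s + ctr2_sum k P a b c t.
Proof.
rewrite /ctr2_sum -big_split; apply: eq_bigr => x _ /=.
rewrite -big_split; apply: eq_bigr => y _ /=; rewrite -big_split; apply: eq_bigr => z _ /=.
by rewrite big_cat.
Qed.

(** The contractions in the bracket are connected since [R] has no cut vertex, so theta of each is
    half the image under [Phi2] of all further contractions. *)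
Lemma cobracket_bracket P R : graph_wf P -> graph_wf R -> connected P -> connected R ->
  ~~ has_cut_vertex R ->
  gc_cobracket (gc_bracket (gcc k P) (gcc k R)) =
  2%:R^-1 *: Phi2 (ctr2_sum k (P ** R) (l1 P) (l2 R) (hs (P ** R)) (hs (P ** R))).
Proof.
move=> wP wR cP cR nR; have wU := wf_union wP wR; have lth := gc_cobracket_linear char0.
rewrite (gc_bracketE k wP cP wR cR) /bracket_sum /ctr2_sum.
rewrite !(lin_sum _ _ _ (@Phi1_linear k)) (lin_sum _ _ _ lth) (lin_sum _ _ _ (@Phi2_linear k)).
rewrite scaler_sumr big_map; apply: eq_big_seq => x xP.
rewrite !(lin_sum _ _ _ (@Phi1_linear k)) (lin_sum _ _ _ lth) (lin_sum _ _ _ (@Phi2_linear k)).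
rewrite scaler_sumr big_map; apply: eq_big_seq => y yR.
have xU : inG x \in hs (P ** R) by rewrite union_simp.
have yU : inH y \in hs (P ** R) by rewrite union_simp.
have vw := union_term_neq P R x y.
have wC := wf_contract wU xU yU vw.
have cC : connected (contract (P ** R) (inG x) (inH y)) by apply: connected_union_contract.
rewrite -(hg_contraction_ctr k wU xU yU) (Phi1_ctr k wU xU yU) ctrE (negPf vw).
rewrite (linZ _ lth) (linZ _ (@hg_contraction_linear k)) (linZ _ (@Phi2_linear k)).
rewrite (gc_cobracketE char0 wC cC) /hg_contraction (hglift_hgd (@contraction_sum_covariant k) wC).
by rewrite [LHS]scalerA [RHS]scalerA mulrC.
Qed.

(** Both cobracket terms are written with [brl], so that [brl_cobracket] serves for each of them;
    [brl_brr] later turns the last one into [G, theta(H)]. *)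
Lemma gcc_compatible P R : graph_wf P -> graph_wf R -> connected P -> connected R ->
  ~~ has_cut_vertex P -> ~~ has_cut_vertex R ->
  gc_cobracket (gc_bracket (gcc k P) (gcc k R))
  + brl (size (vs R)) (gcc k R) (gc_cobracket (gcc k P))
  + (-1) ^+ (size (vs P) * size (vs R)) *: brl (size (vs P)) (gcc k P) (gc_cobracket (gcc k R))
  = 0.
Proof.
move=> wP wR cP cR nP nR; have wU := wf_union wP wR; have wU' := wf_union wR wP.
rewrite (cobracket_bracket wP wR cP cR nR) (brl_cobracket wP wR cP cR nR).
rewrite (brl_cobracket wR wP cR cP nP) hs_union -/(l1 P) -/(l2 R).
rewrite !(ctr2_sum_catl, ctr2_sum_catr).
have s1 := @l1_sub P R; have s2 := @l2_sub P R.
have s1' := @l1_sub R P; have s2' := @l2_sub R P.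
pose S := ctr2_sum k (P ** R).
(* The second contraction of theta[G, H] has four types. Those again between [P] and [R] give a sum
   equal to its own opposite; those inside [P] or inside [R] cancel against the other two terms. *)
have E12 : S (l1 P) (l2 R) (l1 P) (l2 R) = 0.
  exact: (opp_eq0 char0 (ctr2_sum_anti k wU s1 s2 s1 s2)).
have E21 : S (l1 P) (l2 R) (l2 R) (l1 P) = 0.
  by rewrite /S (ctr2_sum_swapr k wU s1 s2 s1 s2).
have E11 : S (l1 P) (l1 P) (l1 P) (l2 R) = - S (l1 P) (l2 R) (l1 P) (l1 P).
  exact: (ctr2_sum_anti k wU s1 s1 s1 s2).
have mE : [/\ map union_swap (l1 R) = l2 R & map union_swap (l2 P) = l1 P].
  split; rewrite /l1 /l2 -map_comp; apply: eq_map => n; [exact: union_swap_inG|exact: union_swap_inH].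
have E22 : (-1) ^+ (size (vs P) * size (vs R)) *: ctr2_sum k (R ** P) (l1 R) (l1 R) (l1 R) (l2 P)
    = - S (l1 P) (l2 R) (l2 R) (l2 R).
  have := ctr2_sum_iso k wU' s1' s1' s1' s2' wU (union_swap_iso R P).
  rewrite (union_swap_sign wR wP) signr_odd mulnC mE.1 mE.2 => <-.
  rewrite -[LHS]/(S (l2 R) (l2 R) (l2 R) (l1 P)) /S (ctr2_sum_anti k wU s2 s2 s2 s1).
  by rewrite (ctr2_sum_swapl k wU s1 s2 s2 s2).
rewrite -/(S (l1 P) (l1 P) (l1 P) (l2 R)) -/S E12 E21 E11 addr0 add0r.
have e (a b : k) (v : T2) : a *: (b *: v) = b *: (a *: v) by rewrite !scalerA mulrC.
rewrite e -(linZ ((-1) ^+ _) (@Phi2_linear k)) E22 !(linN (@Phi2_linear k)) (linD (@Phi2_linear k)).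
rewrite -!scalerDr; have H (V : lmodType k) (u v : V) : u + v - u - v = 0.
  by rewrite addrAC addrK addrN.
by rewrite H scaler0.
Qed.

Definition tensor_hom (n : nat) (X : T2) : Prop :=
  exists2 s : seq (homog (@GC_hom k) * homog (@GC_hom k)), X = tsum s
    & all (fun p => (deg p.1 + deg p.2).+1 == n) s.

Lemma tensor_homD n X Y : tensor_hom n X -> tensor_hom n Y -> tensor_hom n (X + Y).
Proof.
move=> [s -> hs] [t -> ht]; exists (s ++ t); last by rewrite all_cat hs ht.
by rewrite /tsum big_cat.
Qed.

Lemma tensor_hom0 n : tensor_hom n 0.
Proof. by exists [::] => //; rewrite /tsum big_nil. Qed.

Lemma tensor_homZ n c X : tensor_hom n X -> tensor_hom n (c *: X).
Proof.
move=> [s -> hs].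
have cP (u : homog (@GC_hom k)) : c *: homog_val u \in @GC_hom k (deg u) by rewrite rpredZ ?homogP.
exists [seq (Homog (cP p.1), p.2) | p <- s]; last by rewrite all_map.
rewrite /tsum big_map scaler_sumr; apply: eq_bigr => p _.
exact: (esym (linZ _ (tpure_linl _) _)).
Qed.

Lemma tensor_hom_sum n (s : seq nat) (F : nat -> T2) :
  {in s, forall x, tensor_hom n (F x)} -> tensor_hom n (\sum_(x <- s) F x).
Proof.
move=> h; rewrite big_seq; elim/big_ind: _ => //; [exact: tensor_hom0|exact: tensor_homD].
Qed.

Lemma tensor_hom_gcc P R : graph_wf P -> graph_wf R ->
  tensor_hom (size (vs P) + size (vs R)).+1 (gcc k P \ox gcc k R).
Proof.
move=> wP wR; exists [:: (Homog (gcc_hom k wP), Homog (gcc_hom k wR))].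
  by rewrite /tsum big_seq1.
by rewrite /= eqxx.
Qed.

Lemma gc_cobracket_hom n u : u \in @GC_hom k n -> tensor_hom n (gc_cobracket u).
Proof.
have lth := gc_cobracket_linear char0.
move=> /asboolP[s [sX ->]]; rewrite (lin_sum _ _ _ lth) big_seq.
elim/big_ind: _ => [|X Y|p /sX[[[P wP] cP] /= sP ->]]; [exact: tensor_hom0|exact: tensor_homD|].
rewrite -gcc_gc (linZ _ lth) (gc_cobracketE char0 wP cP); do 2 apply: tensor_homZ.
rewrite /contraction_sum (lin_sum _ _ _ (@Phi2_linear k)); apply: tensor_hom_sum => x xP.
rewrite (lin_sum _ _ _ (@Phi2_linear k)); apply: tensor_hom_sum => y yP.
rewrite (Phi2_ctr k wP xP yP); case: ifPn => vw; first exact: tensor_hom0.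
apply: tensor_homZ; have wC := wf_contract wP xP yP vw.
have [cC|[A [B [wA cA wB cB iso]]]] := contract_split_cases wP xP yP vw
    (connected_glued (x := x) (y := y) wP cP).
  by rewrite (phi2_connected k wC cC); apply: tensor_hom0.
rewrite (phi2_covariant k (wf_union wA wB) wC iso); apply: tensor_homZ.
rewrite (phi2_union char0 wA wB cB).
have nE : n = (size (vs A) + size (vs B)).+1.
  by rewrite -sP -(size_contract wP x yP) -(iso_size iso) size_union.
rewrite nE; apply: tensor_homD; first exact: tensor_hom_gcc.
by apply: tensor_homZ; rewrite addnC; apply: tensor_hom_gcc.
Qed.

Lemma tensor_hom_ind (U : lmodType k) n (F G : T2 -> U) X : linear F -> linear G -> tensor_hom n X ->
  (forall u v : homog (@GC_hom k), (deg u + deg v).+1 = n ->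
     F (homog_val u \ox homog_val v) = G (homog_val u \ox homog_val v)) -> F X = G X.
Proof.
move=> lF lG [s -> sn] FG; rewrite /tsum (lin_sum _ _ _ lF) (lin_sum _ _ _ lG).
elim: s sn => [|[u v] s IHs]; first by rewrite !big_nil.
by move=> /= /andP[/eqP nE /IHs E]; rewrite !big_cons E FG.
Qed.

(** The graded symmetry of the bracket, carried over to tensors. [n] is the degree of an element
    with cobracket [X], so the degrees of the factors of [X] add up to [n - 1]. *)
Lemma brl_brr n g w X : tensor_hom n X ->
  (forall b v, v \in @GC_hom k b -> gc_bracket v w = (-1) ^+ (b * g) *: gc_bracket w v) ->
  (-1) ^+ (g * n) *: brl g w X = (-1) ^+ g *: brr g w X.
Proof.
move=> hX sym.
apply: (tensor_hom_ind (lin_scale _ (brl_linear g w)) (lin_scale _ (brr_linear g w)) hX).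
move=> u v <- /=.
rewrite (brl_hom _ _ (homogP u) (homogP v)) (brr_hom _ _ (homogP u) (homogP v)).
rewrite /brl_term /brr_term (sym _ _ (homogP u)) (sym _ _ (homogP v)).
rewrite (linZ _ (tpure_linl _)) (linZ _ (tpure_linr _)).
set Y : T2 := homog_val u \ox _; set Z : T2 := _ \ox homog_val v.
move: Y Z => Y Z; move: (deg u) (deg v) => a b.
have H (V : lmodType k) (Y1 Z1 : V) :
    (-1) ^+ (g * (a + b).+1) *: ((-1) ^+ a *: ((-1) ^+ (b * g) *: Y1) + (-1) ^+ (b * g) *: ((-1) ^+ (a * g) *: Z1))
    = (-1) ^+ g *: (Z1 + (-1) ^+ (g * a + a) *: Y1).
  rewrite !scalerDr !scalerA -!exprD addrC; congr (_ *: _ + _ *: _);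
    rewrite -[LHS]signr_odd -[RHS]signr_odd; congr (_ ^+ nat_of_bool _);
    by rewrite !(oddD, oddM, oddS) /=; case: (odd a); case: (odd b); case: (odd g).
exact: H.
Qed.

End Compatibility.

(** * The Lie bialgebra axioms *)

Section Structure.
Variables (k : fieldType) (char0 : [pchar k] =i pred0).
Notation T2 := (tensor (GC k) (GC k)).
Notation hom := (@GC_hom k).

Lemma gc_bracket_hom a b n u v : u \in hom a -> v \in hom b -> (a + b)%N = n.+1 ->
  gc_bracket u v \in hom n.
Proof.
move=> /asboolP[s [sX ->]] /asboolP[t [tX ->]] ab.
rewrite (lin_sum _ _ _ (gc_bracket_linearl _)) big_seq; apply: rpred_sum => p /sX[[[P wP] cP] /= sP ->].
rewrite (linZ _ (gc_bracket_linearl _)); apply: rpredZ.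
rewrite (lin_sum _ _ _ (gc_bracket_linearr _)) big_seq; apply: rpred_sum => q /tX[[[R wR] cR] /= sR ->].
rewrite (linZ _ (gc_bracket_linearr _)); apply: rpredZ.
rewrite -!gcc_gc (gc_bracketE k wP cP wR cR) /bracket_sum.
rewrite (lin_sum _ _ _ (@Phi1_linear k)) big_seq; apply: rpred_sum => x xP.
rewrite (lin_sum _ _ _ (@Phi1_linear k)) big_seq; apply: rpred_sum => y yR.
have wU := wf_union wP wR; have vw := union_term_neq P R x y.
have xU : inG x \in hs (P ** R) by rewrite union_simp.
have yU : inH y \in hs (P ** R) by rewrite union_simp.
rewrite (Phi1_ctr k wU xU yU) (negPf vw); apply: rpredZ.
have := gcc_hom k (wf_contract wU xU yU vw).
have := size_contract wU (inG x) yU; rewrite size_union sP sR ab => -[->].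
by [].
Qed.

Lemma GC_hom0 u : u \in hom 0 -> u = 0.
Proof.
move: u; apply: (@hom_ind_lin k _ 0 id (fun=> 0)) => // [a u v|P wP cP _ /size0nil P0].
  by rewrite scaler0 addr0.
by have := connected_nonempty wP cP; rewrite P0.
Qed.

Lemma gc_bracket_sym a b u v : u \in hom a -> v \in hom b ->
  gc_bracket u v = (-1) ^+ (a * b) *: gc_bracket v u.
Proof.
move=> ua vb; move: u ua.
apply: (hom_ind_lin (gc_bracket_linearl v) (lin_scale _ (gc_bracket_linearr v))).
move=> P wP cP _ <-; move: v vb.
apply: (hom_ind_lin (gc_bracket_linearr (gcc k P)) (lin_scale _ (gc_bracket_linearl (gcc k P)))).
move=> R wR cR _ <-.
rewrite (gc_bracketE k wP cP wR cR) (gc_bracketE k wR cR wP cP) (bracket_sumC k wR wP).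
by rewrite (linZ _ (@Phi1_linear k)) mulnC.
Qed.

Lemma gc_jacobi a b c u v w : u \in hom a -> v \in hom b -> w \in hom c ->
  gc_bracket (gc_bracket u v) w + (-1) ^+ (a * (b + c)) *: gc_bracket (gc_bracket v w) u
  + (-1) ^+ (c * (a + b)) *: gc_bracket (gc_bracket w u) v = 0.
Proof.
move=> ua vb wc.
have l0 : linear (fun _ : GC k => 0 : GC k) by move=> s x y; rewrite scaler0 addr0.
have bl := @gc_bracket_linearl k; have br := @gc_bracket_linearr k.
move: u ua; apply: (hom_ind_lin _ l0).
  exact: (lin_add (lin_add (lin_comp (bl w) (bl v)) (lin_scale _ (br _)))
    (lin_scale _ (lin_comp (bl v) (br w)))).
move=> P wP cP nP <-; move: v vb; apply: (hom_ind_lin _ l0).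
  exact: (lin_add (lin_add (lin_comp (bl w) (br _)) (lin_scale _ (lin_comp (bl _) (bl w))))
    (lin_scale _ (br _))).
move=> R wR cR nR <-; move: w wc; apply: (hom_ind_lin _ l0).
  exact: (lin_add (lin_add (br _) (lin_scale _ (lin_comp (bl _) (br _))))
    (lin_scale _ (lin_comp (bl _) (bl _)))).
by move=> Q wQ cQ nQ <-; apply: gcc_jacobi.
Qed.

Lemma lin_tsum (U : lmodType k) (F : T2 -> U) (s : seq (homog hom * homog hom)) : linear F ->
  F (tsum s) = \sum_(p <- s) F (homog_val p.1 \ox homog_val p.2).
Proof. by move=> lF; rewrite /tsum (lin_sum _ _ _ lF). Qed.

Lemma gc_compatible a b u v : u \in hom a -> v \in hom b ->
  gc_cobracket (gc_bracket u v) + brl b v (gc_cobracket u)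
  + (-1) ^+ a *: brr a u (gc_cobracket v) = 0.
Proof.
move=> ua vb.
have <- : (-1) ^+ (a * b) *: brl a u (gc_cobracket v) = (-1) ^+ a *: brr a u (gc_cobracket v).
  apply: brl_brr (gc_cobracket_hom char0 vb) _ => c w wc.
  exact: gc_bracket_sym wc ua.
have l0 : linear (fun _ : GC k => 0 : T2) by move=> s x y; rewrite scaler0 addr0.
have lth := gc_cobracket_linear char0.
move: u ua; apply: (hom_ind_lin _ l0).
  exact: (lin_add (lin_add (lin_comp lth (gc_bracket_linearl v)) (lin_comp (brl_linear b v) lth))
    (lin_scale _ (brl_linearw a _))).
move=> P wP cP nP <-; move: v vb; apply: (hom_ind_lin _ l0).
  exact: (lin_add (lin_add (lin_comp lth (gc_bracket_linearr _)) (brl_linearw _ _))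
    (lin_scale _ (lin_comp (brl_linear _ _) lth))).
by move=> R wR cR nR <-; apply: gcc_compatible.
Qed.

Let T3 := tensor T2 (GC k).
Let m3 : T2 -> GC k -> T3 := @tpure k T2 (GC k).

Lemma gc_graded_lie_bialgebra : graded_lie_bialgebra hom (@gc_bracket k) (@gc_cobracket k).
Proof.
have lth := gc_cobracket_linear char0.
split.
- exact: gc_grading.
- exact: gc_bracket_linearl.
- exact: gc_bracket_linearr.
- exact: lth.
- move=> a b; case E: (deg a + deg b)%N => [|n].
    (* Both degrees are 0, and [GC] is zero in degree 0 because connected graphs are nonempty. *)
    move/eqP: E; rewrite addn_eq0 => /andP[/eqP a0 _].
    have := homogP a; rewrite a0 => /GC_hom0->; exact: lin0 (gc_bracket_linearl _).
  exact: gc_bracket_hom (homogP a) (homogP b) E.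
- by move=> a; apply: gc_cobracket_hom (homogP a).
- by move=> a b; apply: gc_bracket_sym (homogP a) (homogP b).
- by move=> a b c; apply: gc_jacobi (homogP a) (homogP b) (homogP c).
- move=> t tE a; rewrite -(gc_cobracket_flip char0 (homog_val a)) tE (lin_tsum _ (@tflip_linear k)).
  by apply: eq_bigr => p _; apply: esym (tflip_hom (homogP p.1) (homogP p.2)).
- move=> t tE a.
  have ml w : linear (m3^~ w) := tpure_linl w.
  have mr X : linear (m3 X) := tpure_linr X.
  have := gc_cojacobi char0 ml mr (homog_val a).
  rewrite tE (lin_tsum _ (cobracket_cyc_linear char0 ml mr)) => E.
  apply: etrans E; apply: eq_bigr => p _.
  apply: etrans (esym (cobracket_cyc_hom char0 ml mr _ (homogP p.2))).
  rewrite tE (lin_tsum _ (cyc_linear ml mr _ _)); apply: eq_bigr => q _.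
  exact: (esym (cyc_hom ml mr _ _ (homogP q.1) (homogP q.2))).
- move=> t tE g h; have := gc_compatible (homogP g) (homogP h).
  rewrite !tE (lin_tsum _ (brl_linear _ _)) (lin_tsum _ (brr_linear _ _)) => E.
  apply: etrans E; congr (_ + _ + _ *: _).
    by apply: eq_bigr => p _; apply: esym (brl_hom _ _ (homogP p.1) (homogP p.2)).
  by apply: eq_bigr => p _; apply: esym (brr_hom _ _ (homogP p.1) (homogP p.2)).
Qed.

End Structure.

(** * Comparison with the sums over separating pairs *)

Lemma ograph_wf (G : ograph) : graph_wf G.
Proof. by case: G. Qed.

Lemma cgraph_connected (G : cgraph) : connected G.
Proof. by case: G. Qed.

Section FlipEdge.
Variables (Q : graph_data) (e : nat).

(** [contraction_splits] asks for equal orientations; reversing an edge of the first part corrects a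
    wrong sign. *)
Definition flip_edge : graph_data := {|
  vs := vs Q; hs := hs Q; bar := bar Q; term := term Q;
  init := fun h => (h \in [:: e; bar Q e]) (+) init Q h |}.

Hypotheses (wQ : graph_wf Q) (eQ : e \in hs Q).

Lemma mem_flip_edge h : h \in hs Q -> (bar Q h \in [:: e; bar Q e]) = (h \in [:: e; bar Q e]).
Proof.
by move=> hQ; rewrite !inE (bar_eq wQ hQ eQ) (bar_eq wQ hQ (bar_hs wQ eQ)) (barK wQ eQ) orbC.
Qed.

Lemma wf_flip_edge : graph_wf flip_edge.
Proof.
have /and4P[uv uh /allP hP vP] := wQ; apply/and4P; split=> //.
apply/allP => h hQ; have /and5P[a b c d /eqP i] := hP h hQ; apply/and5P; split=> //.
by rewrite /= mem_flip_edge // i addbN.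
Qed.

Lemma connected_flip_edge : connected Q -> connected flip_edge.
Proof. by move=> cQ; rewrite (connected_iso wQ wf_flip_edge (iso_id _ _ _ _)). Qed.

Lemma iso_parity_flip_edge f g P : graph_wf P -> graph_iso f g P Q ->
  iso_parity f g P flip_edge = ~~ iso_parity f g P Q.
Proof.
move=> wP iso; have [h1 h1P h1E] := iso_hs_ex iso eQ.
have barh1 : g (bar P h1) = bar Q e by rewrite -(iso_bar iso h1P) -h1E.
have ginj := iso_hs_inj wQ iso.
rewrite !iso_parityE -addbN; congr (_ (+) _); rewrite /flips.
have mE h : h \in hs P -> (g h \in [:: e; bar Q e]) = (h \in [:: h1; bar P h1]).
  by move=> hP; rewrite !inE -barh1 h1E !(inj_in_eq ginj) ?bar_hs.
have uh := uniq_hs wP; have bP := bar_hs wP h1P; have nb := bar_neq wP h1P.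
rewrite eq_sym in nb; rewrite !(odd_count_rem2 _ uh h1P bP nb).
rewrite (@eq_in_count _ _ (fun h => init P h && ~~ init Q (g h)) [seq h <- hs P | _]); last first.
  move=> h; rewrite mem_filter => /andP[/andP[/negPf n1 /negPf n2] hP] /=.
  by rewrite (mE _ hP) !inE n1 n2.
rewrite -addNb; congr (_ (+) _); rewrite /= !mE // !inE !eqxx orbT /=.
rewrite barh1 -h1E (init_bar wQ eQ) (init_bar wP h1P).
by case: (init P h1); case: (init Q e).
Qed.

End FlipEdge.

Lemma flip_edge_unionl A B e : flip_edge (A ** B) (inG e) = flip_edge A e ** B.
Proof.
apply: graph_data_eq => //; elim/inGH_ind => n.
  rewrite [RHS]init_union [LHS]/(_ (+) init (A ** B) _) !parity_simp.
  by rewrite [RHS]/= !inE !union_simp.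
rewrite [RHS]init_union [LHS]/(_ (+) init (A ** B) _) !parity_simp.
by rewrite !inE !union_simp.
Qed.

(** The direction opposite to [split_iso], since [contraction_splits] asks for an isomorphism from
    the contracted graph to the union. *)
Lemma split_graph_iso P (K : pred nat) : graph_wf P -> closed_set P K ->
  graph_iso (fun v => if K v then inH v else inG v)
    (fun h => if K (term P h) then inH h else inG h) P (restrict P (predC K) ** restrict P K).
Proof.
move=> wP cK.
have pm (a : pred nat) (s : seq nat) :
    perm_eq [seq (if a n then inH n else inG n) | n <- s]
      (map inG [seq n <- s | ~~ a n] ++ map inH [seq n <- s | a n]).
  apply: perm_trans (perm_map _ (perm_split a s)) _; rewrite map_cat.
  rewrite (_ : map _ [seq n <- s | ~~ a n] = map inG [seq n <- s | ~~ a n]).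
    rewrite (_ : map _ [seq n <- s | a n] = map inH [seq n <- s | a n]) //.
    by apply/eq_in_map => n; rewrite mem_filter => /andP[->].
  by apply/eq_in_map => n; rewrite mem_filter => /andP[/negPf->].
split; [exact: pm|exact: (pm (fun h => K (term P h)))| |].
- by move=> h hP; rewrite cK //; case: ifP => _; rewrite !union_simp.
- by move=> h hP; case: ifP => _; rewrite !union_simp.
Qed.

Lemma contraction_splits_ex (G : cgraph) x y : x \in hs G -> y \in hs G -> separating G x y ->
  exists A B : cgraph, contraction_splits G x y A B.
Proof.
move=> xG yG /andP[vw sep]; have wP := ograph_wf G; have cP := cgraph_connected G.
have wD := contract_data_wf wP xG yG vw.
have DE : ograph_data (gcontract G x y) = contract_data (front_data G x y) x y.
  by rewrite /gcontract insubdK.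
have wC := wf_contract wP xG yG vw.
have pv := perm_contract_vs wP xG vw.
have isoC : graph_iso id id (contract G x y) (gcontract G x y).
  by rewrite DE; apply: iso_id; rewrite // perm_sym.
have nC : ~~ connected (contract G x y).
  rewrite -(connected_iso wC (ograph_wf _) isoC) /connected.
  by move: sep; rewrite (eqP cP); case: eqP => // ->.
have [v vC [cA cB]] := contract_split wP xG yG vw (connected_glued (x := x) (y := y) wP cP) nC.
set K := component _ v in cA cB.
have cK : closed_set (contract G x y) K by apply: component_closed.
have [pf pg eb et] := split_graph_iso wC cK.
set f := fun v : nat => _ in pf et; set g := fun h : nat => _ in pg eb et.
have wA := wf_restrict wC (closed_setC cK); have wB := wf_restrict wC cK.
set A := restrict _ (predC K) in cB wA pf pg eb et; set B := restrict _ K in cA wB pf pg eb et.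
have iso : graph_iso f g (gcontract G x y) (A ** B).
  rewrite DE; split=> //; apply: perm_trans pf; exact: perm_map.
have cg (Q : graph_data) (wQ : graph_wf Q) (cQ : connected Q) := CGraph (cgraph_graph := OGraph wQ) cQ.
case: (boolP (iso_parity f g (gcontract G x y) (A ** B) == contract_parity G x y)) => [/eqP p|p].
  by exists (CGraph (cgraph_graph := OGraph wA) cB), (CGraph (cgraph_graph := OGraph wB) cA), (f, g).
(* The orientation is the opposite one, so an edge of [A] is reversed; there is one because [A] is
   nonempty and its vertices have half-edges. *)
have [u uA] : exists u, u \in vs A.
  by have := connected_nonempty wA cB; case: (vs A) => // u s _; exists u; apply: mem_head.
have [e eA _] := has_half_edge wA uA.
have eU : inG e \in hs (A ** B) by rewrite union_simp.
have wU := wf_union wA wB; have wF := wf_flip_edge wA eA.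
have p' : iso_parity f g (gcontract G x y) (flip_edge A e ** B) = contract_parity G x y.
  rewrite -flip_edge_unionl (iso_parity_flip_edge wU eU (ograph_wf _) iso).
  by move: p; case: contract_parity; case: iso_parity.
have cF := connected_flip_edge wA eA cB.
exists (CGraph (cgraph_graph := OGraph wF) cF), (CGraph (cgraph_graph := OGraph wB) cA), (f, g) => //.
Qed.

Section Induced.
Variables (k : fieldType) (char0 : [pchar k] =i pred0).
Notation T2 := (tensor (GC k) (GC k)).

Lemma sum_sym_pairs (U : lmodType k) (s : seq nat) (F : nat -> nat -> U) :
  {in s &, forall x y, F x y = F y x} -> {in s, forall x, F x x = 0} ->
  2%:R^-1 *: \sum_(x <- s) \sum_(y <- s) F x y = \sum_(x <- s) \sum_(y <- s | (x < y)%N) F x y.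
Proof.
move=> sym diag; set X := RHS.
have E : \sum_(x <- s) \sum_(y <- s | (y < x)%N) F x y = X.
  rewrite (exchange_big_dep xpredT) //=; apply: eq_big_seq => x xs.
  by rewrite big_seq_cond [RHS]big_seq_cond; apply: eq_bigr => y /andP[ys _]; apply: sym.
have -> : \sum_(x <- s) \sum_(y <- s) F x y = X + X.
  rewrite -{2}E /X -big_split; apply: eq_big_seq => x xs /=.
  rewrite (bigID (fun y => (x < y)%N)) /=; congr (_ + _).
  rewrite big_mkcond [RHS]big_mkcond; apply: eq_big_seq => y ys /=.
  by case: ltngtP => // ->; rewrite diag.
by rewrite -mulr2n -scaler_nat scalerA mulVf ?scale1r // natr2_neq0.
Qed.

Lemma gc_cobracket_induced : induced_cobracket (@gc_cobracket k).
Proof.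
move=> G; have wP := ograph_wf G; have cP := cgraph_connected G.
(* The parts are chosen for all pairs of numbers at once; [(G, G)] is a dummy value off the
   separating pairs. *)
have /choice[AB ABP] : forall p : nat * nat, exists AB : cgraph * cgraph,
    p.1 \in hs G -> p.2 \in hs G -> separating G p.1 p.2 ->
    contraction_splits G p.1 p.2 AB.1 AB.2.
  move=> p; case: (boolP [&& p.1 \in hs G, p.2 \in hs G & separating G p.1 p.2]).
    by case/and3P => xG yG sep; have [A [B AB]] := contraction_splits_ex xG yG sep; exists (A, B).
  by move=> n; exists (G, G) => xG yG sep; rewrite xG yG sep in n.
exists (fun x y => (AB (x, y)).1), (fun x y => (AB (x, y)).2).
split=> [x y|]; first exact: ABP (x, y).
rewrite -gcc_gc (gc_cobracketE char0 wP cP) /contraction_sum (lin_sum _ _ _ (@Phi2_linear k)).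
under eq_bigr do rewrite (lin_sum _ _ _ (@Phi2_linear k)).
rewrite sum_sym_pairs; last 2 first.
- by move=> x y xG yG; rewrite ctr_swap.
- by move=> x xG; rewrite ctrE eqxx (lin0 (@Phi2_linear k)).
apply: eq_big_seq => x xG; rewrite big_mkcond [RHS]big_mkcond; apply: eq_big_seq => y yG /=.
case: ltnP => //= _; case: (boolP (separating G x y)) => [sep|].
  have /andP[vw _] := sep; have [[f g] /= iso par] := ABP (x, y) xG yG sep.
  have wA := ograph_wf (AB (x, y)).1; have wB := ograph_wf (AB (x, y)).2.
  have cB := cgraph_connected (AB (x, y)).2.
  have wD := ograph_wf (gcontract G x y).
  rewrite -!gcc_gc; apply: etrans (phi2_union char0 wA wB cB).
  rewrite -(contractionE k xG yG) /contraction (negPf vw) (linZ _ (@Phi2_linear k)).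
  rewrite -hgd_hg (Phi2_hgd k wD) (phi2_covariant k wD (wf_union wA wB) iso).
  by rewrite -par iso_parityE.
(* A pair at distinct vertices that is not separating has a connected contraction, on which [phi2]
   vanishes. *)
rewrite /separating negb_and negbK => ns; rewrite (Phi2_ctr k wP xG yG).
case: (boolP (_ == _)) ns => //= vw ns.
have wC := wf_contract wP xG yG vw.
rewrite (phi2_connected k wC) ?scaler0 //.
have isoC : graph_iso id id (contract G x y) (gcontract G x y).
  rewrite /gcontract insubdK; last exact: contract_data_wf.
  by apply: iso_id; rewrite // perm_sym perm_contract_vs.
rewrite -(connected_iso wC (ograph_wf _) isoC) /connected eqn_leq.
move: ns; rewrite (eqP cP) -leqNgt => -> /=; have wD := ograph_wf (gcontract G x y).
have vD : term G x \in vs (gcontract G x y).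
  have := iso_vs isoC; apply; rewrite -(perm_mem (perm_contract_vs wP xG vw)).
  by rewrite /= (negPf vw) eqxx mem_head.
exact: (ncomp_gt0 wD vD).
Qed.

Lemma bracket_sum_HC (G H : cgraph) : has_cut_vertex G -> bracket_sum k G H \in @HC k.
Proof.
move=> hG; have wP := ograph_wf G; have wQ := ograph_wf H.
rewrite /bracket_sum big_seq; apply: rpred_sum => x xG; rewrite big_seq; apply: rpred_sum => y yH.
have wU := wf_union wP wQ; have vw := union_term_neq G H x y.
have xU : inG x \in hs (G ** H) by rewrite union_simp.
have yU : inH y \in hs (G ** H) by rewrite union_simp.
have wC := wf_contract wU xU yU vw.
rewrite ctrE (negPf vw); apply: rpredZ; rewrite -[contract _ _ _]/(ograph_data (OGraph wC)) hgd_hg.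
by apply: mem_span; exists (OGraph wC) => //; apply: cut_union_contract.
Qed.

Lemma gc_bracket_induced : induced_bracket (@gc_bracket k).
Proof.
move=> G H; have wP := ograph_wf G; have wQ := ograph_wf H.
have cP := cgraph_connected G; have cQ := cgraph_connected H.
rewrite graph_bracketE -!gcc_gc.
case: (boolP (has_cut_vertex G)) => hG.
  (* The bracket of the two graphs lies in [HC], so 0 represents its coset. *)
  exists 0; first by rewrite (lin0 (@val_GG_linear k)) sub0r rpredN bracket_sum_HC.
  by rewrite (gcc_cut k wP cP hG) (lin0 (gc_bracket_linearl _)) (lin0 (coset_is_linear _)).
case: (boolP (has_cut_vertex H)) => hH.
  exists 0; first by rewrite (lin0 (@val_GG_linear k)) sub0r rpredN bracket_sumC // rpredZ // bracket_sum_HC.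
  by rewrite (gcc_cut k wQ cQ hH) (lin0 (gc_bracket_linearr _)) (lin0 (coset_is_linear _)).
(* Without cut vertices all contractions are connected, so the bracket itself lies in [GG] and
   represents its coset. *)
have bG : bracket_sum k G H \in Defs.span [set u | exists F : cgraph, u = hg k F].
  rewrite /bracket_sum big_seq; apply: rpred_sum => x xG; rewrite big_seq; apply: rpred_sum => y yH.
  have wU := wf_union wP wQ; have vw := union_term_neq G H x y.
  have xU : inG x \in hs (G ** H) by rewrite union_simp.
  have yU : inH y \in hs (G ** H) by rewrite union_simp.
  have wC := wf_contract wU xU yU vw.
  rewrite ctrE (negPf vw); apply: rpredZ; rewrite -[contract _ _ _]/(ograph_data (OGraph wC)) hgd_hg.
  have cC : connected (OGraph wC) by apply: connected_union_contract.
  by apply: mem_span; exists (CGraph cC).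
exists (Subspace bG : GG k); first by rewrite subrr rpred0.
by rewrite -Phi1_val gc_bracketE.
Qed.

End Induced.

Theorem theorem1p2 (k : fieldType) (char0 : [pchar k] =i pred0) :
  exists (br : GC k -> GC k -> GC k) (th : GC k -> tensor (GC k) (GC k)),
    [/\ induced_bracket br, induced_cobracket th
      & graded_lie_bialgebra (@GC_hom k) br th].
Proof.
exists (@gc_bracket k), (@gc_cobracket k); split.
- exact: gc_bracket_induced.
- exact: gc_cobracket_induced.
- exact: gc_graded_lie_bialgebra.
Qed.
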